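(* For every typed $\lambda$-term $(\Gamma,M)$ one has $(\Gamma^{\mathtt N},M^{\mathtt n})^\circ=(\Gamma,M)^{\mathtt N}$ and $(\Gamma^{\mathtt V},M^{\mathtt v})^\circ\to_{\mathtt{ax}}^*(\Gamma,M)^{\mathtt V}$.
   Context: Ground-structures. Write $\wp$ for par. A ground-structure is a finite directed multigraph (an arc is a conclusion of its tail and a premise of its head) whose nodes carry labels in $\{\mathtt{ax},\mathtt{cut},\mathtt 1,\bot,\otimes,\wp,!,?\mathtt d,?,\bullet\}$ with the following numbers of premises and conclusions: $\mathtt{ax}$: 0 premises, 2 conclusions; $\mathtt{cut}$: 2, 0; $\mathtt 1$ and $\bot$: 0, 1; $\otimes$ and $\wp$: 2, 1; $!$: 0 premises, at least 1 conclusion; $?\mathtt d$: 1, 1; $?$: any number $k\ge0$ of premises (unordered), 1 conclusion; $\bullet$: 1, 0. It is equipped with a total order on the premises of its $\bullet$ nodes (the conclusions of the ground-structure), on the conclusions of each $!$ node (the greatest is its principal port, the others its auxiliary ports), and on the premises of each $\otimes,\wp$ node (left, right). A proof-structure (inductively) is a pair $R=(\mathcal G_R,\mathrm{box}_R)$ of a ground-structure and a function mapping each $!$ node of $\mathcal G_R$ to a proof-structure (its box) with the same number of conclusions, all sets of nodes and arcs being pairwise disjoint. Proof-structures are considered up to isomorphism (renaming of nodes and arcs, and simultaneous reordering of the auxiliary ports of a $!$ node and of the corresponding conclusions of its box). Types. Atoms have a fixed-point-free involution $X\mapsto X^\bot$ and are split into two classes exchanged by it. Formulae of ${!\mathsf{MELL}}$: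 outputs $O::=X\mid{?I}\wp O\mid{!O}$, inputs $I::=X^\bot\mid{!O}\otimes I\mid{?I}$ ($X$ in one class); $(\cdot)^\bot$ is the involutive De Morgan negation with $(A\otimes B)^\bot=A^\bot\wp B^\bot$, $(!A)^\bot={?A^\bot}$; $O\multimap O':=O^\bot\wp O'$. Arcs of the proof-structures below are typed by such formulae in the usual way (dual types at $\mathtt{ax}$ and $\mathtt{cut}$; $A\otimes B$, $A\wp B$ below premises $A,B$; ${?A}$ below a $?\mathtt d$ with premise $A$; a single type ${?A}$ around a $?$ node; conclusions ${?A_1},\dots,{?A_k},{!A}$ for a $!$ node whose box has conclusions ${?A_1},\dots,{?A_k},A$). All of them have exactly one conclusion of output type (the output conclusion, taken as greatest conclusion), and their input conclusions are injectively named by variables (and ordered by a fixed total order on variables). Reductions (each applicable in $\mathcal G_R$ or inside any box). $\to_{\mathtt{ax}}$: a $\mathtt{cut}$ node $c$ has one premise that is a conclusion of an $\mathtt{ax}$ node $m$, its other premise $b$ not being a conclusion of $m$; erase $m,c$ and fuse $b$ with the other conclusion of $m$. $\to_{\mathtt{ax}}^*$ is its reflexive-transitive closure. $\to_?$ is the union of: (fl) merging a $?$ node whose conclusion is a premise of another $?$ node into the latter (its premises become premises of the latter); (er) erasing a $?$ node with exactly one premise (fusing its premise and conclusion); (pu) if the conclusion of a box of a $!$ node $m$ corresponding to an auxiliary port $p$ of $m$ is the conclusion of a $?$ node with $k\ge 0$ premises, then pulling this $?$ node out of the box: its $k$ premises become conclusions of the box, $p$ is replaced by $k$ auxiliary ports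 of $m$, and these are the premises of a new $?$ node outside the box whose conclusion replaces $p$. $\to_?$ is strongly normalizing and confluent; ''$?$-normal form'' refers to it. Simply typed $\lambda$-calculus. Simple types $\sigma,\tau::=X\mid\tau\Rightarrow\sigma$. $\lambda$-terms $M,N::=x\mid\lambda x^\tau M\mid(M)N$, up to $\alpha$-equivalence. Typing, with $\lambda$-contexts $\Gamma=x_1:\tau_1,\dots,x_k:\tau_k$: $\Gamma,x:\tau\vdash x:\tau$; from $\Gamma,x:\tau\vdash M:\sigma$ infer $\Gamma\vdash\lambda x^\tau M:\tau\Rightarrow\sigma$; from $\Gamma\vdash M:\tau\Rightarrow\sigma$ and $\Gamma\vdash N:\tau$ infer $\Gamma\vdash(M)N:\sigma$. $(\Gamma,M)$ is a typed $\lambda$-term if $\Gamma\vdash M:\tau$ is derivable for some (unique) $\tau$. Simply typed bang calculus. $!$-terms: $s,t::=x\mid\lambda x^{!O}t\mid\langle s\rangle t\mid\mathsf{der}\,t\mid t^!$. Typing, with $!$-contexts $\Gamma=x_1:{!O_1},\dots,x_k:{!O_k}$: $\Gamma,x:{!O}\vdash x:O$; from $\Gamma,x:{!O}\vdash t:O'$ infer $\Gamma\vdash\lambda x^{!O}t:{!O}\multimap O'$; from $\Gamma\vdash t:{!O}\multimap O'$ and $\Gamma\vdash s:{!O}$ infer $\Gamma\vdash\langle t\rangle s:O'$; from $\Gamma\vdash t:O$ infer $\Gamma\vdash t^!:{!O}$; from $\Gamma\vdash t:{!O}$ infer $\Gamma\vdash\mathsf{der}\,t:O$. $(\Gamma,t)$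 is a typed $!$-term if it has a (then unique) type. Translations of types, contexts and terms. $X^{\mathtt N}=X$, $(\sigma\Rightarrow\tau)^{\mathtt N}={!\sigma^{\mathtt N}}\multimap\tau^{\mathtt N}$; $X^{\mathtt V}=X$, $(\sigma\Rightarrow\tau)^{\mathtt V}={!\sigma^{\mathtt V}}\multimap{!\tau^{\mathtt V}}$; if $\Gamma=x_1:\tau_1,\dots,x_k:\tau_k$ then $\Gamma^{\mathtt N}=x_1:{!\tau_1^{\mathtt N}},\dots,x_k:{!\tau_k^{\mathtt N}}$ and $\Gamma^{\mathtt V}=x_1:{!\tau_1^{\mathtt V}},\dots,x_k:{!\tau_k^{\mathtt V}}$. Terms: $x^{\mathtt n}=x$, $(\lambda x^\tau M)^{\mathtt n}=\lambda x^{!\tau^{\mathtt N}}M^{\mathtt n}$, $((M)N)^{\mathtt n}=\langle M^{\mathtt n}\rangle(N^{\mathtt n})^!$; $x^{\mathtt v}=x^!$, $(\lambda x^\tau M)^{\mathtt v}=(\lambda x^{!\tau^{\mathtt V}}M^{\mathtt v})^!$, $((M)N)^{\mathtt v}=\langle\mathsf{der}\,M^{\mathtt v}\rangle N^{\mathtt v}$. Constructions on proof-nets. For a $!$-context $\Gamma=x_1:{!O_1},\dots,x_k:{!O_k}$: - $\mathrm{Var}_{x_j}(\Gamma)$: an $\mathtt{ax}$ node with conclusions $O_j^\bot,O_j$; a $?\mathtt d$ node below $O_j^\bot$ with conclusion ${?O_j^\bot}$ named $x_j$; for $i\neq j$ a $?$ node without premises with conclusion ${?O_i^\bot}$ named $x_i$;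 output conclusion $O_j$. - $\lambda x\,R$: add a $\wp$ node with left premise the input conclusion of $R$ named $x$ and right premise its output conclusion. - $R^!$: the $?$-normal form of a single $!$ node with box $R$ (names kept). - $\mathrm{App}(R_1,R_2)$, for output conclusions of types ${!O}\multimap O'$ and ${!O}$: add an $\mathtt{ax}$ node with conclusions $O'^\bot,O'$, a $\otimes$ node with left premise the output conclusion of $R_2$ and right premise $O'^\bot$, a $\mathtt{cut}$ node between the conclusion of the $\otimes$ and the output conclusion of $R_1$; for each variable $x$ join the input conclusions of $R_1,R_2$ named $x$ by a $?$ node with conclusion named $x$; take the $?$-normal form. Output conclusion $O'$. - $\mathrm{App}_{\mathtt d}(R_1,R_2)$, for output conclusions of types ${!({!O}\multimap O')}$ and ${!O}$: same as $\mathrm{App}$ except that a $?\mathtt d$ node is added below the $\otimes$ node and the $\mathtt{cut}$ node is between the conclusion of that $?\mathtt d$ node and the output conclusion of $R_1$. - $\mathrm{Der}(R)$, for output conclusion of type ${!O}$: add an $\mathtt{ax}$ node with conclusions $O^\bot,O$, a $?\mathtt d$ node below $O^\bot$, and a $\mathtt{cut}$ node between the conclusion of the $?\mathtt d$ node and the output conclusion of $R$. Output conclusion $O$. Translations into proof-nets. For typed $!$-terms: $(\Gamma,x)^\circ=\mathrm{Var}_x(\Gamma)$; $(\Gamma,\lambda x^{!O}s)^\circ=\lambda x\,((\Gamma,x:{!O}),s)^\circ$; $(\Gamma,\langle t_1\rangle t_2)^\circ=\mathrm{App}((\Gamma,t_1)^\circ,(\Gamma,t_2)^\circ)$; $(\Gamma,\mathsf{der}\,s)^\circ=\mathrm{Der}((\Gamma,s)^\circ)$;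 $(\Gamma,s^!)^\circ=((\Gamma,s)^\circ)^!$. For typed $\lambda$-terms: $(\Gamma,x)^{\mathtt N}=\mathrm{Var}_x(\Gamma^{\mathtt N})$; $(\Gamma,\lambda x^\tau N)^{\mathtt N}=\lambda x\,((\Gamma,x:\tau),N)^{\mathtt N}$; $(\Gamma,(M_1)M_2)^{\mathtt N}=\mathrm{App}((\Gamma,M_1)^{\mathtt N},((\Gamma,M_2)^{\mathtt N})^!)$; and $(\Gamma,x)^{\mathtt V}=(\mathrm{Var}_x(\Gamma^{\mathtt V}))^!$; $(\Gamma,\lambda x^\tau N)^{\mathtt V}=(\lambda x\,((\Gamma,x:\tau),N)^{\mathtt V})^!$; $(\Gamma,(M_1)M_2)^{\mathtt V}=\mathrm{App}_{\mathtt d}((\Gamma,M_1)^{\mathtt V},(\Gamma,M_2)^{\mathtt V})$. *)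

(* Defs.v *)
From Stdlib Require Import Permutation ClassicalEpsilon.
From HB Require Import structures.
From mathcomp Require Import all_boot.

Set Implicit Arguments.
Unset Strict Implicit.
Unset Printing Implicit Defensive.

(** * Formulae of !MELL *)

(* [X : nat] ranges over the positive class of atoms, and [IAtom X] is the dual
   atom of [OAtom X].  [OPar J A] is ?J par A, [ITens A J] is !A tensor J. *)
Inductive output : Type :=
| OAtom of nat
| OPar of input & output
| OBang of output
with input : Type :=
| IAtom of nat
| ITens of output & input
| IWhy of input.

Fixpoint negO (A : output) : input :=
  match A with
  | OAtom X => IAtom X
  | OPar J A => ITens (negI J) (negO A)
  | OBang A => IWhy (negO A)
  end
with negI (J : input) : output :=
  match J with
  | IAtom X => OAtom X
  | ITens A J => OPar (negO A) (negI J)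
  | IWhy J => OBang (negI J)
  end.

(* !A -o A', that is ?(A^perp) par A' *)
Definition blimp (A A' : output) : output := OPar (negO A) A'.

Inductive formula : Type := Out of output | In of input.

Fixpoint output_eq_dec (A B : output) {struct A} : {A = B} + {A <> B}
with input_eq_dec (A B : input) {struct A} : {A = B} + {A <> B}.
Proof. all: decide equality; exact: PeanoNat.Nat.eq_dec. Defined.

Lemma formula_eq_dec (A B : formula) : {A = B} + {A <> B}.
Proof. decide equality; [exact: output_eq_dec | exact: input_eq_dec]. Defined.

HB.instance Definition _ := hasDecEq.Build formula (compareP formula_eq_dec).

(** * Proof-structures *)

(* An arc is an identifier together with its type. *)
Definition garc : Type := (seq nat * formula)%type.

(* A ground-structure is the list of its nodes, each given with its premises and
   conclusions, plus the list of its conclusions.  A bullet node is represented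
   by its unique premise: [cs] in [PS ns cs] lists the premises of the bullet
   nodes, in order.  The box of a ! node is stored in the node; each box has its
   own arc identifiers.  The order of the arcs of Ax, Cut and of the premises of
   Why is immaterial (see [niso]). *)
Inductive pstruct : Type :=
| PS of seq node & seq garc
with node : Type :=
| Ax (a b : garc)
| Cut (a b : garc)
| One (c : garc)
| Bot (c : garc)
| Tens (l r c : garc)
| Par (l r c : garc)
| Bang (box : pstruct) (aux : seq garc) (principal : garc)
| Der (p c : garc)
| Why (ps : seq garc) (c : garc).

Definition nodes (R : pstruct) : seq node := let: PS ns _ := R in ns.
Definition concl (R : pstruct) : seq garc := let: PS _ cs := R in cs.

Definition node_prems (n : node) : seq garc :=
  match n with
  | Ax _ _ | One _ | Bot _ | Bang _ _ _ => [::]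
  | Cut a b => [:: a; b]
  | Tens l r _ | Par l r _ => [:: l; r]
  | Der p _ => [:: p]
  | Why ps _ => ps
  end.

Definition node_concls (n : node) : seq garc :=
  match n with
  | Ax a b => [:: a; b]
  | Cut _ _ => [::]
  | One c | Bot c | Tens _ _ c | Par _ _ c | Der _ c | Why _ c => [:: c]
  | Bang _ aux p => rcons aux p
  end.

Definition tails (R : pstruct) : seq garc := flatten (map node_concls (nodes R)).
Definition heads (R : pstruct) : seq garc :=
  flatten (map node_prems (nodes R)) ++ concl R.
Definition arcs (R : pstruct) : seq garc := tails R ++ heads R.

(* Elements of [pstruct] that are incidence data of actual proof-structures:
   every arc has exactly one tail and one head, and every ! node has as many
   conclusions as its box.  The nets associated with typed terms below are such,
   and the reductions preserve this condition. *)
Fixpoint well_formed (R : pstruct) : bool :=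
  let: PS ns cs := R in
  [&& uniq (tails (PS ns cs)), perm_eq (tails (PS ns cs)) (heads (PS ns cs))
    & all well_formed_node ns]
with well_formed_node (n : node) : bool :=
  match n with
  | Bang B aux _ => (size (concl B) == (size aux).+1) && well_formed B
  | _ => true
  end.

(** * Isomorphism *)

(* [iso] is given by a type-preserving renaming [g] of the arcs and a bijection
   between the nodes; it respects the order of the conclusions.  For ! nodes, the
   auxiliary ports [aux] and the corresponding conclusions [l] of the box may be
   reordered simultaneously: [z] permutes the list of pairs. *)
Inductive iso : pstruct -> pstruct -> Prop :=
| Iso (g : garc -> garc) ns ns1 ns' cs :
    {in arcs (PS ns cs) &, injective g} ->
    {in arcs (PS ns cs), forall a, (g a).2 = a.2} ->
    List.Forall2 (niso g) ns ns1 -> Permutation ns1 ns' ->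
    iso (PS ns cs) (PS ns' (map g cs))
with niso : (garc -> garc) -> node -> node -> Prop :=
| iAx g a b : niso g (Ax a b) (Ax (g a) (g b))
| iAxC g a b : niso g (Ax a b) (Ax (g b) (g a))
| iCut g a b : niso g (Cut a b) (Cut (g a) (g b))
| iCutC g a b : niso g (Cut a b) (Cut (g b) (g a))
| iOne g c : niso g (One c) (One (g c))
| iBot g c : niso g (Bot c) (Bot (g c))
| iTens g l r c : niso g (Tens l r c) (Tens (g l) (g r) (g c))
| iPar g l r c : niso g (Par l r c) (Par (g l) (g r) (g c))
| iDer g p c : niso g (Der p c) (Der (g p) (g c))
| iWhy g ps qs c : perm_eq qs (map g ps) -> niso g (Why ps c) (Why qs (g c))
| iBang g bns l c aux p B z :
    size l = size aux -> perm_eq z (zip l aux) ->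
    iso (PS bns (rcons (unzip1 z) c)) B ->
    niso g (Bang (PS bns (rcons l c)) aux p) (Bang B (map g (unzip2 z)) (g p)).

(** * Reductions *)

Definition map_node (g : garc -> garc) (n : node) : node :=
  match n with
  | Ax a b => Ax (g a) (g b)
  | Cut a b => Cut (g a) (g b)
  | One c => One (g c)
  | Bot c => Bot (g c)
  | Tens l r c => Tens (g l) (g r) (g c)
  | Par l r c => Par (g l) (g r) (g c)
  | Bang B aux p => Bang B (map g aux) (g p)
  | Der p c => Der (g p) (g c)
  | Why ps c => Why (map g ps) (g c)
  end.

Definition map_arcs (g : garc -> garc) (R : pstruct) : pstruct :=
  PS (map (map_node g) (nodes R)) (map g (concl R)).

(* [fuse a b] fuses the arc [a] with [b], the result being called [b]. *)
Definition fuse (a b : garc) : pstruct -> pstruct :=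
  map_arcs (fun e => if e == a then b else e).

(* The rules are stated on representatives having the redex in front; [step]
   closes them under isomorphism. *)
Inductive ax_rule : pstruct -> pstruct -> Prop :=
| AxRule a a' b ns cs : b \notin [:: a; a'] ->
    ax_rule (PS (Ax a a' :: Cut a b :: ns) cs) (fuse a' b (PS ns cs)).

(* Merging, erasure of a unary ? node, and pulling a ? node out of a box through
   an auxiliary port [a] ([size l2 = (size aux2).+1] excludes the principal port).
   In [WhyEr], [p = c] would be an isolated loop, which cannot be fused. *)
Inductive why_rule : pstruct -> pstruct -> Prop :=
| WhyFl ps c qs d ns cs :
    why_rule (PS (Why ps c :: Why (c :: qs) d :: ns) cs)
             (PS (Why (ps ++ qs) d :: ns) cs)
| WhyEr p c ns cs : p != c ->
    why_rule (PS (Why [:: p] c :: ns) cs) (fuse c p (PS ns cs))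
| WhyPu qs c bns l1 l2 aux1 a aux2 p ns cs new :
    size l1 = size aux1 -> size l2 = (size aux2).+1 ->
    let R := PS (Bang (PS (Why qs c :: bns) (l1 ++ c :: l2))
                      (aux1 ++ a :: aux2) p :: ns) cs in
    uniq new -> ~~ has (mem (arcs R)) new ->
    [seq e.2 | e <- new] = [seq e.2 | e <- qs] ->
    why_rule R (PS (Bang (PS bns (l1 ++ qs ++ l2)) (aux1 ++ new ++ aux2) p
                    :: Why new a :: ns) cs).

Inductive deep (r : pstruct -> pstruct -> Prop) : pstruct -> pstruct -> Prop :=
| deep_root R R' : r R R' -> deep r R R'
| deep_box B B' aux p ns cs : deep r B B' ->
    deep r (PS (Bang B aux p :: ns) cs) (PS (Bang B' aux p :: ns) cs).

Definition step (r : pstruct -> pstruct -> Prop) (R R' : pstruct) : Prop :=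
  exists R1 R1', [/\ iso R R1, deep r R1 R1' & iso R1' R'].

(* Reflexive-transitive closure, on isomorphism classes. *)
Inductive steps (r : pstruct -> pstruct -> Prop) : pstruct -> pstruct -> Prop :=
| steps_refl R R' : iso R R' -> steps r R R'
| steps_cons R R1 R' : step r R R1 -> steps r R1 R' -> steps r R R'.

Definition why_normal (R : pstruct) : Prop := forall R', ~ step why_rule R R'.

(* A representative of the ?-normal form, which is unique up to isomorphism. *)
Definition why_nf (R : pstruct) : pstruct :=
  epsilon (inhabits R) (fun N => steps why_rule R N /\ why_normal N).

(** * Constructions on proof-nets *)

(* Variables are de Bruijn indices: the conclusions of a net over the context
   x_0, ..., x_{k-1} are, in order, the input conclusions named x_0, ..., x_{k-1}
   and the output conclusion. *)
Definition dflt_arc : garc := ([::], Out (OAtom 0)).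
Definition ins (R : pstruct) : seq garc := take (size (concl R)).-1 (concl R).
Definition out (R : pstruct) : garc := last dflt_arc (concl R).
Definition out_type (R : pstruct) : output :=
  if (out R).2 is Out A then A else OAtom 0.
Definition unbang (A : output) : output := if A is OBang A' then A' else A.
Definition limp_cod (A : output) : output := if A is OPar _ A' then A' else A.

(* [tag i R] and [tag j R'] have disjoint arcs for [i <> j]. *)
Definition tag (i : nat) : pstruct -> pstruct :=
  map_arcs (fun a => (i :: a.1, a.2)).

(* A !-context x_0 : !A_0, ..., x_{k-1} : !A_{k-1} is given as [:: A_0; ...]. *)
Definition bctx : Type := seq output.

Definition var_net (G : bctx) (j : nat) : pstruct :=
  let A i := nth (OAtom 0) G i in
  let x i : garc := ([:: 0; i], In (IWhy (negO (A i)))) in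
  let n : garc := ([:: 1], In (negO (A j))) in
  let o : garc := ([:: 2], Out (A j)) in
  PS (Ax n o :: Der n (x j)
        :: [seq Why [::] (x i) | i <- iota 0 (size G) & i != j])
     (rcons [seq x i | i <- iota 0 (size G)] o).

(* The abstracted variable is x_0. *)
Definition lam_net (R : pstruct) : pstruct :=
  let S := tag 0 R in
  let x := head dflt_arc (ins S) in
  let c : garc :=
    ([:: 1], if x.2 is In (IWhy J) then Out (OPar J (out_type S))
             else Out (out_type S)) in
  PS (Par x (out S) c :: nodes S) (rcons (behead (ins S)) c).

Definition bang_net (R : pstruct) : pstruct :=
  let aux : seq garc :=
    [seq ([:: 0; i], (nth dflt_arc (ins R) i).2) | i <- iota 0 (size (ins R))] in
  let p : garc := ([:: 1], Out (OBang (out_type R))) in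
  why_nf (PS [:: Bang R aux p] (rcons aux p)).

(* The input conclusions of [R1] and [R2] named x_i are joined by a ? node. *)
Definition join_arc (R1 : pstruct) (i : nat) : garc :=
  ([:: 2; i], (nth dflt_arc (ins R1) i).2).
Definition joins (R1 R2 : pstruct) : seq node :=
  [seq Why [:: nth dflt_arc (ins R1) i; nth dflt_arc (ins R2) i] (join_arc R1 i)
  | i <- iota 0 (size (ins R1))].
Definition joined (R1 : pstruct) : seq garc :=
  [seq join_arc R1 i | i <- iota 0 (size (ins R1))].

Definition app_net (R1 R2 : pstruct) : pstruct :=
  let S1 := tag 0 R1 in
  let S2 := tag 1 R2 in
  let A := unbang (out_type S2) in
  let A' := limp_cod (out_type S1) in
  let n : garc := ([:: 3], In (negO A')) in
  let o : garc := ([:: 4], Out A') in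
  let t : garc := ([:: 5], In (ITens A (negO A'))) in
  why_nf (PS ([:: Ax n o; Tens (out S2) n t; Cut t (out S1)]
                ++ joins S1 S2 ++ nodes S1 ++ nodes S2)
             (rcons (joined S1) o)).

Definition appd_net (R1 R2 : pstruct) : pstruct :=
  let S1 := tag 0 R1 in
  let S2 := tag 1 R2 in
  let A := unbang (out_type S2) in
  let A' := limp_cod (unbang (out_type S1)) in
  let n : garc := ([:: 3], In (negO A')) in
  let o : garc := ([:: 4], Out A') in
  let t : garc := ([:: 5], In (ITens A (negO A'))) in
  let d : garc := ([:: 6], In (IWhy (ITens A (negO A')))) in
  why_nf (PS ([:: Ax n o; Tens (out S2) n t; Der t d; Cut d (out S1)]
                ++ joins S1 S2 ++ nodes S1 ++ nodes S2)
             (rcons (joined S1) o)).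

Definition der_net (R : pstruct) : pstruct :=
  let S := tag 0 R in
  let A := unbang (out_type S) in
  let n : garc := ([:: 1], In (negO A)) in
  let o : garc := ([:: 2], Out A) in
  let d : garc := ([:: 3], In (IWhy (negO A))) in
  PS ([:: Ax n o; Der n d; Cut d (out S)] ++ nodes S) (rcons (ins S) o).

(** * Simply typed lambda-calculus *)

(* [TArr s t] is s => t. *)
Inductive stype : Type := TAtom of nat | TArr of stype & stype.

Inductive lterm : Type :=
| LVar of nat
| LLam of stype & lterm
| LApp of lterm & lterm.

Inductive ltyped : seq stype -> lterm -> stype -> Prop :=
| lt_var G i s : onth G i = Some s -> ltyped G (LVar i) s
| lt_lam G s M t : ltyped (s :: G) M t -> ltyped G (LLam s M) (TArr s t)
| lt_app G M N s t : ltyped G M (TArr s t) -> ltyped G N s ->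
    ltyped G (LApp M N) t.

(** * Simply typed bang calculus *)

(* [BLam A t] is the abstraction over a variable of type !A. *)
Inductive bterm : Type :=
| BVar of nat
| BLam of output & bterm
| BApp of bterm & bterm
| BDer of bterm
| BProm of bterm.

Inductive btyped : bctx -> bterm -> output -> Prop :=
| bt_var G i A : onth G i = Some A -> btyped G (BVar i) A
| bt_lam G A t A' : btyped (A :: G) t A' -> btyped G (BLam A t) (blimp A A')
| bt_app G t s A A' : btyped G t (blimp A A') -> btyped G s (OBang A) ->
    btyped G (BApp t s) A'
| bt_prom G t A : btyped G t A -> btyped G (BProm t) (OBang A)
| bt_der G t A : btyped G t (OBang A) -> btyped G (BDer t) A.

(** * Translations *)

Fixpoint typN (s : stype) : output :=
  match s with
  | TAtom X => OAtom X
  | TArr s t => blimp (typN s) (typN t)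
  end.

Fixpoint typV (s : stype) : output :=
  match s with
  | TAtom X => OAtom X
  | TArr s t => blimp (typV s) (OBang (typV t))
  end.

Definition ctxN : seq stype -> bctx := map typN.
Definition ctxV : seq stype -> bctx := map typV.

Fixpoint termN (M : lterm) : bterm :=
  match M with
  | LVar i => BVar i
  | LLam s M => BLam (typN s) (termN M)
  | LApp M N => BApp (termN M) (BProm (termN N))
  end.

Fixpoint termV (M : lterm) : bterm :=
  match M with
  | LVar i => BProm (BVar i)
  | LLam s M => BProm (BLam (typV s) (termV M))
  | LApp M N => BApp (BDer (termV M)) (termV N)
  end.

Lemma onth_map_Some (T U : Type) (f : T -> U) (G : seq T) i x :
  onth G i = Some x -> onth (map f G) i = Some (f x).
Proof. by rewrite onth_map => ->. Qed.

Lemma termN_typed G M s : ltyped G M s -> btyped (ctxN G) (termN M) (typN s).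
Proof.
elim=> {G M s} [G i s Gi|G s M t _ IH|G M N s t _ IHM _ IHN] /=.
- by apply: bt_var; apply: onth_map_Some.
- exact: bt_lam.
- by apply: bt_app IHM _; apply: bt_prom.
Qed.

Lemma termV_typed G M s :
  ltyped G M s -> btyped (ctxV G) (termV M) (OBang (typV s)).
Proof.
elim=> {G M s} [G i s Gi|G s M t _ IH|G M N s t _ IHM _ IHN] /=.
- by apply: bt_prom; apply: bt_var; apply: onth_map_Some.
- by apply: bt_prom; apply: bt_lam.
- by apply: bt_app IHN; apply: bt_der.
Qed.

Fixpoint net_of_bterm (G : bctx) (t : bterm) : pstruct :=
  match t with
  | BVar j => var_net G j
  | BLam A s => lam_net (net_of_bterm (A :: G) s)
  | BApp t1 t2 => app_net (net_of_bterm G t1) (net_of_bterm G t2)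
  | BDer s => der_net (net_of_bterm G s)
  | BProm s => bang_net (net_of_bterm G s)
  end.

Fixpoint netN (G : seq stype) (M : lterm) : pstruct :=
  match M with
  | LVar j => var_net (ctxN G) j
  | LLam s N => lam_net (netN (s :: G) N)
  | LApp M1 M2 => app_net (netN G M1) (bang_net (netN G M2))
  end.

Fixpoint netV (G : seq stype) (M : lterm) : pstruct :=
  match M with
  | LVar j => bang_net (var_net (ctxV G) j)
  | LLam s N => bang_net (lam_net (netV (s :: G) N))
  | LApp M1 M2 => appd_net (netV G M1) (netV G M2)
  end.

(* Main.v *)
(** The call-by-name statement is a literal equality of representatives, up to
    the reflexivity of [iso], which is proved for well-formed nets.

    In the call-by-value statement the two nets differ in applications: there
    [App (Der R1, R2)] has to become [App_d (R1, R2)].  Before ?-normalization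
    this is one ax-step, which turns the ?d node of [Der] into the one of [App_d].
    Such a step is local (three nodes become one) and touches no ? node, whereas
    ?-steps touch only ? nodes and boxes; so the two commute and the step survives
    ?-normalization, also inside boxes.

    As [why_nf] is an arbitrary normal form, one needs its uniqueness, but only for
    the two shapes that occur.  For [App] and [App_d] of ?-normal nets, only
    merging and erasing can happen, and they preserve, for each conclusion, the
    multiset of the non-? arcs that reach it through ? nodes; a normal net is
    determined by these multisets.  For the box of a ?-normal net, only pulling can
    happen, and a reachable net is determined by the set of auxiliary ports that
    have been treated, all of them in a normal form. *)

Require Import Defs.
From Stdlib Require Import Permutation ClassicalEpsilon.
From HB Require Import structures.
From mathcomp Require Import all_boot zify.

Set Implicit Arguments.
Unset Strict Implicit.
Unset Printing Implicit Defensive.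

(** * Isomorphism *)

(** Commutation of ax-steps with ?-steps is not proved step by step. The nodes [N] rewritten by an
    ax-step are not ? nodes, so they are still present in a ?-normal form, in the core or in the
    box. Replacing them there by [N'] gives a net without ?-redex that satisfies the invariants
    attached to the reduct, and uniqueness identifies it with the chosen normal form of the reduct.
    Hence the explicit lists of nodes in [ax_der], and invariants stated relative to a list of
    untouched nodes.

    Merging and erasing alone, or pulling alone, occur because the arguments of each construction
    are already ?-normal at every depth. This is carried along as a boolean condition, [redex_free],
    part of the invariant [good] of all nets of typed terms.

    Steps are closed under isomorphism, which permutes nodes and ports and renames each box
    independently. A reachable net is therefore given by a concrete representative and an
    isomorphism, and every redex is first pulled back to the representative. *)

Lemma node_eq_dec (m n : node) : {m = n} + {m <> n}.
Proof. exact: excluded_middle_informative. Qed.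

(** Equality of nodes is decided classically, only to have [perm_eq], [rem] and membership on lists
    of nodes. *)
HB.instance Definition _ := hasDecEq.Build node (compareP node_eq_dec).

Lemma perm_Permutation (T : eqType) (s t : seq T) :
  perm_eq s t <-> Permutation s t.
Proof.
split.
- elim: s t => [|x s IH] t; first by move/perm_size/esym/size0nil->.
  move=> p; have xt : x \in t by rewrite -(perm_mem p) mem_head.
  apply: Permutation_trans (perm_skip x (IH (rem x t) _)) _.
    by rewrite -(perm_cons x) (perm_trans p) // perm_to_rem.
  elim: t xt {p} => //= y t IHt; rewrite in_cons.
  case: eqVneq => [-> _|xy] //= /IHt p.
  exact: Permutation_trans (perm_swap _ _ _) (perm_skip _ p).
- elim=> {s t} [|x s t _|x y s|s t u _ p _ q] //; first by rewrite perm_cons.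
  - by rewrite (perm_catCA [:: y] [:: x] s).
  - exact: perm_trans p q.
Qed.

Lemma Forall2_in (S T : eqType) (r r' : S -> T -> Prop) s t :
  (forall x y, x \in s -> y \in t -> r x y -> r' x y) ->
  List.Forall2 r s t -> List.Forall2 r' s t.
Proof.
move=> h f; elim: f h => {s t} [|x y s t xy _ IH] h; constructor.
  by apply: h xy; exact: mem_head.
by apply: IH => u v us vt; apply: h; rewrite in_cons ?us ?vt orbT.
Qed.

Lemma Forall2_flip (S T : Type) (r : S -> T -> Prop) s t :
  List.Forall2 r s t -> List.Forall2 (fun y x => r x y) t s.
Proof. by elim=> {s t} *; constructor. Qed.

Lemma Forall2_trans (S T U : Type) (r : S -> T -> Prop) (r' : T -> U -> Prop)
    s t u :
  List.Forall2 r s t -> List.Forall2 r' t u ->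
  List.Forall2 (fun x z => exists2 y, r x y & r' y z) s u.
Proof.
move=> f; elim: f u => {s t} [|x y s t xy _ IH] u h; inversion h; subst.
  by constructor.
by constructor; [exists y | apply: IH].
Qed.

Definition subnodes (n : node) : seq node :=
  if n is Bang B _ _ then nodes B else [::].

(** Nodes of a box are nested under a list, where the generated principle gives no induction
    hypothesis. [F] is cleared in the branches that must not call it, so that the fixpoint passes
    the guard condition. *)
Lemma node_box_ind (P : node -> Prop) :
  (forall n, (forall m, m \in subnodes n -> P m) -> P n) -> forall n, P n.
Proof.
move=> H.
have H0 n : subnodes n = [::] -> P n by move=> e; apply: H; rewrite e.
fix F 1; case=> [a b|a b|c|c|l r c|l r c|[ns cs] aux p|p c|ps c].
7: {
  apply: H => /=; elim: ns => [|n ns IH] m.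
    by clear F; rewrite in_nil.
  rewrite in_cons => /predU1P[->|h]; [exact: F|exact: IH]. }
all: by clear F; apply: H0.
Qed.

(** Arcs inside a box are left out: the box has its own names, renamed independently. *)
Definition narcs (n : node) : seq garc := node_prems n ++ node_concls n.

Lemma mem_tails R a : (a \in tails R) = has (fun n => a \in node_concls n) (nodes R).
Proof. by rewrite /tails; elim: (nodes R) => //= n ns; rewrite mem_cat => ->. Qed.

Lemma mem_prems (ns : seq node) a :
  (a \in flatten (map node_prems ns)) = has (fun n => a \in node_prems n) ns.
Proof. by elim: ns => //= n ns; rewrite mem_cat => ->. Qed.

Lemma mem_arcs R a :
  (a \in arcs R) = has (fun n => a \in narcs n) (nodes R) || (a \in concl R).
Proof.
rewrite /arcs mem_cat mem_tails mem_cat mem_prems orbA -has_predU; congr orb.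
by apply: eq_has => n /=; rewrite mem_cat orbC.
Qed.

Lemma narcs_arcs R n : n \in nodes R -> {subset narcs n <= arcs R}.
Proof. by move=> nR a an; rewrite mem_arcs; apply/orP; left; apply/hasP; exists n. Qed.

Lemma concl_arcs R : {subset concl R <= arcs R}.
Proof. by move=> a aR; rewrite mem_arcs aR orbT. Qed.

(** The part of an isomorphism that concerns the nodes, without injectivity of [g], so that it
    splits along concatenations of lists of nodes. *)
Definition nsiso g (ns ns' : seq node) : Prop :=
  exists2 ns1, List.Forall2 (niso g) ns ns1 & perm_eq ns1 ns'.

(** Exposes the renaming of an isomorphism: restricting, extending and gluing isomorphisms act on
    this function. *)
Definition isog g (R R' : pstruct) : Prop :=
  [/\ {in arcs R &, injective g}, {in arcs R, forall a, (g a).2 = a.2},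
      nsiso g (nodes R) (nodes R') & concl R' = map g (concl R)].

Lemma isoP R R' : iso R R' <-> exists g, isog g R R'.
Proof.
split=> [[g ns ns1 ns' cs gi gt gn p]|[g [gi gt [ns1 gn p] gc]]].
  by exists g; split=> //; exists ns1 => //; apply/perm_Permutation.
case: R R' gi gt gn p gc => [ns cs] [ns' cs'] /= gi gt gn p ->.
by apply: Iso gn _ => //; apply/perm_Permutation.
Qed.

Lemma nsiso_perm g ns ns2 ns' ns2' :
  perm_eq ns2 ns -> perm_eq ns' ns2' -> nsiso g ns ns' -> nsiso g ns2 ns2'.
Proof.
rewrite perm_sym => /perm_Permutation p q [ns1 f r].
have [ns3 [p' f']] := Permutation_Forall2 p f; exists ns3 => //.
apply: perm_trans (perm_trans r q); rewrite perm_sym; exact/perm_Permutation.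
Qed.

Lemma nsiso_cat g ns1 ns1' ns2 ns2' :
  nsiso g ns1 ns1' -> nsiso g ns2 ns2' -> nsiso g (ns1 ++ ns2) (ns1' ++ ns2').
Proof.
move=> [m1 f1 p1] [m2 f2 p2]; exists (m1 ++ m2); first exact: List.Forall2_app.
exact: perm_cat.
Qed.

Lemma nsiso_cons g n n' ns ns' :
  niso g n n' -> nsiso g ns ns' -> nsiso g (n :: ns) (n' :: ns').
Proof.
move=> h [m f p]; exists (n' :: m); first by constructor.
by rewrite perm_cons.
Qed.

Lemma nsiso_nil g : nsiso g [::] [::].
Proof. by exists [::]. Qed.

Lemma nsiso_inv g ns n' ns' : nsiso g ns (n' :: ns') ->
  exists n ns0, [/\ perm_eq ns (n :: ns0), niso g n n' & nsiso g ns0 ns'].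
Proof.
move=> [ns1 f p].
have [ns2 [q h]] := Permutation_Forall2 (proj1 (perm_Permutation _ _) p)
  (Forall2_flip f).
inversion h as [|x n s ns0 hn hs]; subst; exists n, ns0; split=> //.
  exact/perm_Permutation.
by exists ns'; first exact: Forall2_flip.
Qed.

Lemma nsiso_mem_r g ns ns' n' : nsiso g ns ns' -> n' \in ns' ->
  exists2 n, n \in ns & niso g n n'.
Proof.
move=> h n'ns; have /nsiso_inv [n [ns0 [p hn _]]] :
    nsiso g ns (n' :: rem n' ns').
  by apply: nsiso_perm h; rewrite ?perm_refl ?perm_to_rem.
by exists n => //; rewrite (perm_mem p) mem_head.
Qed.

Lemma nsiso_sub g h ns ns' :
  (forall n n', n \in ns -> niso g n n' -> niso h n n') ->
  nsiso g ns ns' -> nsiso h ns ns'.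
Proof.
by move=> s [ns1 f p]; exists ns1 => //; apply: Forall2_in f => n n' /s sn _ /sn.
Qed.

Lemma nsiso_sym g h ns ns' :
  (forall n n', n \in ns -> niso g n n' -> niso h n' n) ->
  nsiso g ns ns' -> nsiso h ns' ns.
Proof.
move=> s [ns1 f p]; apply: (@nsiso_perm _ ns1 _ ns); rewrite 1?perm_sym //.
exists ns => //; apply: Forall2_flip; apply: Forall2_in f => n n' /s sn _ /sn.
by [].
Qed.

Lemma nsiso_trans g h k ns1 ns2 ns3 :
  (forall n n' n'', n \in ns1 -> niso g n n' -> niso h n' n'' -> niso k n n'') ->
  nsiso g ns1 ns2 -> nsiso h ns2 ns3 -> nsiso k ns1 ns3.
Proof.
move=> s [m f p] q; have [m' f' p'] : nsiso h m ns3.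
  by apply: nsiso_perm q => //.
exists m' => //; apply: Forall2_in (Forall2_trans f f') => n n'' nn _ [n' u v].
exact: s u v.
Qed.

Lemma perm_map_inv (S T : eqType) (f : S -> T) (s : seq S) (t : seq T) :
  perm_eq t (map f s) -> exists2 u, t = map f u & perm_eq u s.
Proof.
elim: t s => [|y t IH] s p.
  exists [::] => //; move/perm_size: p => /=; rewrite size_map.
  by move/esym/size0nil->.
have: y \in map f s by rewrite -(perm_mem p) mem_head.
case/mapP=> x xs e; have /IH[u ->] : perm_eq t (map f (rem x s)).
  by rewrite -(perm_cons y) (perm_trans p) // e -map_cons perm_map // perm_to_rem.
move=> q; exists (x :: u); first by rewrite e.
by rewrite perm_sym (perm_trans (perm_to_rem xs)) // perm_cons perm_sym.
Qed.

Definition map_pair (S T : Type) (f : S -> S) (g : T -> T) (x : S * T) := (f x.1, g x.2).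

(** [iBang] reorders the left box before comparing it. Here the reordering is a permutation of
    zipped lists, while the isomorphism of boxes keeps the order of [rcons l c]; this form, with its
    converse [niso_bang], can be inverted and composed. *)
Lemma niso_bang_inv g B aux p n : niso g (Bang B aux p) n ->
  exists h bns l c bns' l' aux',
  [/\ B = PS bns (rcons l c), n = Bang (PS bns' (rcons l' (h c))) aux' (g p),
      (size l = size aux) * (size l' = size aux'),
      perm_eq (zip l' aux') (map (map_pair h g) (zip l aux)) &
      isog h (PS bns (rcons l c)) (PS bns' (map h (rcons l c)))].
Proof.
move E: (Bang B aux p) => m H.
case: m n / H E => // {}g bns l c aux0 p0 B' z sl zp /isoP[h [hi ht hn hc]].
case=> -> -> ->; case: B' hn hc => bns' cs' /= hn ->.
exists h, bns, l, c, bns', (map h (unzip1 z)), (map g (unzip2 z)).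
rewrite map_rcons !size_map; split=> //.
  rewrite (_ : zip _ _ = map (map_pair h g) z) ?perm_map //.
  by rewrite /unzip1 /unzip2 -!map_comp; elim: (z) => //= -[x y] s ->.
have e a : (a \in arcs (PS bns (rcons l c))) =
           (a \in arcs (PS bns (rcons (unzip1 z) c))).
  rewrite !mem_arcs /= !mem_rcons !in_cons; congr (_ || (_ || _)).
  rewrite -[in LHS](@unzip1_zip _ _ l aux0) ?sl //.
  by rewrite (perm_mem (perm_map _ zp)).
by split=> // [a b|a]; rewrite ?e; [exact: hi|exact: ht].
Qed.

Lemma niso_bang g h bns l c aux p bns' l' aux' :
  size l = size aux -> size l' = size aux' ->
  perm_eq (zip l' aux') (map (map_pair h g) (zip l aux)) ->
  isog h (PS bns (rcons l c)) (PS bns' (map h (rcons l c))) ->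
  niso g (Bang (PS bns (rcons l c)) aux p)
         (Bang (PS bns' (rcons l' (h c))) aux' (g p)).
Proof.
move=> sl sl' /perm_map_inv[z ez pz] [hi ht hn _].
have e1 : l' = map h (unzip1 z).
  rewrite -(@unzip1_zip _ _ l' aux') ?sl' // ez /unzip1 -!map_comp.
  exact: eq_map.
have e2 : aux' = map g (unzip2 z).
  rewrite -(@unzip2_zip _ _ l' aux') ?sl' // ez /unzip2 -!map_comp.
  exact: eq_map.
rewrite e2; apply: (@iBang _ _ _ _ _ _ _ z) => //.
apply/isoP; exists h.
have e a : (a \in arcs (PS bns (rcons (unzip1 z) c))) =
           (a \in arcs (PS bns (rcons l c))).
  rewrite !mem_arcs /= !mem_rcons !in_cons; congr (_ || (_ || _)).
  rewrite -[in RHS](@unzip1_zip _ _ l aux) ?sl //.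
  by rewrite (perm_mem (perm_map _ pz)).
split=> /= [a b|a||]; rewrite ?e //; [exact: hi|exact: ht|].
by rewrite map_rcons e1.
Qed.

Lemma perm_zip_unzip2 (S T : eqType) (f : S -> S) (g : T -> T) l l' aux aux' :
  size l = size aux -> size l' = size aux' ->
  perm_eq (zip l' aux') (map (map_pair f g) (zip l aux)) ->
  perm_eq l' (map f l) /\ perm_eq aux' (map g aux).
Proof.
move=> sl sl' p; split.
  move: (perm_map fst p); rewrite -!map_comp -/unzip1.
  rewrite (eq_map (_ : _ =1 f \o fst)) // map_comp -!/unzip1.
  by rewrite !unzip1_zip ?sl ?sl'.
move: (perm_map snd p); rewrite -!map_comp.
rewrite (eq_map (_ : _ =1 g \o snd)) // map_comp -!/(unzip2 _).
by rewrite !unzip2_zip ?sl ?sl'.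
Qed.

Lemma niso_prems g n n' :
  niso g n n' -> perm_eq (node_prems n') (map g (node_prems n)).
Proof. by case=> //= {}g a b; rewrite (perm_catC [:: g b]). Qed.

Lemma niso_concls g n n' :
  niso g n n' -> perm_eq (node_concls n') (map g (node_concls n)).
Proof.
case: n => [a b|a b|c|c|l r c|l r c|B aux p|p c|ps c] H.
7: case/niso_bang_inv: H => h [bns [l [c [bns' [l' [aux' [_ -> [sl sl'] pz _]]]]]]].
7: have [_ pa] := perm_zip_unzip2 sl sl' pz.
7: by rewrite /= map_rcons -!cats1 perm_cat2r.
all: inversion H; subst => //=.
by rewrite (perm_catC [:: g b]).
Qed.

Lemma niso_narcs g n n' : niso g n n' -> perm_eq (narcs n') (map g (narcs n)).
Proof. by move=> h; rewrite map_cat perm_cat ?niso_prems ?niso_concls. Qed.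

Lemma niso_ext g h n n' : {in narcs n, g =1 h} -> niso g n n' -> niso h n n'.
Proof.
case: n => [a b|a b|c|c|l r c|l r c|B aux p|p c|ps c] e H.
7: {
  case/niso_bang_inv: H => k [bns [l [c [bns' [l' [aux' [-> -> [sl sl'] pz hi]]]]]]].
  rewrite e ?mem_rcons ?mem_head //; apply: niso_bang => //.
  suff <- : map (map_pair k g) (zip l aux) = map (map_pair k h) (zip l aux) by [].
  apply/eq_in_map=> -[x y] xy; congr pair; rewrite /= e // mem_rcons in_cons.
  by rewrite -(@unzip2_zip _ _ l aux) ?sl // (map_f snd xy) orbT. }
8: {
  inversion H as [| | | | | | | | |? ? qs ? pq|]; subst; rewrite e.
    constructor; rewrite (perm_trans pq) //.
    suff -> : map g ps = map h ps by [].
    by apply/eq_in_map=> x xp; apply: e; rewrite mem_cat xp.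
  by rewrite mem_cat mem_head orbT. }
all: by inversion H; subst; rewrite !e ?inE ?eqxx ?orbT //; constructor.
Qed.

Lemma nsiso_ext g h ns ns' :
  {in flatten (map narcs ns), g =1 h} -> nsiso g ns ns' -> nsiso h ns ns'.
Proof.
move=> e; apply: nsiso_sub => n n' nn; apply: niso_ext => a an; apply: e.
by apply/flattenP; exists (narcs n) => //; exact: map_f.
Qed.

Lemma mem_isog_arcs g R R' : isog g R R' -> arcs R' =i map g (arcs R).
Proof.
move=> [_ _ gn gc] a; rewrite mem_arcs gc; apply/orP/mapP.
- case=> [/hasP[n' n'R an']|/mapP[b bR ->]]; last by exists b; first exact: concl_arcs.
  have [n nR hn] := nsiso_mem_r gn n'R.
  move: an'; rewrite (perm_mem (niso_narcs hn)) => /mapP[b bn ->].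
  by exists b => //; apply: narcs_arcs bn.
- move=> [b bR ->]; move: bR; rewrite mem_arcs.
  case/orP=> [/hasP[n nR bn]|bR]; last by right; exact: map_f.
  left; case: gn => ns1 f p.
  have : has (fun n' => g b \in narcs n') ns1.
    elim: f nR {p} => //= m m' s t mm _ IH.
    rewrite in_cons => /predU1P[en|/IH->]; last by rewrite orbT.
    rewrite -en in mm; by rewrite (perm_mem (niso_narcs mm)) map_f.
  by rewrite !has_count -!size_filter (perm_size (perm_filter _ p)).
Qed.

(** A renaming is injective on the arcs of a net only, so it is inverted through their list; outside
    the image the value is the default arc. *)
Definition inv_on (s : seq garc) (g : garc -> garc) (b : garc) : garc :=
  nth dflt_arc s (index b (map g s)).

Lemma inv_onK s g : {in s &, injective g} -> {in s, cancel g (inv_on s g)}.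
Proof.
move=> gi a aS; have gs : g a \in map g s by exact: map_f.
have lt : index (g a) (map g s) < size s by rewrite -(size_map g) index_mem.
apply: gi => //; first exact: mem_nth.
by rewrite -[LHS](nth_map _ dflt_arc) // nth_index.
Qed.

Lemma perm_zip_sym (f f' : garc -> garc) (g g' : garc -> garc) l l' aux aux' :
  size l = size aux -> {in l, cancel f f'} -> {in aux, cancel g g'} ->
  perm_eq (zip l' aux') (map (map_pair f g) (zip l aux)) ->
  perm_eq (zip l aux) (map (map_pair f' g') (zip l' aux')).
Proof.
move=> sl fK gK /(perm_map (map_pair f' g')) p; rewrite perm_sym (perm_trans p) //.
rewrite -map_comp map_id_in // => -[x y] xy; congr pair => /=.
  by rewrite fK // -(@unzip1_zip _ _ l aux) ?sl // (map_f fst xy).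
by rewrite gK // -(@unzip2_zip _ _ l aux) ?sl // (map_f snd xy).
Qed.

(** The property of the nodes is a hypothesis, so that the lemma applies to a box inside the
    induction of [niso_sym]. The other lemmas ending in [_in] on isomorphisms have this form for the
    same reason. *)
Lemma isog_sym_in g h R R' :
  (forall n, n \in nodes R -> forall g h n', niso g n n' ->
     {in narcs n, cancel g h} -> niso h n' n) ->
  isog g R R' -> {in arcs R, cancel g h} -> isog h R' R.
Proof.
move=> IH iR gK; have [gi gt gn gc] := iR; split.
- move=> a b; rewrite !(mem_isog_arcs iR) => /mapP[x xR ->] /mapP[y yR ->].
  by rewrite !gK // => ->.
- by move=> a; rewrite (mem_isog_arcs iR) => /mapP[x xR ->]; rewrite gK ?gt.
- apply: nsiso_sym gn => n n' nR hn; apply: IH (nR) _ _ _ hn _ => a an.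
  by apply: gK; apply: narcs_arcs an.
- by rewrite gc -map_comp map_id_in // => a aR; rewrite /= gK // concl_arcs.
Qed.

Lemma niso_sym n : forall g h n',
  niso g n n' -> {in narcs n, cancel g h} -> niso h n' n.
Proof.
elim/node_box_ind: n => n IH g h n' H gK.
case: n IH H gK => [a b|a b|c|c|l r c|l r c|B aux p|p c|ps c] IH H gK.
7: {
  case/niso_bang_inv: H => k [bns [l [c [bns' [l' [aux' [eB -> [sl sl'] pz hi]]]]]]].
  subst B; have [ki _ _ _] := hi.
  set k' := inv_on (arcs (PS bns (rcons l c))) k.
  have kK : {in arcs (PS bns (rcons l c)), cancel k k'} := inv_onK ki.
  have lA : {subset rcons l c <= arcs (PS bns (rcons l c))}.
    by move=> a al; apply: concl_arcs.
  have := @niso_bang h k' bns' l' (k c) aux' (g p) bns l aux.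
  rewrite kK ?lA ?mem_rcons ?mem_head // gK ?mem_rcons ?mem_head //; apply=> //.
    apply: perm_zip_sym pz => // a aX; first by rewrite kK // lA // mem_rcons in_cons aX orbT.
    by rewrite gK // mem_rcons in_cons aX orbT.
  have sym : isog k' (PS bns' (map k (rcons l c))) (PS bns (rcons l c)).
    by apply: isog_sym_in hi kK => n nb; apply: IH.
  have [pl _] := perm_zip_unzip2 sl sl' pz.
  (* The box on the right lists its conclusions as [rcons l' (k c)], but [sym] speaks of
     [map k (rcons l c)]. The two orders have the same arcs, which is all that injectivity and
     preservation of types depend on. *)
  have e a : (a \in rcons l' (k c)) = (a \in map k (rcons l c)).
    by rewrite map_rcons !mem_rcons !in_cons (perm_mem pl).
  have ea a : (a \in arcs (PS bns' (rcons l' (k c)))) =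
              (a \in arcs (PS bns' (map k (rcons l c)))).
    by rewrite !mem_arcs /= e.
  have [si st sn _] := sym.
  by split=> // [a b|a]; rewrite ?ea; [exact: si|exact: st]. }
8: {
  inversion H as [| | | | | | | | |? ? qs ? pq|]; subst.
  rewrite -{2}(gK c) ?mem_cat ?mem_head ?orbT //; constructor.
  rewrite perm_sym (perm_trans (perm_map h pq)) // -map_comp map_id_in //.
  by move=> a ap; rewrite /= gK // mem_cat ap. }
all: inversion H; subst; rewrite /narcs /= in gK.
- by have := iAx h (g a) (g b); rewrite !gK ?inE ?eqxx ?orbT.
- by have := iAxC h (g b) (g a); rewrite !gK ?inE ?eqxx ?orbT.
- by have := iCut h (g a) (g b); rewrite !gK ?inE ?eqxx ?orbT.
- by have := iCutC h (g b) (g a); rewrite !gK ?inE ?eqxx ?orbT.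
- by have := iOne h (g c); rewrite !gK ?inE ?eqxx ?orbT.
- by have := iBot h (g c); rewrite !gK ?inE ?eqxx ?orbT.
- by have := iTens h (g l) (g r) (g c); rewrite !gK ?inE ?eqxx ?orbT.
- by have := iPar h (g l) (g r) (g c); rewrite !gK ?inE ?eqxx ?orbT.
- by have := iDer h (g p) (g c); rewrite !gK ?inE ?eqxx ?orbT.
Qed.

Lemma isog_inv g R R' : isog g R R' ->
  isog (inv_on (arcs R) g) R' R.
Proof.
move=> iR; have [gi _ _ _] := iR.
by apply: (isog_sym_in _ iR (inv_onK gi)) => n _; exact: niso_sym.
Qed.

Lemma iso_sym R R' : iso R R' -> iso R' R.
Proof. by case/isoP=> g /isog_inv iR; apply/isoP; exists (inv_on (arcs R) g). Qed.

Lemma isog_trans_in g h R1 R2 R3 :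
  (forall n, n \in nodes R1 -> forall g h n' n'', niso g n n' ->
     niso h n' n'' -> niso (h \o g) n n'') ->
  isog g R1 R2 -> isog h R2 R3 -> isog (h \o g) R1 R3.
Proof.
move=> IH iR iR'; have e := mem_isog_arcs iR.
have [gi gt gn gc] := iR; have [hi ht hn hc] := iR'; split.
- move=> a b aR bR /= /hi eab; apply: gi => //.
  by apply: eab; rewrite e map_f.
- by move=> a aR; rewrite /= ht ?gt // e map_f.
- by apply: nsiso_trans gn hn => n n' n'' nR; exact: IH.
- by rewrite hc gc -map_comp.
Qed.

Lemma niso_trans n : forall g h n' n'',
  niso g n n' -> niso h n' n'' -> niso (h \o g) n n''.
Proof.
elim/node_box_ind: n => n IH g h n' n'' H H'.
case: n IH H => [a b|a b|c|c|l r c|l r c|B aux p|p c|ps c] IH H.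
7: {
  case/niso_bang_inv: H => k [bns [l [c [bns' [l' [aux' [eB eN [sl sl'] pz hi]]]]]]].
  subst B n'.
  case/niso_bang_inv: H' => m [bns1 [l1 [c1 [bns2 [l2 [aux2 [eB -> [s1 s2] pz' hi']]]]]]].
  case: eB => ? /rcons_inj[? ?]; subst bns1 l1 c1.
  apply: (@niso_bang _ (m \o k)) => //.
    rewrite (perm_trans pz') // (_ : map _ (zip l aux) =
      map (map_pair m h) (map (map_pair k g) (zip l aux))); first exact: perm_map.
    by rewrite -map_comp.
  have [pl _] := perm_zip_unzip2 sl sl' pz.
  have e a : (a \in rcons l' (k c)) = (a \in map k (rcons l c)).
    by rewrite map_rcons !mem_rcons !in_cons (perm_mem pl).
  have ea a : (a \in arcs (PS bns' (rcons l' (k c)))) =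
              (a \in arcs (PS bns' (map k (rcons l c)))).
    by rewrite !mem_arcs /= e.
  have hi2 : isog m (PS bns' (map k (rcons l c)))
                    (PS bns2 (map m (map k (rcons l c)))).
    have [mi mt mn _] := hi'.
    by split=> // [a b|a]; rewrite -?ea; [exact: mi|exact: mt].
  rewrite (map_comp m k); apply: isog_trans_in hi hi2 => n nb; exact: IH. }
8: {
  inversion H as [| | | | | | | | |? ? qs ? pq|]; subst.
  inversion H' as [| | | | | | | | |? ? qs' ? pq'|]; subst.
  apply: (@iWhy (h \o g)); rewrite (perm_trans pq') // (map_comp h g); exact: perm_map. }
all: inversion H; subst; inversion H'; subst.
- exact: (@iAx (h \o g)).
- exact: (@iAxC (h \o g)).
- exact: (@iAxC (h \o g)).
- exact: (@iAx (h \o g)).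
- exact: (@iCut (h \o g)).
- exact: (@iCutC (h \o g)).
- exact: (@iCutC (h \o g)).
- exact: (@iCut (h \o g)).
- exact: (@iOne (h \o g)).
- exact: (@iBot (h \o g)).
- exact: (@iTens (h \o g)).
- exact: (@iPar (h \o g)).
- exact: (@iDer (h \o g)).
Qed.

Lemma isog_trans g h R1 R2 R3 :
  isog g R1 R2 -> isog h R2 R3 -> isog (h \o g) R1 R3.
Proof. by apply: isog_trans_in => n _; exact: niso_trans. Qed.

Lemma iso_trans R1 R2 R3 : iso R1 R2 -> iso R2 R3 -> iso R1 R3.
Proof.
by move=> /isoP[g i] /isoP[h j]; apply/isoP; exists (h \o g); exact: isog_trans j.
Qed.

(* [iso] is only partially reflexive: a box must have one more conclusion than
   its ! node has auxiliary ports. *)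
Lemma isog_refl_in R :
  (forall n, n \in nodes R -> niso id n n) -> isog id R R.
Proof.
move=> h; split=> //; last by rewrite map_id.
exists (nodes R) => //; elim: (nodes R) h => [|n ns IH] h; constructor.
  by apply: h; exact: mem_head.
by apply: IH => m ms; apply: h; rewrite in_cons ms orbT.
Qed.

Lemma niso_box_cong B B' aux p : size (concl B) = (size aux).+1 ->
  iso B B' -> niso id (Bang B aux p) (Bang B' aux p).
Proof.
case: B => bns cs /= sc /isoP[g iB]; have [_ _ _ gc] := iB.
case: B' iB gc => bns' cs' iB /= gc; subst cs'.
case/lastP: cs sc iB => // l c; rewrite size_rcons => -[sl] iB.
rewrite map_rcons; apply: niso_bang => //; first by rewrite size_map.
have -> // : zip (map g l) aux = map (map_pair g id) (zip l aux).
by elim: l aux {sl iB} => [|x l IH] [|y aux] //=; rewrite IH.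
Qed.

Lemma well_formedE R : well_formed R =
  [&& uniq (tails R), perm_eq (tails R) (heads R) & all well_formed_node (nodes R)].
Proof. by case: R => ns cs. Qed.

Lemma niso_refl n : well_formed_node n -> niso id n n.
Proof.
elim/node_box_ind: n => n IH; case: n IH => [a b|a b|c|c|l r c|l r c|B aux p|p c|ps c].
7: {
  move=> IH /= /andP[/eqP sB]; rewrite well_formedE => /and3P[_ _ /allP wB].
  apply: niso_box_cong => //; apply/isoP; exists id; apply: isog_refl_in => n nB.
  exact: IH (wB _ nB). }
8: { by move=> _ _; apply: (@iWhy id); rewrite map_id. }
- by move=> _ _; exact: (@iAx id).
- by move=> _ _; exact: (@iCut id).
- by move=> _ _; exact: (@iOne id).
- by move=> _ _; exact: (@iBot id).
- by move=> _ _; exact: (@iTens id).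
- by move=> _ _; exact: (@iPar id).
- by move=> _ _; exact: (@iDer id).
Qed.

Lemma isog_refl R : all well_formed_node (nodes R) -> isog id R R.
Proof. by move/allP=> h; apply: isog_refl_in => n /h; exact: niso_refl. Qed.

Lemma wf_nodes R : well_formed R -> all well_formed_node (nodes R).
Proof. by rewrite well_formedE => /and3P[]. Qed.

Lemma iso_refl R : well_formed R -> iso R R.
Proof. by move/wf_nodes/isog_refl=> h; apply/isoP; exists id. Qed.

Lemma iso_refl_r R R' : iso R R' -> iso R' R'.
Proof. by move=> h; exact: iso_trans (iso_sym h) h. Qed.

(** * Existence of ?-normal forms *)

Lemma nsiso_flatten (f : node -> seq garc) g ns ns' :
  (forall n n', niso g n n' -> perm_eq (f n') (map g (f n))) ->
  nsiso g ns ns' ->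
  perm_eq (flatten (map f ns')) (map g (flatten (map f ns))).
Proof.
move=> h [ns1 fn p]; rewrite perm_sym.
apply: perm_trans (perm_flatten (perm_map f p)); rewrite perm_sym.
elim: fn {p} => //= n n' s t nn _ IH; rewrite map_cat perm_cat // h //.
Qed.

Lemma isog_tails g R R' : isog g R R' -> perm_eq (tails R') (map g (tails R)).
Proof. by case=> _ _ gn _; apply: nsiso_flatten gn => n n'; exact: niso_concls. Qed.

Lemma isog_heads g R R' : isog g R R' -> perm_eq (heads R') (map g (heads R)).
Proof.
case=> _ _ gn gc; rewrite /heads map_cat gc perm_cat2r.
by apply: nsiso_flatten gn => n n'; exact: niso_prems.
Qed.

Lemma tails_arcs R : {subset tails R <= arcs R}.
Proof. by move=> a aR; rewrite /arcs mem_cat aR. Qed.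

Lemma heads_arcs R : {subset heads R <= arcs R}.
Proof. by move=> a aR; rewrite /arcs mem_cat aR orbT. Qed.

Lemma isog_wf_in g R R' :
  (forall n, n \in nodes R -> forall g n', niso g n n' ->
     well_formed_node n -> well_formed_node n') ->
  isog g R R' -> well_formed R -> well_formed R'.
Proof.
move=> IH iR; rewrite !well_formedE => /and3P[u p /allP w].
have [gi _ gn _] := iR; apply/and3P; split.
- rewrite (perm_uniq (isog_tails iR)) map_inj_in_uniq // => a b /tails_arcs aR.
  by move/tails_arcs; exact: gi.
- rewrite (perm_trans (isog_tails iR)) // perm_sym (perm_trans (isog_heads iR)) //.
  by rewrite perm_map // perm_sym.
- apply/allP=> n' /(nsiso_mem_r gn)[n nR h]; exact: IH h (w _ nR).
Qed.

Lemma niso_wf n : forall g n', niso g n n' ->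
  well_formed_node n -> well_formed_node n'.
Proof.
elim/node_box_ind: n => n IH g n' H.
case: n IH H => [a b|a b|c|c|l r c|l r c|B aux p|p c|ps c] IH H.
7: {
  case/niso_bang_inv: H => k [bns [l [c [bns' [l' [aux' [eB -> [sl sl'] pz hi]]]]]]].
  subst B => /andP[_ w]; rewrite /well_formed_node -/well_formed.
  rewrite /= size_rcons sl' eqxx /=.
  have {w} := isog_wf_in (fun n nb => IH n nb) hi w; rewrite !well_formedE.
  suff e : perm_eq (heads (PS bns' (map k (rcons l c))))
                   (heads (PS bns' (rcons l' (k c)))).
    by case/and3P=> -> /= /perm_trans-> // ->.
  have [pl _] := perm_zip_unzip2 sl sl' pz.
  by rewrite /heads perm_cat2l map_rcons -!cats1 perm_cat2r perm_sym. }
all: by inversion H.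
Qed.

Lemma isog_wf g R R' : isog g R R' -> well_formed R -> well_formed R'.
Proof. by apply: isog_wf_in => n _; exact: niso_wf. Qed.

Lemma iso_wf R R' : iso R R' -> well_formed R -> well_formed R'.
Proof. by case/isoP=> g; exact: isog_wf. Qed.

(* A ? node weighs one more than its depth, so that pulling it out of a box
   makes the total weight drop. *)
Fixpoint weight (d : nat) (R : pstruct) : nat :=
  let: PS ns _ := R in sumn (map (node_weight d) ns)
with node_weight (d : nat) (n : node) : nat :=
  match n with
  | Why _ _ => d.+1
  | Bang B _ _ => weight d.+1 B
  | _ => 0
  end.

Lemma weightE d R : weight d R = sumn (map (node_weight d) (nodes R)).
Proof. by case: R. Qed.

Lemma nsiso_weight_in d g ns ns' :
  (forall n, n \in ns -> forall g n', niso g n n' ->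
     node_weight d n' = node_weight d n) ->
  nsiso g ns ns' ->
  sumn (map (node_weight d) ns') = sumn (map (node_weight d) ns).
Proof.
move=> IH [ns1 f p]; rewrite -(perm_sumn (perm_map _ p)).
elim: f IH {p} => //= n n' s t nn _ IHf IH; rewrite (IH n _ g) ?mem_head // IHf //.
by move=> m ms; apply: IH; rewrite in_cons ms orbT.
Qed.

Lemma niso_weight n : forall d g n', niso g n n' ->
  node_weight d n' = node_weight d n.
Proof.
elim/node_box_ind: n => n IH d g n' H.
case: n IH H => [a b|a b|c|c|l r c|l r c|B aux p|p c|ps c] IH H.
7: {
  case/niso_bang_inv: H => k [bns [l [c [bns' [l' [aux' [eB -> _ _ hi]]]]]]].
  subst B; have [_ _ hn _] := hi.
  by apply: nsiso_weight_in hn => m mb ? ?; apply: IH. }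
all: by inversion H.
Qed.

Lemma iso_weight R R' d : iso R R' -> weight d R' = weight d R.
Proof.
case/isoP=> g [_ _ gn _]; rewrite !weightE.
by apply: nsiso_weight_in gn => n _ h n'; exact: niso_weight.
Qed.

Lemma node_weight_map f d n : node_weight d (map_node f n) = node_weight d n.
Proof. by case: n => //= *; move. Qed.

Lemma weight_fuse c p d R : weight d (fuse c p R) = weight d R.
Proof.
rewrite !weightE /= -map_comp; congr sumn; apply: eq_map => n.
exact: node_weight_map.
Qed.

Lemma deep_weight R R' d : deep why_rule R R' -> weight d R' < weight d R.
Proof.
move=> h; elim: h d => {R R'} [R R' []|B B' aux p ns cs _ IH].
- by move=> ps c qs e ns cs d; rewrite /= addSn ltnS leq_addl.
- by move=> p c ns cs _ d; rewrite weight_fuse /= addSn ltnS leq_addl.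
- move=> qs c bns l1 l2 aux1 a aux2 p ns cs new _ _ X _ _ _ d; rewrite /X /=.
  by rewrite addnCA -addnA ltn_add2r.
- by move=> d; rewrite /= ltn_add2r IH.
Qed.

Lemma step_iso_l r R R1 R2 : iso R R1 -> step r R1 R2 -> step r R R2.
Proof. by move=> i [S [S' [j d k]]]; exists S, S'; split=> //; exact: iso_trans j. Qed.

Lemma steps_inv r (I : pstruct -> Prop) R R' :
  (forall S S', I S -> iso S S' -> I S') ->
  (forall S S', I S -> deep r S S' -> I S') ->
  steps r R R' -> I R -> I R'.
Proof.
move=> hi hd; elim=> {R R'} [R R' i IR|R S R' [R1 [R2 [i d j]]] _ IH IR].
  exact: hi i.
by apply: IH; apply: (hi _ _ _ j); apply: (hd _ _ _ d); exact: hi i.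
Qed.

(** Every step lowers the weight, and excluded middle tells whether a step exists. The hypothesis
    [iso R R] provides the empty reduction, which is a [steps_refl]. *)
Lemma why_nf_exists R : iso R R ->
  exists N, steps why_rule R N /\ why_normal N.
Proof.
have [k] := ubnP (weight 0 R); elim: k R => // k IH R lt iR.
case: (excluded_middle_informative (exists R', step why_rule R R')) => [[R' h]|h].
  have [R1 [R2 [i d j]]] := h.
  have [||N [s n]] := IH R'; last by exists N; split=> //; exact: steps_cons s.
    rewrite (iso_weight _ j); apply: leq_trans (deep_weight 0 d) _.
    by rewrite (iso_weight _ i) -ltnS.
  exact: iso_refl_r j.
exists R; split; first exact: steps_refl.
by move=> R' s; apply: h; exists R'.
Qed.

Lemma why_nfP R : iso R R ->
  steps why_rule R (why_nf R) /\ why_normal (why_nf R).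
Proof. by move/why_nf_exists; exact: epsilon_spec. Qed.

(** * Syntactic ?-normality *)

Definition why_concl (n : node) : seq garc := if n is Why _ c then [:: c] else [::].
Definition why_prems (n : node) : seq garc := if n is Why ps _ then ps else [::].
Definition why_concls (ns : seq node) := flatten (map why_concl ns).
Definition why_premss (ns : seq node) := flatten (map why_prems ns).

(** A boolean form of ?-normality at all depths, invariant under isomorphism. [take (size aux)]
    leaves out the conclusion of the box that corresponds to the principal port. *)
Fixpoint redex_free (R : pstruct) : bool :=
  let: PS ns _ := R in
  all redex_free_node ns && ~~ has (mem (why_premss ns)) (why_concls ns)
with redex_free_node (n : node) : bool :=
  match n with
  | Why ps _ => size ps != 1
  | Bang B aux _ =>
      redex_free B && ~~ has (mem (why_concls (nodes B))) (take (size aux) (concl B))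
  | _ => true
  end.

Lemma redex_freeE R : redex_free R =
  all redex_free_node (nodes R) && ~~ has (mem (why_premss (nodes R))) (why_concls (nodes R)).
Proof. by case: R. Qed.

Lemma mem_why_concls ns a :
  (a \in why_concls ns) = has (fun n => a \in why_concl n) ns.
Proof. by rewrite /why_concls; elim: ns => //= n ns; rewrite mem_cat => ->. Qed.

Lemma mem_why_premss ns a :
  (a \in why_premss ns) = has (fun n => a \in why_prems n) ns.
Proof. by rewrite /why_premss; elim: ns => //= n ns; rewrite mem_cat => ->. Qed.

Lemma why_concl_concls n : {subset why_concl n <= node_concls n}.
Proof. by case: n => //= *; move. Qed.

Lemma why_prems_prems n : {subset why_prems n <= node_prems n}.
Proof. by case: n => //= *; move. Qed.

Lemma why_concls_tails R : {subset why_concls (nodes R) <= tails R}.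
Proof.
move=> a; rewrite mem_why_concls mem_tails => /hasP[n nR an].
by apply/hasP; exists n => //; exact: why_concl_concls.
Qed.

Lemma why_premss_heads R : {subset why_premss (nodes R) <= heads R}.
Proof.
move=> a; rewrite mem_why_premss mem_cat mem_prems => /hasP[n nR an].
by apply/orP; left; apply/hasP; exists n => //; exact: why_prems_prems.
Qed.

Lemma niso_why_concl g n n' :
  niso g n n' -> perm_eq (why_concl n') (map g (why_concl n)).
Proof. by case=> //= *; exact: perm_refl. Qed.

Lemma niso_why_prems g n n' :
  niso g n n' -> perm_eq (why_prems n') (map g (why_prems n)).
Proof. by case=> //= *; exact: perm_refl. Qed.

Lemma isog_redex_free_in g R R' :
  (forall n, n \in nodes R -> forall g n', niso g n n' ->
     redex_free_node n -> redex_free_node n') ->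
  isog g R R' -> redex_free R -> redex_free R'.
Proof.
move=> IH [gi _ gn _]; rewrite !redex_freeE => /andP[/allP w d]; apply/andP; split.
  by apply/allP=> n' /(nsiso_mem_r gn)[n nR h]; exact: IH h (w _ nR).
apply: contra d => /hasP[a' /=].
rewrite (perm_mem (nsiso_flatten (@niso_why_concl g) gn)) => /mapP[a ac ->].
rewrite (perm_mem (nsiso_flatten (@niso_why_prems g) gn)) => /mapP[b bp e].
apply/hasP; exists a => //=; rewrite (gi a b) //.
  by apply: tails_arcs; exact: why_concls_tails.
by apply: heads_arcs; exact: why_premss_heads.
Qed.

Lemma niso_redex_free n : forall g n', niso g n n' ->
  redex_free_node n -> redex_free_node n'.
Proof.
elim/node_box_ind: n => n IH g n' H.
case: n IH H => [a b|a b|c|c|l r c|l r c|B aux p|p c|ps c] IH H.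
7: {
  case/niso_bang_inv: H => k [bns [l [c [bns' [l' [aux' [eB -> [sl sl'] pz hi]]]]]]].
  subst B => /andP[w h]; apply/andP; split.
    have := isog_redex_free_in (fun n nb => IH n nb) hi w.
    by rewrite !redex_freeE.
  have [pl _] := perm_zip_unzip2 sl sl' pz; have [ki _ kn _] := hi.
  apply: contra h => /hasP[a']; rewrite /= -sl' -cats1 take_size_cat //.
  rewrite (perm_mem pl) => /mapP[a al ->].
  rewrite (perm_mem (nsiso_flatten (@niso_why_concl k) kn)) => /mapP[b bb e].
  apply/hasP; exists a => /=; first by rewrite -sl -cats1 take_size_cat.
  rewrite (ki a b) //; first by apply: concl_arcs; rewrite mem_rcons in_cons al orbT.
  by apply: tails_arcs; apply: why_concls_tails. }
8: {
  inversion H as [| | | | | | | | |? ? qs ? pq|]; subst.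
  by rewrite /= (perm_size pq) size_map. }
all: by inversion H.
Qed.

Lemma iso_redex_free R R' : iso R R' -> redex_free R -> redex_free R'.
Proof. by case/isoP=> g; apply: isog_redex_free_in => n _; exact: niso_redex_free. Qed.

Lemma pull_redex_free qs c bns l1 l2 aux1 (a : garc) aux2 p :
  size l1 = size aux1 -> size l2 = (size aux2).+1 ->
  ~~ redex_free_node (Bang (PS (Why qs c :: bns) (l1 ++ c :: l2)) (aux1 ++ a :: aux2) p).
Proof.
move=> s1 s2; rewrite /= negb_and; apply/orP; right; rewrite negbK.
apply/hasP; exists c; last by rewrite /= mem_head.
rewrite size_cat /= -s1 addnS take_cat ltnNge leqW ?leq_addr //=.
by rewrite subSn ?leq_addr //= mem_cat mem_head orbT.
Qed.

(** Used to exclude steps inside the boxes of reachable nets. *)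
Lemma deep_redex_free R R' : deep why_rule R R' -> ~~ redex_free R.
Proof.
elim=> {R R'} [R R' []|B B' aux p ns cs _ IH].
- move=> ps c qs d ns cs /=; rewrite negb_and; apply/orP; right.
  rewrite negbK; apply/orP; left.
  by rewrite /= !mem_cat mem_head !orbT.
- by [].
- move=> qs c bns l1 l2 aux1 a aux2 p ns cs new s1 s2 X _ _ _.
  rewrite /X redex_freeE; apply/nandP; left; apply/nandP; left.
  exact: pull_redex_free.
- by rewrite redex_freeE /= (negbTE IH).
Qed.

(** * Local ax-steps *)

Lemma map_node_in f g n : {in narcs n, f =1 g} -> map_node f n = map_node g n.
Proof.
have e s : {subset s <= narcs n} -> {in narcs n, f =1 g} -> map f s = map g s.
  by move=> h k; apply/eq_in_map=> a /h/k.
case: n e => [a b|a b|c|c|l r c|l r c|B aux p|p c|ps c] e h.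
7: {
  rewrite /= h ?e // => [a aX|]; rewrite mem_rcons ?mem_head //.
  by rewrite in_cons aX orbT. }
8: { by rewrite /= h ?e // => [a aX|]; rewrite mem_cat ?mem_head ?orbT // aX. }
all: by rewrite /= ?h ?inE ?eqxx ?orbT.
Qed.

Lemma map_node_id n : map_node id n = n.
Proof. by case: n => *; rewrite /= ?map_id. Qed.

Lemma map_nodes_id f ns :
  (forall n, n \in ns -> {in narcs n, f =1 id}) -> map (map_node f) ns = ns.
Proof. by move=> h; apply: map_id_in => n /h/map_node_in->; exact: map_node_id. Qed.

Lemma wf_uniq_heads R : well_formed R -> uniq (heads R).
Proof. by rewrite well_formedE => /and3P[u /perm_uniq<-]. Qed.

(* The only instance of [ax_rule] that is needed, together with its context: the
   node below the fused arc is a ?d node.  The ? nodes are left untouched. *)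
Inductive ax_der : seq node -> seq node -> Prop :=
| ax_der_root a a' b d :
    ax_der [:: Ax a' a; Cut b a; Defs.Der a' d] [:: Defs.Der b d]
| ax_der_box N N' ns cs aux p : ax_der N N' ->
    ax_der [:: Bang (PS (N ++ ns) cs) aux p] [:: Bang (PS (N' ++ ns) cs) aux p].

(** The erased arcs [s] leave the tails and the heads together, so their balance and uniqueness
    survive the step. A step inside a box erases no arc outside it. *)
Lemma ax_der_arcs N N' : ax_der N N' -> exists s,
  perm_eq (flatten (map node_concls N)) (s ++ flatten (map node_concls N')) /\
  perm_eq (flatten (map node_prems N)) (s ++ flatten (map node_prems N')).
Proof.
case=> [a a' b d|{}N {}N' ns cs aux p _]; last by exists [::]; rewrite !perm_refl.
exists [:: a; a']; split; apply/permP=> P /=; lia.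
Qed.

Lemma ax_der_wf N N' : ax_der N N' -> forall ns cs,
  well_formed (PS (N ++ ns) cs) -> well_formed (PS (N' ++ ns) cs).
Proof.
have arcs_wf M M' : ax_der M M' -> forall ns cs,
    all well_formed_node (M' ++ ns) ->
    well_formed (PS (M ++ ns) cs) -> well_formed (PS (M' ++ ns) cs).
  move=> h ns cs wM'; have [s [pt ph]] := ax_der_arcs h.
  rewrite !well_formedE wM' andbT => /and3P[u p _].
  have qt : perm_eq (tails (PS (M ++ ns) cs)) (s ++ tails (PS (M' ++ ns) cs)).
    by rewrite /tails !map_cat !flatten_cat catA perm_cat2r.
  have qh : perm_eq (heads (PS (M ++ ns) cs)) (s ++ heads (PS (M' ++ ns) cs)).
    by rewrite /heads !map_cat !flatten_cat !catA !perm_cat2r.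
  apply/andP; split.
    by move: u; rewrite (perm_uniq qt) cat_uniq => /and3P[].
  rewrite -(perm_cat2l s); apply: perm_trans qh; apply: perm_trans p.
  by rewrite perm_sym.
elim=> {N N'} [a a' b d|N N' ms ds aux p h IH] ns cs w.
  apply: arcs_wf (w); first exact: ax_der_root.
  by case/and3P: (w) => _ _ /and4P[].
apply: arcs_wf (w); first exact: ax_der_box.
have /andP[/andP[e wB] wn] := wf_nodes w; apply/andP; split=> //.
by apply/andP; split=> //; exact: IH.
Qed.

Definition is_why (n : node) : bool := if n is Why _ _ then true else false.

Lemma ax_der_not_why N N' : ax_der N N' ->
  all (predC is_why) N /\ all (predC is_why) N'.
Proof. by case. Qed.

Lemma not_why_concls N : all (predC is_why) N -> why_concls N = [::].
Proof. by elim: N => // -[]. Qed.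

Lemma not_why_premss N : all (predC is_why) N -> why_premss N = [::].
Proof. by elim: N => // -[]. Qed.

Lemma why_concls_cat s t : why_concls (s ++ t) = why_concls s ++ why_concls t.
Proof. by rewrite /why_concls map_cat flatten_cat. Qed.

Lemma why_premss_cat s t : why_premss (s ++ t) = why_premss s ++ why_premss t.
Proof. by rewrite /why_premss map_cat flatten_cat. Qed.

Lemma redex_free_cat N ns cs : all (predC is_why) N ->
  redex_free (PS (N ++ ns) cs) = all redex_free_node N && redex_free (PS ns cs).
Proof.
move=> n; rewrite !redex_freeE /= all_cat why_concls_cat why_premss_cat.
by rewrite not_why_concls // not_why_premss // andbA.
Qed.

Lemma ax_der_redex_free N N' : ax_der N N' -> forall ns cs,
  redex_free (PS (N ++ ns) cs) -> redex_free (PS (N' ++ ns) cs).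
Proof.
elim=> {N N'} [a a' b d|N N' ms ds aux p h IH] ns cs; rewrite !redex_free_cat //.
have [n n'] := ax_der_not_why h.
case/andP=> /andP[/andP[f d] _] fn; move: d.
rewrite why_concls_cat not_why_concls // => d.
rewrite fn andbT /= andbT; apply/andP; split; first exact: (IH ms ds f).
by rewrite why_concls_cat not_why_concls.
Qed.

Lemma ax_der_map g N N' : ax_der N N' ->
  ax_der (map (map_node g) N) (map (map_node g) N').
Proof. by case=> *; [exact: ax_der_root|exact: ax_der_box]. Qed.

Lemma isog_of_nodes g R R' :
  {in arcs R &, injective g} -> {in arcs R, forall a, (g a).2 = a.2} ->
  nsiso g (nodes R) (nodes R') -> concl R' = map g (concl R) -> isog g R R'.
Proof. by []. Qed.

Lemma isog_id R R' : nsiso id (nodes R) (nodes R') -> concl R' = concl R ->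
  isog id R R'.
Proof. by move=> h e; apply: isog_of_nodes; rewrite ?map_id. Qed.

Lemma nsiso_refl ns : all well_formed_node ns -> nsiso id ns ns.
Proof. by move=> h; have [] := @isog_refl (PS ns [::]) h. Qed.

Lemma step_box r B B' aux p ns cs :
  all well_formed_node ns -> size (concl B) = (size aux).+1 ->
  size (concl B') = (size aux).+1 -> step r B B' ->
  step r (PS (Bang B aux p :: ns) cs) (PS (Bang B' aux p :: ns) cs).
Proof.
move=> w sB sB' [B1 [B1' [i d j]]].
exists (PS (Bang B1 aux p :: ns) cs), (PS (Bang B1' aux p :: ns) cs); split.
- apply/isoP; exists id; apply: isog_id => //; apply: nsiso_cons (nsiso_refl w).
  exact: niso_box_cong.
- exact: deep_box.
- apply/isoP; exists id; apply: isog_id => //; apply: nsiso_cons (nsiso_refl w).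
  apply: niso_box_cong => //; rewrite -sB'.
  by case/isoP: j => g [_ _ _ ->]; rewrite size_map.
Qed.

Lemma ax_der_step N N' : ax_der N N' -> forall ns cs,
  well_formed (PS (N ++ ns) cs) -> step ax_rule (PS (N ++ ns) cs) (PS (N' ++ ns) cs).
Proof.
elim=> {N N'} [a a' b d|N N' ms ds aux p h IH] ns cs w; last first.
  move: (w); rewrite well_formedE => /and3P[_ _ /=/andP[/andP[/eqP sB wB] wn]].
  by apply: step_box => //; apply: IH.
have wn := wf_nodes w; move/and4P: (wn) => [_ _ _ wns].
have ut : uniq [:: a', a, d & flatten (map node_concls ns)].
  by move: w; rewrite well_formedE => /and3P[].
have uh : uniq ([:: b, a, a' & flatten (map node_prems ns) ++ cs]).
  exact: wf_uniq_heads w.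
(* Since tails and heads are unique, [a'] occurs only in the ax node and as premise of the ?d node;
   fusing it with [b] thus changes the ?d node alone. *)
have e : PS (Defs.Der b d :: ns) cs = fuse a' b (PS (Defs.Der a' d :: ns) cs).
  move: ut uh => /and3P[ut1 _ _] /and4P[_ _ uh1 _].
  rewrite /fuse /map_arcs /= eqxx.
  have -> : (if d == a' then b else d) = d.
    case: eqP => // e; move: ut1; rewrite e !inE eqxx orbT //.
  rewrite map_nodes_id; last first.
    move=> n nns x xn /=; case: eqP => // e; subst x.
    move: xn; rewrite mem_cat => /orP[xp|xc].
      move: uh1; rewrite mem_cat mem_prems negb_or => /andP[/hasPn/(_ n nns)].
      by rewrite /= xp.
    move: ut1; rewrite !in_cons !negb_or => /and3P[_ _].
    by rewrite (mem_tails (PS ns cs)) => /hasPn/(_ n nns); rewrite /= xc.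
  rewrite map_id_in // => x xcs; case: eqP => // e; subst x.
  by move: uh1; rewrite mem_cat xcs orbT.
exists (PS (Ax a a' :: Cut a b :: Defs.Der a' d :: ns) cs), (PS (Defs.Der b d :: ns) cs).
split.
- apply/isoP; exists id; apply: isog_id => //.
  apply: nsiso_cons; first exact: (@iAxC id).
  apply: nsiso_cons; first exact: (@iCutC id).
  apply: nsiso_cons; first exact: (@iDer id).
  exact: nsiso_refl.
- apply: deep_root; rewrite e; apply: AxRule.
  move: uh => /= /and3P[]; rewrite !inE !negb_or => /and3P[-> -> _] //.
- apply: iso_refl; exact: (ax_der_wf (ax_der_root a a' b d) (ns := ns) w).
Qed.

(** In contrast with [steps ax_rule], each step displays the nodes it rewrites, so that it can be
    replayed in a larger net and after ?-normalization. *)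
Inductive ax_ders : pstruct -> pstruct -> Prop :=
| ax_ders_iso R R' : iso R R' -> ax_ders R R'
| ax_ders_step R N N' ns cs R' : iso R (PS (N ++ ns) cs) -> ax_der N N' ->
    ax_ders (PS (N' ++ ns) cs) R' -> ax_ders R R'.

Lemma ax_ders_steps R R' : well_formed R -> ax_ders R R' -> steps ax_rule R R'.
Proof.
move=> w h; elim: h w => {R R'} [R R' i|R N N' ns cs R' i h _ IH] w.
  exact: steps_refl.
have w' := iso_wf i w.
apply: (@steps_cons _ _ (PS (N' ++ ns) cs)).
  apply: step_iso_l i _; exact: ax_der_step.
apply: IH; exact: ax_der_wf w'.
Qed.

Lemma ax_ders_iso_l R R1 R' : iso R R1 -> ax_ders R1 R' -> ax_ders R R'.
Proof.
move=> i h; case: h i => {R1 R'} [R1 R' j|R1 N N' ns cs R' j h s] i.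
  by apply: ax_ders_iso; exact: iso_trans j.
by apply: ax_ders_step h s; exact: iso_trans j.
Qed.

Lemma ax_ders_trans R1 R2 R3 : ax_ders R1 R2 -> ax_ders R2 R3 -> ax_ders R1 R3.
Proof.
elim=> {R1 R2} [R R' i|R N N' ns cs R' i h _ IH] s; first exact: ax_ders_iso_l s.
exact: ax_ders_step i h (IH s).
Qed.

(** * The invariant of the nets of terms *)

Definition why_typed (n : node) : bool :=
  if n is Why ps c then all (fun p => p.2 == c.2) ps else true.

Definition ctx_type (A : output) : formula := In (IWhy (negO A)).

(** Redex-freeness confines later ?-reduction to the ? nodes at the interface of a construction.
    [why_typed] ensures that erasing a unary ? node, which renames its conclusion, does not change
    types. *)
Definition good (G : bctx) (A : output) (R : pstruct) : Prop :=
  [/\ well_formed R, redex_free R, all why_typed (nodes R) &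
      map snd (concl R) = rcons (map ctx_type G) (Out A)].

Lemma isog_types g R R' : isog g R R' -> map snd (concl R') = map snd (concl R).
Proof.
case=> _ gt _ ->; rewrite -map_comp; apply/eq_in_map=> a aR.
by rewrite /= gt // concl_arcs.
Qed.

Lemma isog_why_typed g R R' : isog g R R' ->
  all why_typed (nodes R) -> all why_typed (nodes R').
Proof.
case=> _ gt gn _ /allP w; apply/allP=> n' /(nsiso_mem_r gn)[n nR h].
have /= t := w _ nR; have sR := narcs_arcs nR.
inversion h as [| | | | | | | | |? ps qs c pq|]; subst => //.
move/allP: t => t; apply/allP=> q /=; rewrite (perm_mem pq) => /mapP[p pp ->].
by rewrite !gt ?t // sR // mem_cat ?pp ?mem_head ?orbT.
Qed.

Lemma good_iso G A R R' : good G A R -> iso R R' -> good G A R'.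
Proof.
move=> [w f t c] i; split; [exact: iso_wf w|exact: iso_redex_free f| |].
  by case/isoP: i => g /isog_why_typed; apply.
by case/isoP: i => g /isog_types->.
Qed.

Lemma good_ax_der G A N N' ns cs : ax_der N N' ->
  good G A (PS (N ++ ns) cs) -> good G A (PS (N' ++ ns) cs).
Proof.
move=> h [w f t c]; split=> //; first exact: ax_der_wf w.
  exact: ax_der_redex_free f.
move: t; rewrite /= !all_cat => /andP[_ ->]; rewrite andbT.
by have [_ /allP n'] := ax_der_not_why h; apply/allP=> -[] // ps d /n'.
Qed.

(** For promotion, abstraction and each argument of [App_d], this leaves two cases: an isomorphism
    and a single local step. *)
Lemma ax_ders_cong (F : pstruct -> pstruct) (I : pstruct -> Prop) :
  (forall R R', I R -> iso R R' -> I R') ->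
  (forall N N' ns cs, ax_der N N' -> I (PS (N ++ ns) cs) -> I (PS (N' ++ ns) cs)) ->
  (forall R R', I R -> iso R R' -> iso (F R) (F R')) ->
  (forall N N' ns cs, ax_der N N' -> I (PS (N ++ ns) cs) ->
     ax_ders (F (PS (N ++ ns) cs)) (F (PS (N' ++ ns) cs))) ->
  forall R R', ax_ders R R' -> I R -> ax_ders (F R) (F R').
Proof.
move=> Ii Ia Fi Fa R R'; elim=> {R R'} [R R' i IR|R N N' ns cs R' i h _ IH IR].
  by apply: ax_ders_iso; exact: Fi.
have I1 := Ii _ _ IR i; apply: ax_ders_iso_l (Fi _ _ IR i) _.
by apply: ax_ders_trans (Fa _ _ _ _ h I1) (IH _); exact: Ia h I1.
Qed.

Lemma good_ax_ders G A R R' : good G A R -> ax_ders R R' -> good G A R'.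
Proof.
move=> g h; elim: h g => {R R'} [R R' i|R N N' ns cs R' i h _ IH] g.
  exact: good_iso i.
by apply: IH; apply: good_ax_der h _; exact: good_iso i.
Qed.

(** * ?-normal forms of applications *)

Definition concls_of (ns : seq node) := flatten (map node_concls ns).
Definition prems_of (ns : seq node) := flatten (map node_prems ns).

Lemma concls_of_cat s t : concls_of (s ++ t) = concls_of s ++ concls_of t.
Proof. by rewrite /concls_of map_cat flatten_cat. Qed.

Lemma prems_of_cat s t : prems_of (s ++ t) = prems_of s ++ prems_of t.
Proof. by rewrite /prems_of map_cat flatten_cat. Qed.

Lemma tailsE R : tails R = concls_of (nodes R).
Proof. by []. Qed.

Lemma headsE R : heads R = prems_of (nodes R) ++ concl R.
Proof. by []. Qed.

Lemma perm_concls_of s t : perm_eq s t -> perm_eq (concls_of s) (concls_of t).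
Proof. by move=> p; exact: perm_flatten (perm_map _ p). Qed.

Lemma perm_prems_of s t : perm_eq s t -> perm_eq (prems_of s) (prems_of t).
Proof. by move=> p; exact: perm_flatten (perm_map _ p). Qed.

Lemma mem_concls_of n ns : n \in ns -> {subset node_concls n <= concls_of ns}.
Proof. by move=> h a an; apply/flattenP; exists (node_concls n) => //; exact: map_f. Qed.

Lemma mem_prems_of n ns : n \in ns -> {subset node_prems n <= prems_of ns}.
Proof. by move=> h a an; apply/flattenP; exists (node_prems n) => //; exact: map_f. Qed.

Lemma why_conclsP ns c : reflect (exists ps, Why ps c \in ns) (c \in why_concls ns).
Proof.
rewrite mem_why_concls; apply: (iffP hasP) => [[n nn]|[ps h]].
  by case: n nn => //= ps d h; rewrite inE => /eqP->; exists ps.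
by exists (Why ps c) => //=; exact: mem_head.
Qed.

Lemma why_premssP ns p :
  reflect (exists ps c, Why ps c \in ns /\ p \in ps) (p \in why_premss ns).
Proof.
rewrite mem_why_premss; apply: (iffP hasP) => [[n nn]|[ps [c [h pp]]]].
  by case: n nn => //= ps d h pp; exists ps, d.
by exists (Why ps c).
Qed.

Lemma why_concls_sub ns : {subset why_concls ns <= concls_of ns}.
Proof. exact: (@why_concls_tails (PS ns [::])). Qed.

Lemma why_premss_sub ns : {subset why_premss ns <= prems_of ns}.
Proof.
move=> a /why_premssP[ps [c [h ap]]].
exact: (mem_prems_of h).
Qed.

Lemma all_whyP W n : all is_why W -> n \in W -> exists ps c, n = Why ps c.
Proof. by move/allP=> h /h; case: n => // ps c _; exists ps, c. Qed.

Lemma all_why_concls W : all is_why W -> concls_of W = why_concls W.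
Proof. by elim: W => //= -[] // ps c W IH /IH; rewrite /concls_of /= => ->. Qed.

Lemma all_why_prems W : all is_why W -> prems_of W = why_premss W.
Proof. by elim: W => //= -[] // ps c W IH /IH; rewrite /prems_of /= => ->. Qed.

Lemma wf_intro ns cs : uniq (concls_of ns) -> perm_eq (concls_of ns) (prems_of ns ++ cs) ->
  all well_formed_node ns -> well_formed (PS ns cs).
Proof. by move=> u p w; rewrite well_formedE; apply/and3P. Qed.

(* The part of a net that no ?-step below will modify. *)
Record core (NN : seq node) (o : garc) : Prop := Core {
  core_free : all redex_free_node NN;
  core_flat : ~~ has (mem (why_premss NN)) (why_concls NN);
  core_typed : all why_typed NN;
  core_closed : {subset o :: prems_of NN <= concls_of NN};
  core_why : {subset why_concls NN <= prems_of NN} }.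

(* [src a] lists the arcs that reach [a] through the ? nodes of [W], and [fr]
   records the sources of the conclusions: this is what the steps preserve.
   [rank] excludes cycles of ? nodes. *)
Record joining (NN : seq node) (o : garc) (fr : seq (seq garc)) (tau : seq formula)
    (X : pstruct) (W : seq node) (cs : seq garc) (src : garc -> seq garc)
    (rank : garc -> nat) : Prop := Joining {
  jn_nodes : perm_eq (nodes X) (W ++ NN);
  jn_concl : concl X = rcons cs o;
  jn_why : all is_why W;
  jn_typed : all why_typed W;
  jn_wf : well_formed X;
  jn_tau : map snd cs = tau;
  jn_leaf : forall a, a \in concls_of NN -> a \notin why_concls NN -> src a = [:: a];
  jn_src : forall ps c, Why ps c \in W -> perm_eq (src c) (flatten (map src ps));
  jn_rank : forall ps c, Why ps c \in W -> {in ps, forall p, rank p < rank c};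
  jn_fr : all2 (fun c f => perm_eq (src c) f) cs fr }.

Section Joining.
Variables (NN : seq node) (o : garc) (fr : seq (seq garc)) (tau : seq formula).
Hypothesis coreN : core NN o.

Section Facts.
Variables (X : pstruct) (W : seq node) (cs : seq garc) (src : garc -> seq garc).
Variable rank : garc -> nat.
Hypothesis J : joining NN o fr tau X W cs src rank.

Lemma jn_tails : perm_eq (tails X) (concls_of W ++ concls_of NN).
Proof. by rewrite -concls_of_cat; exact: perm_concls_of (jn_nodes J). Qed.

Lemma jn_heads : perm_eq (heads X) (prems_of W ++ prems_of NN ++ rcons cs o).
Proof.
rewrite catA -prems_of_cat /heads (jn_concl J) perm_cat2r.
exact: perm_prems_of (jn_nodes J).
Qed.

Lemma jn_wf_node : all well_formed_node (nodes X).
Proof. exact: wf_nodes (jn_wf J). Qed.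

Lemma jn_uniq_tails : uniq (concls_of W ++ concls_of NN).
Proof.
rewrite -(perm_uniq jn_tails); have := jn_wf J.
by rewrite well_formedE => /and3P[].
Qed.

Lemma jn_uniq_heads : uniq (prems_of W ++ prems_of NN ++ rcons cs o).
Proof. by rewrite -(perm_uniq jn_heads) wf_uniq_heads // (jn_wf J). Qed.

Lemma jn_balance a : (a \in concls_of W ++ concls_of NN) =
  (a \in prems_of W ++ prems_of NN ++ rcons cs o).
Proof.
rewrite -(perm_mem jn_tails) -(perm_mem jn_heads).
by have := jn_wf J; rewrite well_formedE => /and3P[_ /perm_mem].
Qed.

Lemma jn_tailsW a : a \in concls_of W -> a \notin concls_of NN.
Proof.
have := jn_uniq_tails; rewrite cat_uniq => /and3P[_ /hasPn h _] aW.
by apply: contraTN aW => /h.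
Qed.

Lemma jn_why_coreP a : a \in why_concls NN ->
  a \notin prems_of W /\ a \notin rcons cs o.
Proof.
move=> /(core_why coreN) aN; have := jn_uniq_heads.
rewrite cat_uniq => /and3P[_ /hasPn h]; rewrite cat_uniq => /and3P[_ /hasPn k _].
by split; [apply: h; rewrite mem_cat aN|apply: contraTN aN => /k].
Qed.

Lemma jn_premsN a : a \in prems_of NN -> a \notin concls_of W.
Proof.
move=> aN; apply/negP=> /jn_tailsW; rewrite (core_closed coreN) //.
by rewrite in_cons aN orbT.
Qed.

Lemma jn_o : o \notin concls_of W.
Proof. by apply/negP=> /jn_tailsW; rewrite (core_closed coreN) ?mem_head. Qed.

(** A merging redex lies within [W]: the ? nodes of the core conclude into premises of the core, no
    premise of the core starts in [W], and the core itself has no redex. *)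
Lemma jn_redex ps c qs d ns : perm_eq (nodes X) [:: Why ps c, Why qs d & ns] ->
  c \in qs -> exists2 W2, perm_eq W [:: Why ps c, Why qs d & W2] &
                          perm_eq ns (W2 ++ NN).
Proof.
move=> p cq; have q := jn_nodes J.
have nW n : n \in nodes X -> n \notin NN -> n \in W.
  by rewrite (perm_mem q) mem_cat => /orP[|->].
have dN : Why qs d \notin NN.
  apply/negP=> dN; have cN : c \in prems_of NN by exact: (mem_prems_of dN).
  have: Why ps c \in nodes X by rewrite (perm_mem p) mem_head.
  rewrite (perm_mem q) mem_cat => /orP[cW|cW].
    have := jn_premsN cN; rewrite (mem_concls_of cW) //; exact: mem_head.
  have := core_flat coreN; apply/negP; rewrite negbK; apply/hasP; exists c.
    by apply/why_conclsP; exists ps.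
  by apply/why_premssP; exists qs, d.
have cN : Why ps c \notin NN.
  apply/negP=> cN; have dW : Why qs d \in W.
    by apply: nW => //; rewrite (perm_mem p) !in_cons eqxx orbT.
  have: c \in why_concls NN by apply/why_conclsP; exists ps.
  by case/jn_why_coreP; rewrite (mem_prems_of dW).
have cW : Why ps c \in W by apply: nW => //; rewrite (perm_mem p) mem_head.
have p1 : perm_eq (Why qs d :: ns) (rem (Why ps c) W ++ NN).
  rewrite -(perm_cons (Why ps c)) -cat_cons perm_sym; apply: perm_trans p.
  rewrite perm_sym (perm_trans q) // perm_cat2r; exact: perm_to_rem.
have dW : Why qs d \in rem (Why ps c) W.
  have: Why qs d \in rem (Why ps c) W ++ NN by rewrite -(perm_mem p1) mem_head.
  by rewrite mem_cat (negbTE dN) orbF.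
exists (rem (Why qs d) (rem (Why ps c) W)).
  apply: perm_trans (perm_to_rem cW) _; rewrite perm_cons; exact: perm_to_rem.
rewrite -(perm_cons (Why qs d)) -cat_cons (perm_trans p1) // perm_cat2r.
exact: perm_to_rem.
Qed.

(** The same [src] and [rank] serve after merging, because the sources of the vanished arc [c] are
    those of [ps], and ranks compose by transitivity. *)
Lemma jn_merge ps c qs d ns : perm_eq (nodes X) [:: Why ps c, Why qs d & ns] ->
  c \in qs -> exists W',
  joining NN o fr tau (PS (Why (ps ++ rem c qs) d :: ns) (concl X)) W' cs src rank.
Proof.
move=> p cq; have [W2 pW pn] := jn_redex p cq.
exists (Why (ps ++ rem c qs) d :: W2); have pq := perm_to_rem cq.
have cW : Why ps c \in W by rewrite (perm_mem pW) mem_head.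
have dW : Why qs d \in W by rewrite (perm_mem pW) !in_cons eqxx orbT.
have sub n : n \in W2 -> n \in W by move=> nW; rewrite (perm_mem pW) !in_cons nW !orbT.
have := jn_why J; rewrite (perm_all _ pW) => /and3P[_ _ wW2].
have := jn_typed J; rewrite (perm_all _ pW) => /and3P[tc td tW2].
split=> //.
- by rewrite /= perm_cons.
- exact: jn_concl J.
- apply/andP; split=> //; apply/allP=> x.
  rewrite mem_cat => /orP[xp|/mem_rem xq]; last exact: (allP td).
  by rewrite (eqP (allP tc _ xp)); exact: (allP td).
- have := jn_wf J; rewrite !well_formedE => /and3P[u b /allP w].
  have pt : perm_eq (tails X) (c :: tails (PS (Why (ps ++ rem c qs) d :: ns) (concl X))).
    by rewrite (perm_trans (perm_concls_of p)).
  have ph : perm_eq (heads X) (c :: heads (PS (Why (ps ++ rem c qs) d :: ns) (concl X))).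
    rewrite headsE; apply: (@perm_trans _ (prems_of (Why ps c :: Why qs d :: ns) ++ concl X)).
      by rewrite perm_cat2r; exact: perm_prems_of.
    set H := prems_of ns ++ concl X.
    rewrite (_ : prems_of _ ++ _ = ps ++ qs ++ H); last by rewrite /prems_of /= -!catA.
    rewrite (_ : _ :: _ = [:: c] ++ ps ++ rem c qs ++ H); last first.
      by rewrite /heads /= -!catA.
    by rewrite [X in perm_eq _ X]catA perm_sym -catA perm_catCA perm_cat2l perm_sym catA
      perm_cat2r.
  apply/and3P; split.
  + by move: u; rewrite (perm_uniq pt) => /andP[].
  + rewrite -(perm_cons c); apply: perm_trans (perm_trans b ph).
    by rewrite perm_sym.
  + by apply/allP=> n; rewrite in_cons => /predU1P[->//|nn]; apply: w;
      rewrite (perm_mem p) !in_cons nn !orbT.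
- exact: jn_tau J.
- exact: jn_leaf J.
- move=> ps' c'; rewrite in_cons => /predU1P[[-> ->]|/sub]; last exact: (jn_src J).
  rewrite (perm_trans (jn_src J dW)) //.
  apply: perm_trans (perm_flatten (perm_map src pq)) _.
  by rewrite map_cat flatten_cat perm_cat2r /= (jn_src J cW).
- move=> ps' c'; rewrite in_cons => /predU1P[[-> ->]|/sub]; last exact: (jn_rank J).
  move=> x; rewrite mem_cat => /orP[xp|/mem_rem xq]; last exact: (jn_rank J dW).
  exact: ltn_trans (jn_rank J cW xp) (jn_rank J dW cq).
- exact: jn_fr J.
Qed.

(** [c] and its only premise [p] have the same sources, so [src] and [rank] survive the renaming of
    [c] into [p]. As [c] may be a conclusion of the net, the list of conclusions changes. *)
Lemma jn_erase p c ns : perm_eq (nodes X) (Why [:: p] c :: ns) -> p != c ->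
  exists W' cs',
  joining NN o fr tau (fuse c p (PS ns (concl X))) W' cs' src rank.
Proof.
move=> pX pc; have q := jn_nodes J.
have cN : Why [:: p] c \notin NN.
  by apply/negP=> cN; have := allP (core_free coreN) _ cN.
have cW : Why [:: p] c \in W.
  have: Why [:: p] c \in nodes X by rewrite (perm_mem pX) mem_head.
  by rewrite (perm_mem q) mem_cat (negbTE cN) orbF.
set W1 := rem (Why [:: p] c) W; have pW := perm_to_rem cW.
have pn : perm_eq ns (W1 ++ NN).
  rewrite -(perm_cons (Why [:: p] c)) perm_sym; apply: perm_trans pX.
  rewrite perm_sym (perm_trans q) // -cat_cons perm_cat2r; exact: perm_to_rem.
set f := fun e => if e == c then p else e.
have ut := jn_uniq_tails; have uh := jn_uniq_heads.
have c_t : c \in concls_of W by rewrite (mem_concls_of cW) ?mem_head.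
have fN : map (map_node f) NN = NN.
  apply: map_nodes_id => n nN x; rewrite mem_cat /f; case: eqP => // ->.
  case/orP=> [/(mem_prems_of nN) xN|/(mem_concls_of nN) xN].
    by have := jn_premsN xN; rewrite c_t.
  by have := jn_tailsW c_t; rewrite xN.
have fo : f o = o by rewrite /f; case: eqP => // e; have := jn_o; rewrite e c_t.
have sub n : n \in W1 -> n \in W by exact: mem_rem.
have srcf a : perm_eq (src (f a)) (src a).
  rewrite /f; case: eqP => // ->; rewrite perm_sym (perm_trans (jn_src J cW)) //=.
  by rewrite cats0.
have ut1 : uniq (c :: concls_of W1 ++ concls_of NN).
  have e : perm_eq (concls_of W ++ concls_of NN) (c :: concls_of W1 ++ concls_of NN).
    by rewrite -cat_cons perm_cat2r; exact: (perm_concls_of pW).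
  by rewrite -(perm_uniq e).
have fc ps d : Why ps d \in W1 -> f d = d.
  move=> dW; rewrite /f; case: eqP => // e; move: ut1.
  by rewrite /= mem_cat (mem_concls_of dW) //= e mem_head.
have := jn_why J; rewrite (perm_all _ pW) => /andP[_ wW1].
have := jn_typed J; rewrite (perm_all _ pW) => /andP[/andP[/eqP tp _] tW1].
have tf a : (f a).2 = a.2 by rewrite /f; case: eqP => // ->.
have w' n : n \in map (map_node f) W1 -> exists ps d,
    [/\ n = Why (map f ps) d & Why ps d \in W1].
  case/mapP=> m mW ->; have [ps [d e]] := all_whyP wW1 mW; rewrite e in mW *.
  by exists ps, d; rewrite /= (fc _ _ mW).
exists (map (map_node f) W1), (map f cs); split.
- by rewrite /= -[in X in perm_eq _ (_ ++ X)]fN -map_cat perm_map.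
- by rewrite -[X in rcons _ X]fo -map_rcons -(jn_concl J).
- by apply/allP=> n /w'[ps [d [-> _]]].
- apply/allP=> n /w'[ps [d [-> dW]]]; rewrite /= all_map; apply/allP=> x xp /=.
  by rewrite tf; have := allP (allP tW1 _ dW) _ xp.
- have := jn_wf J; rewrite well_formedE => /and3P[u b w].
  have nf : forall n, n \in ns -> map f (node_concls n) = node_concls n.
    move=> n; rewrite (perm_mem pn) mem_cat => /orP[nW|nN]; apply: map_id_in => x xn.
      have [ps [d e]] := all_whyP wW1 nW; subst n.
      by move: xn; rewrite inE => /eqP->; exact: fc nW.
    rewrite /f; case: eqP => // e; have := jn_tailsW c_t.
    by rewrite -e (mem_concls_of nN).
  have mt : concls_of (map (map_node f) ns) = concls_of ns.
    rewrite /concls_of -map_comp; congr flatten; apply/eq_in_map=> n nn /=.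
    rewrite -[RHS]nf //; case: (n) => //= *; by rewrite map_rcons.
  have mh : prems_of (map (map_node f) ns) = map f (prems_of ns).
    rewrite /prems_of map_flatten -!map_comp; congr flatten; apply/eq_in_map=> n nn /=.
    by case: (n).
  have pt : perm_eq (tails X) (c :: concls_of ns) by exact: perm_concls_of pX.
  have ph : perm_eq (heads X) (p :: (prems_of ns ++ concl X)).
    by rewrite headsE -cat_cons perm_cat2r; exact: perm_prems_of pX.
  apply: wf_intro.
  + by rewrite mt; move: u; rewrite (perm_uniq pt) => /andP[].
  (* With the erased node, [p] disappears from the heads and [c] from the tails. The only other head
     [c] becomes [p], which restores the balance. *)
  + rewrite mt mh -map_cat; set H := prems_of ns ++ concl X.
    have e1 : perm_eq (c :: concls_of ns) (p :: H).
      by apply: perm_trans (perm_trans b ph); rewrite perm_sym.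
    have cH : c \in H.
      have: c \in p :: H by rewrite -(perm_mem e1) mem_head.
      by rewrite in_cons eq_sym (negbTE pc).
    have e2 := perm_to_rem cH.
    have e3 : perm_eq (concls_of ns) (p :: rem c H).
      rewrite -(perm_cons c) (perm_trans e1) //.
      apply: perm_trans (perm_cat (perm_refl [:: p]) e2) _.
      by rewrite (perm_catCA [:: p] [:: c] (rem c H)).
    rewrite (perm_trans e3) // perm_sym (perm_trans (perm_map f e2)) //= {1}/f eqxx.
    rewrite perm_cons map_id_in // => x xr; rewrite /f; case: eqP => // e; subst x.
    move: u; rewrite (perm_uniq pt) (perm_uniq e1) (perm_uniq (perm_cat (perm_refl [:: p]) e2)).
    by rewrite /= xr !andbF.
  + apply/allP=> n /mapP[m mn ->]; have wm : well_formed_node m.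
      by apply: (allP w); rewrite (perm_mem pX) in_cons mn orbT.
    by case: m wm {mn} => //= *; rewrite size_map.
- by rewrite -(jn_tau J) -map_comp; apply: eq_map.
- exact: jn_leaf J.
- move=> ps' d' /w'[ps [d [[-> ->] /sub dW]]].
  rewrite (perm_trans (jn_src J dW)) //; elim: (ps) => //= x s IH.
  by rewrite perm_cat // perm_sym srcf.
- move=> ps' d' /w'[ps [d [[-> ->] /sub dW]]] x /mapP[y yp ->].
  have := jn_rank J dW yp; rewrite /f; case: eqP => // ->.
  by apply: ltn_trans; apply: (jn_rank J cW); exact: mem_head.
- have := jn_fr J; elim: (cs) (fr) => //= x s IH [|y t] //= /andP[h /IH->].
  by rewrite andbT (perm_trans (srcf x)).
Qed.

End Facts.
End Joining.

(** Merging and erasing create no arc, so the renaming given for a net also serves for its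
    reduct. *)
Lemma isog_sub g X R X' R' : isog g X R -> {subset arcs X' <= arcs X} ->
  nsiso g (nodes X') (nodes R') -> concl R' = map g (concl X') -> isog g X' R'.
Proof.
move=> [gi gt _ _] s gn gc; split=> // [a b /s aX /s bX|a /s aX]; first exact: gi.
exact: gt.
Qed.

Lemma niso_map g f f' n n' : niso g n n' ->
  {in narcs n, forall a, f' (g a) = g (f a)} ->
  niso g (map_node f n) (map_node f' n').
Proof.
case: n => [a b|a b|c|c|l r c|l r c|B aux p|p c|ps c] H e.
7: {
  case/niso_bang_inv: H => k [bns [l [c [bns' [l' [aux' [-> -> [sl sl'] pz hi]]]]]]].
  rewrite /= e; last by rewrite mem_rcons mem_head.
  apply: niso_bang hi; rewrite ?size_map //.
  have e1 : zip l' (map f' aux') = map (map_pair id f') (zip l' aux').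
    by elim: (l') (aux') => [|x s IH] [|y t] //=; rewrite IH.
  rewrite e1 (perm_trans (perm_map _ pz)) // -map_comp.
  suff -> : map (map_pair id f' \o map_pair k g) (zip l aux) =
            map (map_pair k g) (zip l (map f aux)) by [].
  have : {in aux, forall a, f' (g a) = g (f a)}.
    by move=> a aX; apply: e; rewrite mem_rcons in_cons aX orbT.
  elim: (l) (aux) => [|x s IH] [|y t] //= h; rewrite /map_pair /= h ?mem_head //.
  by rewrite IH // => a aX; apply: h; rewrite in_cons aX orbT. }
8: {
  inversion H as [| | | | | | | | |? ? qs ? pq|]; subst.
  rewrite /= e; last by rewrite mem_cat mem_head orbT.
  apply: iWhy; rewrite (perm_trans (perm_map f' pq)) // -!map_comp.
  suff -> : map (f' \o g) ps = map (g \o f) ps by [].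
  by apply/eq_in_map=> a ap; rewrite /= e // mem_cat ap. }
all: by inversion H; subst; rewrite /= !e ?inE ?eqxx ?orbT //; constructor.
Qed.

Lemma nsiso_map g f f' ns ns' : nsiso g ns ns' ->
  (forall n, n \in ns -> {in narcs n, forall a, f' (g a) = g (f a)}) ->
  nsiso g (map (map_node f) ns) (map (map_node f') ns').
Proof.
move=> [ns1 h p] e; exists (map (map_node f') ns1); last exact: perm_map.
elim: h e {p} => /= [|n n' s t nn _ IH] e; constructor.
  by apply: niso_map => //; apply: e; exact: mem_head.
by apply: IH => m ms; apply: e; rewrite in_cons ms orbT.
Qed.

Lemma niso_why_inv g n ps c : niso g n (Why ps c) ->
  exists ps0 c0, [/\ n = Why ps0 c0, perm_eq ps (map g ps0) & c = g c0].
Proof. by move=> h; inversion h; subst; eexists; eexists; split. Qed.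

Lemma mem_arcs_cons n ns cs a :
  (a \in arcs (PS (n :: ns) cs)) = (a \in narcs n) || (a \in arcs (PS ns cs)).
Proof. by rewrite !mem_arcs /= orbA. Qed.

Lemma arcs_perm X ns : perm_eq (nodes X) ns -> arcs X =i arcs (PS ns (concl X)).
Proof. by move=> p a; rewrite !mem_arcs /= (perm_has _ p). Qed.

Lemma iso_front X ns : all well_formed_node (nodes X) -> perm_eq (nodes X) ns ->
  iso X (PS ns (concl X)).
Proof.
move=> w p; apply/isoP; exists id; apply: isog_id => //=.
by apply: nsiso_perm (perm_refl _) p (nsiso_refl w).
Qed.

Lemma why_normal_front X ns R' : all well_formed_node (nodes X) ->
  perm_eq (nodes X) ns -> why_rule (PS ns (concl X)) R' ->
  all well_formed_node (nodes R') -> ~ why_normal X.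
Proof.
move=> w p r w' h; apply: (h R'); exists (PS ns (concl X)), R'; split.
- exact: iso_front.
- exact: deep_root.
- by apply/isoP; exists id; exact: isog_refl.
Qed.

(** * Nets reachable by merging and erasing *)

Section Joining.
Variables (NN : seq node) (o : garc) (fr : seq (seq garc)) (tau : seq formula).
Hypothesis coreN : core NN o.

Definition reach (Y : pstruct) : Prop :=
  exists X W cs src rank, joining NN o fr tau X W cs src rank /\ iso X Y.

(** The redex is pulled back to the representative [X], where [jn_merge] and [jn_erase] apply.
    Pulling and steps inside boxes are impossible: [W] consists of ? nodes, so every ! node comes
    from the core, whose nodes are redex-free. *)
Lemma reach_deep R R' : reach R -> deep why_rule R R' -> reach R'.
Proof.
move=> [X [W [cs [src [rank [J /isoP[g iX]]]]]]] d.
have bang B aux p : Bang B aux p \in nodes R -> redex_free_node (Bang B aux p).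
  have [_ _ gn _] := iX; move=> /(nsiso_mem_r gn)[n nX h].
  apply: (niso_redex_free h); apply: (allP (core_free coreN)).
  move: nX; rewrite (perm_mem (jn_nodes J)) mem_cat => /orP[nW|//].
  by have [ps [c e]] := all_whyP (jn_why J) nW; rewrite e in h; inversion h.
case: d iX bang => {R R'} [R R' []|B B' aux p ns ds /deep_redex_free f] /=.
- move=> ps c qs d ns ds iX _; have [gi gt gn gc] := iX.
  have [n1 [n0 [p1 h1 k1]]] := nsiso_inv gn.
  have [n2 [n3 [p2 h2 k2]]] := nsiso_inv k1.
  have [ps0 [c0 [e1 q1 ec]]] := niso_why_inv h1.
  have [qs0 [d0 [e2 q2 ed]]] := niso_why_inv h2; subst n1 n2 c d.
  have pX : perm_eq (nodes X) [:: Why ps0 c0, Why qs0 d0 & n3].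
    by rewrite (perm_trans p1) // perm_cons.
  have aX := arcs_perm pX.
  have c0X : c0 \in arcs X.
    by rewrite aX mem_arcs_cons mem_cat mem_head orbT.
  have qX : {subset qs0 <= arcs X}.
    by move=> a aq; rewrite aX mem_arcs_cons mem_arcs_cons [X in _ || (X || _)]mem_cat aq orbT.
  have cq : c0 \in qs0.
    have : g c0 \in map g qs0 by rewrite -(perm_mem q2) mem_head.
    case/mapP=> x xq /gi e; rewrite e //; exact: qX.
  have [W' J'] := jn_merge coreN J pX cq.
  do 5 eexists; split; first exact: J'.
  apply/isoP; exists g; apply: (isog_sub iX) => //.
    move=> a; rewrite aX !mem_arcs_cons !mem_cat.
    case/orP=> [/orP[/orP[->|/mem_rem->]|->]|->]; rewrite ?orbT //.
  apply: nsiso_cons => //=; apply: iWhy; rewrite map_cat perm_cat //.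
  rewrite -(perm_cons (g c0)) (perm_trans q2) // -map_cons perm_map //.
  exact: perm_to_rem.
- move=> p c ns ds pc iX _; have [gi gt gn gc] := iX.
  have [n1 [n0 [p1 h1 k1]]] := nsiso_inv gn.
  have [ps0 [c0 [e1 q1 ec]]] := niso_why_inv h1; subst n1 c.
  have : perm_eq (map g ps0) [:: p] by rewrite perm_sym.
  move/perm_small_eq => /(_ isT); case: ps0 q1 p1 h1 => [|p0 []] //= q1 p1 h1 [e].
  subst p; have pc0 : p0 != c0 by apply: contraNneq pc => ->.
  have aX := arcs_perm p1.
  have p0X : p0 \in arcs X by rewrite aX mem_arcs_cons mem_head.
  have c0X : c0 \in arcs X by rewrite aX mem_arcs_cons mem_cat mem_head orbT.
  have n0X a : a \in arcs (PS n0 (concl X)) -> a \in arcs X.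
    by rewrite aX mem_arcs_cons => ->; rewrite orbT.
  have [W' [cs' J']] := jn_erase coreN J p1 pc0.
  do 5 eexists; split; first exact: J'.
  have fg a : a \in arcs X ->
      (if g a == g c0 then g p0 else g a) = g (if a == c0 then p0 else a).
    move=> aXX; case: (eqVneq a c0) => [->|ne]; first by rewrite eqxx.
    by case: eqP => // /gi e; rewrite e // eqxx in ne.
  apply/isoP; exists g; apply: (isog_sub iX).
  + move=> a; rewrite mem_arcs => /orP[/hasP[n /mapP[m mn0 ->]]|/mapP[x xX ->]].
      have -> : narcs (map_node (fun e => if e == c0 then p0 else e) m) =
                map (fun e => if e == c0 then p0 else e) (narcs m).
        by rewrite /narcs map_cat; case: (m) => //= *; rewrite ?map_rcons.
      move=> /mapP[x xm ->]; case: ifP => // _; apply: n0X.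
      exact: (narcs_arcs (R := PS n0 (concl X))) xm.
    by case: ifP => // _; apply: n0X; exact: (concl_arcs (R := PS n0 (concl X))).
  + apply: nsiso_map k1 _ => n nn0 a an; rewrite fg //.
    by apply: n0X; exact: (narcs_arcs (R := PS n0 (concl X))) an.
  + rewrite /= in gc; rewrite /= gc -!map_comp; apply/eq_in_map=> a aXc; rewrite /= fg //.
    exact: concl_arcs.
- move=> qs c bns l1 l2 aux1 a aux2 p ns ds new s1 s2 _ _ _ _ bang.
  have /negP[] := @pull_redex_free qs c bns l1 l2 aux1 a aux2 p s1 s2.
  by apply: bang; exact: mem_head.
- move=> _ /(_ B aux p (mem_head _ _)).
  by rewrite /= (negbTE f).
Qed.

Lemma reach_iso R R' : reach R -> iso R R' -> reach R'.
Proof.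
move=> [X [W [cs [src [rank [J i]]]]]] j; exists X, W, cs, src, rank; split=> //.
exact: iso_trans j.
Qed.

Definition settled (W : seq node) : bool :=
  all redex_free_node W && ~~ has (mem (why_premss W)) (why_concls W).

(** [rank] excludes the two configurations to which the rules do not apply: a unary ? node whose
    premise is its own conclusion, and a ? node to be merged with itself. *)
Lemma normal_settled X W cs src rank :
  joining NN o fr tau X W cs src rank -> why_normal X -> settled W.
Proof.
move=> J nX; have wX := jn_wf_node J; apply/andP; split.
  apply/allP=> n nW; have [ps [c e]] := all_whyP (jn_why J) nW; subst n.
  apply/negP=> /eqP/= s1; case: ps s1 nW => [|p []] // _ cW.
  have : Why [:: p] c \in nodes X by rewrite (perm_mem (jn_nodes J)) mem_cat cW.
  move/perm_to_rem=> pX; apply: (why_normal_front wX pX _ _ nX); first apply: WhyEr.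
    apply/eqP=> e; have := jn_rank J cW (mem_head _ _).
    by rewrite e ltnn.
  apply/allP=> n /mapP[m /mem_rem mX ->]; have := allP wX _ mX.
  by case: (m) => //= *; rewrite size_map.
apply/negP=> /hasP[c /why_conclsP[ps cW] /why_premssP[qs [d [dW cq]]]].
have pq := perm_to_rem cq.
have ne : Why qs d != Why ps c.
  apply/eqP=> -[e1 e2]; subst; have := jn_rank J cW cq.
  by rewrite ltnn.
have cX : Why ps c \in nodes X by rewrite (perm_mem (jn_nodes J)) mem_cat cW.
have dX : Why qs d \in nodes X by rewrite (perm_mem (jn_nodes J)) mem_cat dW.
have p1 := perm_to_rem cX.
have dX1 : Why qs d \in rem (Why ps c) (nodes X).
  by move: dX; rewrite (perm_mem p1) in_cons (negbTE ne).
have p2 := perm_to_rem dX1.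
set ns := rem _ (rem _ _) in p2.
have wns : all well_formed_node ns.
  by apply/allP=> n /mem_rem/mem_rem; exact: (allP wX).
have i : iso X (PS (Why ps c :: Why (c :: rem c qs) d :: ns) (concl X)).
  apply/isoP; exists id; apply: isog_id => //=.
  apply: (@nsiso_perm _ [:: Why ps c, Why qs d & ns] _ _ _ _ (perm_refl _)).
    by rewrite (perm_trans p1) // perm_cons.
  apply: nsiso_cons; first by apply: niso_refl.
  apply: nsiso_cons; last exact: nsiso_refl.
  by apply: (@iWhy id); rewrite map_id perm_sym.
apply: (nX (PS (Why (ps ++ rem c qs) d :: ns) (concl X))).
exists (PS (Why ps c :: Why (c :: rem c qs) d :: ns) (concl X)).
exists (PS (Why (ps ++ rem c qs) d :: ns) (concl X)); split=> //.
  by apply: deep_root; exact: WhyFl.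
by apply/isoP; exists id; apply: isog_refl.
Qed.
End Joining.

(** * Uniqueness of settled nets *)

Section Settled.
Variables (NN : seq node) (o : garc) (fr : seq (seq garc)) (tau : seq formula).
Hypothesis coreN : core NN o.

Section Facts.
Variables (X : pstruct) (W : seq node) (cs : seq garc) (src : garc -> seq garc).
Variable rank : garc -> nat.
Hypothesis J : joining NN o fr tau X W cs src rank.
Hypothesis S : settled W.

Lemma jn_size : size cs = size fr.
Proof. by have := jn_fr J; rewrite all2E => /andP[/eqP]. Qed.

Lemma jn_nth i : i < size cs -> perm_eq (src (nth dflt_arc cs i)) (nth [::] fr i).
Proof.
have := jn_fr J; elim: (cs) (fr) i => [|x s IH] [|y t] // [|i] /andP[h k] //=.
by rewrite ltnS; exact: IH.
Qed.

Lemma jn_cs_heads a : a \in cs -> a \notin prems_of W ++ prems_of NN.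
Proof.
move=> acs; have := jn_uniq_heads J; rewrite catA cat_uniq => /and3P[_ /hasPn h _].
by apply: h; rewrite mem_rcons in_cons acs orbT.
Qed.

Lemma jn_uniq_cs : uniq (rcons cs o).
Proof. by have := jn_uniq_heads J; rewrite catA cat_uniq => /and3P[_ _]. Qed.

(** Such an arc does not start at a ? node of [W], by settledness, nor at a ? node of the core,
    whose conclusion is already a premise in the core. *)
Lemma settled_leaf p : p \in prems_of W -> src p = [:: p] /\ p \in concls_of NN.
Proof.
move=> pW; have : p \in concls_of W ++ concls_of NN.
  by rewrite (jn_balance J) mem_cat pW.
have pnW : p \notin concls_of W.
  rewrite all_why_concls ?(jn_why J) //; apply/negP=> pc.
  case/andP: S => _ /hasPn/(_ p pc) /=.
  by rewrite -all_why_prems ?pW ?(jn_why J).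
rewrite mem_cat (negbTE pnW) /= => pN; split=> //; apply: (jn_leaf J) => //.
by apply/negP=> /(jn_why_coreP coreN J)[]; rewrite pW.
Qed.

Lemma settled_why ps c : Why ps c \in W -> perm_eq (src c) ps.
Proof.
move=> cW; have sub : {subset ps <= prems_of W} by exact: (mem_prems_of cW).
apply: perm_trans (jn_src J cW) _.
suff -> : flatten (map src ps) = ps by [].
elim: ps sub {cW} => //= p ps IH sub.
have [-> _] := settled_leaf (sub p (mem_head _ _)).
by rewrite IH // => a aps; apply: sub; rewrite in_cons aps orbT.
Qed.

(** No settled ? node is unary. Hence a conclusion has exactly one source when it leaves the core
    directly, and any other number, possibly zero, when it leaves a ? node. *)
Lemma settled_case i : i < size cs ->
  if size (nth [::] fr i) == 1
  then nth dflt_arc cs i \in concls_of NN /\ nth [::] fr i = [:: nth dflt_arc cs i]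
  else nth dflt_arc cs i \notin concls_of NN /\ nth dflt_arc cs i \in why_concls W.
Proof.
move=> lt; set c := nth dflt_arc cs i; have ccs : c \in cs by exact: mem_nth.
have pf := jn_nth lt; rewrite -/c in pf; rewrite -(perm_size pf).
have: c \in concls_of W ++ concls_of NN.
  by rewrite (jn_balance J) !mem_cat mem_rcons in_cons ccs !orbT.
rewrite mem_cat; case: (boolP (c \in concls_of NN)) => cN.
  have e : src c = [:: c].
    apply: (jn_leaf J) => //; apply/negP=> /(core_why coreN) cP.
    by have := jn_cs_heads ccs; rewrite mem_cat cP orbT.
  rewrite e in pf *; rewrite eqxx => _; split=> //.
  by move: pf; rewrite perm_sym => /perm_small_eq->.
rewrite orbF all_why_concls ?(jn_why J) // => cW.
have [ps h] := why_conclsP _ _ cW; rewrite (perm_size (settled_why h)).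
by case/andP: S => /allP/(_ _ h) /= /negbTE-> _.
Qed.

(** Premises of [W] and premises of the core all start in the core, so a ? node of [W] has nowhere
    else to end. *)
Lemma why_concls_cs c : c \in why_concls W -> c \in cs.
Proof.
move=> cW; have cW' : c \in concls_of W by rewrite all_why_concls ?(jn_why J).
have: c \in prems_of W ++ prems_of NN ++ rcons cs o.
  by rewrite -(jn_balance J) mem_cat cW'.
rewrite !mem_cat mem_rcons in_cons => /or3P[h|h|/predU1P[e|//]].
- by have [_ h'] := settled_leaf h; have := jn_tailsW J cW'; rewrite h'.
- by have := jn_premsN coreN J h; rewrite cW'.
- by have := jn_o coreN J; rewrite -e cW'.
Qed.

(** A canonical form of [W], computed from the sources [fr] and the names of the conclusions; two
    settled nets are compared through it. *)
Definition why_list (g : garc -> garc) (cs : seq garc) : seq node :=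
  [seq Why (nth [::] fr i) (g (nth dflt_arc cs i))
  | i <- iota 0 (size fr) & size (nth [::] fr i) != 1].

Lemma settled_nsiso g : {in prems_of W, g =1 id} -> nsiso g W (why_list g cs).
Proof.
move=> gid; set h := fun c => Why (nth [::] fr (index c cs)) (g c).
exists (map h (why_concls W)).
  suff gen s : all is_why s -> {subset s <= W} ->
      List.Forall2 (niso g) s (map h (why_concls s)) by apply: gen; rewrite ?(jn_why J).
  elim: s => [|n s IH] /=; first by constructor.
  case: n => // ps c /= ws sub; have cW : Why ps c \in W by apply: sub; exact: mem_head.
  have ccs : c \in cs by apply: why_concls_cs; apply/why_conclsP; exists ps.
  constructor; last by apply: IH => // n ns; apply: sub; rewrite in_cons ns orbT.
  apply: iWhy; rewrite map_id_in; last first.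
    by move=> p pp; apply: gid; exact: (mem_prems_of cW).
  have := jn_nth (i := index c cs); rewrite index_mem nth_index // => /(_ ccs) pf.
  rewrite perm_sym; apply: perm_trans pf; rewrite perm_sym; exact: settled_why.
set I := [seq i <- iota 0 (size fr) | size (nth [::] fr i) != 1].
have lI i : i \in I -> i < size cs.
  by rewrite mem_filter mem_iota jn_size => /and3P[_ _].
have ucs : uniq cs by have := jn_uniq_cs; rewrite rcons_uniq => /andP[].
have -> : why_list g cs = map h (map (nth dflt_arc cs) I).
  by rewrite -map_comp; apply/eq_in_map=> i /lI lt; rewrite /h /= index_uniq.
apply: perm_map; apply: uniq_perm.
- rewrite -all_why_concls ?(jn_why J) //.
  by have := jn_uniq_tails J; rewrite cat_uniq => /andP[].
- rewrite map_inj_in_uniq ?filter_uniq ?iota_uniq // => i j /lI li /lI lj /eqP.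
  by rewrite nth_uniq // => /eqP.
- move=> c; apply/idP/mapP=> [cW|[i iI ->]].
    have ccs := why_concls_cs cW; exists (index c cs); last by rewrite nth_index.
    have li : index c cs < size cs by rewrite index_mem.
    rewrite mem_filter mem_iota -jn_size li andbT /=.
    have := settled_case li; rewrite nth_index //; case: ifP => // _ [cN _].
    rewrite -all_why_concls ?(jn_why J) // in cW.
    by have := jn_tailsW J cW; rewrite cN.
  have := settled_case (lI i iI); move: iI; rewrite mem_filter => /andP[/negbTE-> _].
  by case.
Qed.
End Facts.

Lemma joining_unique X W cs src rank X' W' cs' src' rank' :
  joining NN o fr tau X W cs src rank -> settled W ->
  joining NN o fr tau X' W' cs' src' rank' -> settled W' -> iso X X'.
Proof.
move=> J S J' S'; have sz := jn_size J; have sz' := jn_size J'.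
have ess : size cs = size cs' by rewrite sz sz'.
have ucs : uniq cs by have := jn_uniq_cs J; rewrite rcons_uniq => /andP[].
have ucs' : uniq cs' by have := jn_uniq_cs J'; rewrite rcons_uniq => /andP[].
(* Conclusions are matched by position and all other arcs are kept. This agrees with the identity on
   the core: a conclusion leaving the core is its own only source, hence bears the same name in both
   nets. *)
pose g a := if a \in cs then nth dflt_arc cs' (index a cs) else a.
have gW : {in prems_of W, g =1 id}.
  move=> p pW; rewrite /g; case: ifP => // /(jn_cs_heads J).
  by rewrite mem_cat pW.
have gN : {in concls_of NN, g =1 id}.
  move=> a aN; rewrite /g; case: ifP => // acs.
  have li : index a cs < size cs by rewrite index_mem.
  have := settled_case J S li; rewrite nth_index //.
  have := settled_case J' S'; rewrite -ess => /(_ _ li).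
  case: ifP => _; last by move=> _ [/negP[]].
  by move=> [_ e'] [_ e]; rewrite e' in e; case: e.
have gcs : map g cs = cs'.
  apply: (@eq_from_nth _ dflt_arc); rewrite size_map // => i lt.
  by rewrite (nth_map dflt_arc) // /g mem_nth // index_uniq.
have go : g o = o by apply: gN; apply: (core_closed coreN); exact: mem_head.
have gK : nsiso id W' (why_list id cs') by exact: (settled_nsiso J' S').
have gKK : nsiso g W (why_list id cs').
  have -> : why_list id cs' = why_list g cs.
    apply/eq_in_map=> i; rewrite mem_filter mem_iota -sz => /and3P[_ _ lt].
    by rewrite -gcs (nth_map dflt_arc).
  exact: (settled_nsiso J S).
have wW' : {subset W' <= nodes X'}.
  by move=> n nW; rewrite (perm_mem (jn_nodes J')) mem_cat nW.
have nW : nsiso g W W'.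
  have sy : nsiso id (why_list id cs') W'.
    by apply: nsiso_sym gK => n n' _ h; apply: niso_sym h _.
  apply: nsiso_trans gKK sy => n n' n'' _ h h'.
  by have := niso_trans h h'.
have wN : all well_formed_node NN.
  by have := jn_wf_node J; rewrite (perm_all _ (jn_nodes J)) all_cat => /andP[].
have nN : nsiso g NN NN.
  apply: nsiso_sub (nsiso_refl wN) => n n' nNN; apply: niso_ext => a.
  rewrite mem_cat => /orP[an|an]; rewrite gN //.
    by apply: (core_closed coreN); rewrite in_cons (mem_prems_of nNN) ?orbT.
  exact: (mem_concls_of nNN).
have aX a : a \in arcs X -> a \in cs \/ a \in concls_of NN.
  have := jn_wf J; rewrite well_formedE => /and3P[_ /perm_mem e _].
  rewrite /arcs mem_cat -e orbb (perm_mem (jn_tails J)) mem_cat.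
  case/orP=> [aW|]; last by right.
  by left; apply: (why_concls_cs J S); rewrite -all_why_concls ?(jn_why J).
apply/isoP; exists g; apply: isog_of_nodes.
- have inj a b : a \in cs -> b \notin cs -> b \in concls_of NN -> g a = g b -> a = b.
    move=> acs bcs bN; rewrite (gN b) // => e.
    have li : index a cs < size cs by rewrite index_mem.
    have e' : nth dflt_arc cs' (index a cs) = b by rewrite -e /g acs.
    have := settled_case J S li; rewrite nth_index //.
    have := settled_case J' S'; rewrite -ess => /(_ _ li); rewrite e'.
    case: ifP => _; last by move=> [/negP[]].
    by move=> [_ e1] [_ e2]; rewrite e1 in e2; case: e2.
  move=> a b /aX aX1 /aX bX1 e.
  case: (boolP (a \in cs)) (boolP (b \in cs)) => acs [] bcs.
  + move: e; rewrite /g acs bcs => /eqP.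
    rewrite nth_uniq -?ess ?index_mem // => /eqP e.
    by rewrite -(nth_index dflt_arc acs) e nth_index.
  + by apply: inj => //; case: bX1 => // bb; rewrite bb in bcs.
  + by apply/esym/inj => //; case: aX1 => // aa; rewrite aa in acs.
  + by move: e; rewrite /g (negbTE acs) (negbTE bcs).
- move=> a aXX; rewrite /g; case: ifP => // acs.
  have li : index a cs < size cs by rewrite index_mem.
  rewrite -[LHS](nth_map _ dflt_arc.2) -?ess // (jn_tau J') -(jn_tau J).
  by rewrite (nth_map dflt_arc) // nth_index.
- apply: nsiso_perm (jn_nodes J) _ (nsiso_cat nW nN).
  by rewrite perm_sym (jn_nodes J').
- by rewrite (jn_concl J) (jn_concl J') map_rcons gcs go.
Qed.

Lemma reach_why_nf Y : reach NN o fr tau Y ->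
  exists X W cs src rank, [/\ joining NN o fr tau X W cs src rank, settled W &
                             iso X (why_nf Y)].
Proof.
move=> rY; have [X0 [W0 [cs0 [src0 [rank0 [_ i0]]]]]] := rY.
have [s n] := why_nfP (iso_refl_r i0).
have r : reach NN o fr tau (why_nf Y).
  apply: steps_inv s rY => S S'; first exact: reach_iso.
  exact: reach_deep.
have [X [W [cs [src [rank [J i]]]]]] := r.
exists X, W, cs, src, rank; split=> //; apply: (normal_settled J) => R' h.
apply: (n R'); apply: step_iso_l h; exact: iso_sym.
Qed.

Lemma joining_reach X W cs src rank :
  joining NN o fr tau X W cs src rank -> reach NN o fr tau X.
Proof. by move=> J; exists X, W, cs, src, rank; split=> //; exact: iso_refl (jn_wf J). Qed.

Lemma reach_why_nf_iso Y Y' : reach NN o fr tau Y -> reach NN o fr tau Y' ->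
  iso (why_nf Y) (why_nf Y').
Proof.
move=> /reach_why_nf[X [W [cs [src [rank [J S i]]]]]].
move=> /reach_why_nf[X' [W' [cs' [src' [rank' [J' S' i']]]]]].
apply: iso_trans (iso_sym i) _; apply: iso_trans i'.
exact: joining_unique J S J' S'.
Qed.

Lemma reach_good G A Y : reach NN o fr tau Y -> tau = map ctx_type G ->
  o.2 = Out A -> good G A (why_nf Y).
Proof.
move=> /reach_why_nf[X [W [cs [src [rank [J S i]]]]]] et eo.
apply: good_iso i; have p := jn_nodes J; split.
- exact: jn_wf J.
- rewrite redex_freeE (perm_all _ p) all_cat (core_free coreN) andbT.
  case/andP: S => -> S /=; apply/negP=> /hasP[c].
  rewrite (perm_mem (perm_flatten (perm_map _ p))) => cC.
  rewrite /= (perm_mem (perm_flatten (perm_map _ p))) => cP; move: cC cP.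
  rewrite -!/(why_concls _) -!/(why_premss _) why_concls_cat why_premss_cat !mem_cat.
  case/orP=> [cW|cN] /orP[dW|dN].
  + by case/hasP: S; exists c.
  + have := jn_premsN coreN J (why_premss_sub dN).
    by rewrite all_why_concls ?cW ?(jn_why J).
  + by have [] := jn_why_coreP coreN J cN; rewrite why_premss_sub.
  + by case/hasP: (core_flat coreN); exists c.
- by rewrite (perm_all _ p) all_cat (jn_typed J) (core_typed coreN).
- by rewrite (jn_concl J) map_rcons (jn_tau J) et eo.
Qed.
End Settled.

(** Locates the nodes of an ax-step: not being ? nodes, they lie in the part [nb] that ?-reduction
    leaves alone. *)
Lemma perm_split_why (N ns nb W : seq node) : all (predC is_why) N -> all is_why W ->
  perm_eq (N ++ ns) (nb ++ W) ->
  exists2 nb0, perm_eq nb (N ++ nb0) & perm_eq ns (nb0 ++ W).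
Proof.
move=> nN wW; elim: N nN nb => [|n N IH] /= nN nb h.
  by exists nb => //; exact: perm_refl.
case/andP: nN => nn nN; have nnb : n \in nb.
  have : n \in nb ++ W by rewrite -(perm_mem h) mem_head.
  by rewrite mem_cat => /orP[//|/(allP wW)]; rewrite (negbTE nn).
have p1 := perm_to_rem nnb.
have [|nb0 q1 q2] := IH nN (rem n nb).
  rewrite -(perm_cons n) (perm_trans h) // -cat_cons perm_cat2r; exact: p1.
by exists nb0 => //; rewrite (perm_trans p1) // perm_cons.
Qed.

Lemma perm_core NN NN' o : perm_eq NN NN' -> core NN o -> core NN' o.
Proof.
move=> p [c1 c2 c3 c4 c5]; have pc := perm_concls_of p; have pp := perm_prems_of p.
have pwc := perm_flatten (perm_map why_concl p).
have pwp := perm_flatten (perm_map why_prems p).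
split; rewrite -?(perm_all _ p) //.
- apply: contra c2 => /hasP[c]; rewrite /= -(perm_mem pwc) -(perm_mem pwp) => h k.
  by apply/hasP; exists c.
- move=> a aP; rewrite -(perm_mem pc); apply: c4; move: aP.
  by rewrite !in_cons (perm_mem pp).
- by move=> a; rewrite -(perm_mem pwc) -(perm_mem pp); exact: c5.
Qed.

(** The step is confined to the core; [W], [cs], [src] and [rank] are the same before and after it.
    Applied to a normal form, this replaces the commutation of individual steps. *)
Lemma joining_ax_der NN o fr tau X W cs src rank N N' C :
  core NN o -> joining NN o fr tau X W cs src rank -> perm_eq NN (N ++ C) ->
  ax_der N N' ->
  core (N' ++ C) o /\
  joining (N' ++ C) o fr tau (PS (N' ++ C ++ W) (concl X)) W cs src rank.
Proof.
move=> coreN J pN h; have [s [ps ph]] := ax_der_arcs h.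
have [n n'] := ax_der_not_why h.
have pX : perm_eq (nodes X) (N ++ C ++ W).
  rewrite (perm_trans (jn_nodes J)) // perm_catC catA perm_cat2r //.
have wX' := ax_der_wf h (iso_wf (iso_front (jn_wf_node J) pX) (jn_wf J)).
have pNc : perm_eq (concls_of NN) (s ++ concls_of (N' ++ C)).
  rewrite (perm_trans (perm_concls_of pN)) // !concls_of_cat catA perm_cat2r; exact: ps.
have pNp : perm_eq (prems_of NN) (s ++ prems_of (N' ++ C)).
  rewrite (perm_trans (perm_prems_of pN)) // !prems_of_cat catA perm_cat2r; exact: ph.
have wcE : why_concls (N ++ C) = why_concls (N' ++ C).
  by rewrite !why_concls_cat (not_why_concls n) (not_why_concls n').
have wpE : why_premss (N ++ C) = why_premss (N' ++ C).
  by rewrite !why_premss_cat (not_why_premss n) (not_why_premss n').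
have [d1 d2 d3 d4 d5] := perm_core pN coreN.
(* Heads are unique, so an erased arc is neither a remaining premise nor [o]; the new core is
   therefore still closed. *)
have uh : uniq (s ++ prems_of (N' ++ C) ++ [:: o]).
  have p1 : perm_eq (prems_of NN ++ [:: o]) (s ++ prems_of (N' ++ C) ++ [:: o]).
    by rewrite catA perm_cat2r.
  rewrite -(perm_uniq p1); have := jn_uniq_heads J.
  rewrite cat_uniq => /and3P[_ _]; rewrite !cat_uniq rcons_uniq => /and3P[-> hs _].
  rewrite /= orbF andbT; apply/negP=> oP; move/hasPn: hs => /(_ o).
  by rewrite mem_rcons mem_head /= oP => /(_ isT).
have ut : uniq (s ++ concls_of (N' ++ C)).
  rewrite -(perm_uniq pNc); have := jn_uniq_tails J.
  by rewrite cat_uniq => /and3P[].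
split; [split|split].
- move: d1; rewrite !all_cat => /andP[fN ->]; rewrite andbT.
  have := @ax_der_redex_free _ _ h [::] [::]; rewrite !redex_free_cat // fN.
  by rewrite !redex_freeE /= !andbT; apply.
- by rewrite -wcE -wpE.
- move: d3; rewrite !all_cat => /andP[_ ->]; rewrite andbT.
  by apply/allP=> -[] // qs d /(allP n').
- move=> a aP; have aN : a \in concls_of NN.
    apply: (core_closed coreN); move: aP; rewrite !in_cons => /predU1P[->|aP].
      by rewrite eqxx.
    by rewrite (perm_mem pNp) mem_cat aP !orbT.
  move: aN; rewrite (perm_mem pNc) mem_cat => /orP[as_|//].
  move: uh; rewrite cat_uniq => /and3P[_ /hasPn/(_ a)]; rewrite /= as_.
  by rewrite mem_cat inE orbC -in_cons aP => /(_ isT).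
- rewrite -wcE => a aW; have := d5 a aW.
  rewrite -(perm_mem (perm_prems_of pN)) (perm_mem pNp) mem_cat => /orP[as_|//].
  have aC : a \in concls_of (N' ++ C) by apply: why_concls_sub; rewrite -wcE.
  move: ut; rewrite cat_uniq => /and3P[_ /hasPn/(_ a aC)] /=.
  by rewrite as_.
- by rewrite /= catA perm_catC.
- exact: jn_concl J.
- exact: jn_why J.
- exact: jn_typed J.
- exact: wX'.
- exact: jn_tau J.
- move=> a aN an; apply: (jn_leaf J); first by rewrite (perm_mem pNc) mem_cat aN orbT.
  by rewrite (perm_mem (perm_flatten (perm_map _ pN))) -/(why_concls _) wcE.
- exact: jn_src J.
- exact: jn_rank J.
- exact: jn_fr J.
Qed.

(** Performing the step in a settled representative of [why_nf X] gives a settled net over the new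
    core. The normal form of [Y] has one too, with the same [fr] and [tau], and [joining_unique]
    identifies the two. *)
Lemma why_nf_ax_der NN o fr tau X W cs src rank N N' ns Y : core NN o ->
  joining NN o fr tau X W cs src rank -> ax_der N N' ->
  perm_eq (nodes X) (N ++ ns) -> iso (PS (N' ++ ns) (concl X)) Y ->
  ax_ders (why_nf X) (why_nf Y).
Proof.
move=> coreN J h pX iY; have [n n'] := ax_der_not_why h.
have q : perm_eq (N ++ ns) (NN ++ W).
  rewrite perm_sym in pX; rewrite (perm_trans pX) // (perm_trans (jn_nodes J)) //.
  by rewrite perm_catC.
have [C pN pn] := perm_split_why n (jn_why J) q.
have [coreN' J'] := joining_ax_der coreN J pN h.
have rY : reach (N' ++ C) o fr tau Y.
  apply: reach_iso (joining_reach J') _; apply: iso_trans iY.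
  apply: (iso_front (jn_wf_node J')) => /=.
  by rewrite perm_cat2l perm_sym.
have [Xf [Wf [csf [srcf [rankf [Jf Sf i]]]]]] := reach_why_nf coreN (joining_reach J).
have [Xf' [Wf' [csf' [srcf' [rankf' [Jf' Sf' i']]]]]] := reach_why_nf coreN' rY.
have [_ Jg] := joining_ax_der coreN Jf pN h.
apply: ax_ders_iso_l (iso_sym i) _.
have pXf : perm_eq (nodes Xf) (N ++ C ++ Wf).
  by rewrite (perm_trans (jn_nodes Jf)) // perm_catC catA perm_cat2r.
apply: (ax_ders_step (iso_front (jn_wf_node Jf) pXf) h); apply: ax_ders_iso.
apply: iso_trans i'; exact: (joining_unique coreN' Jg Sf Jf' Sf').
Qed.

(** * ?-normal forms of boxes *)

(* Counting at the syntactic type [garc], so that [lia] identifies the counts. *)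
Lemma perm_count (s t : seq garc) :
  perm_eq s t <-> forall A : pred garc, @count garc A s = @count garc A t.
Proof. by split=> [/permP//|h]; apply/permP=> A; exact: h. Qed.

Lemma fresh_arcs (s : seq garc) (ts : seq formula) : exists new : seq garc,
  [/\ uniq new, {in new, forall a, a \notin s} & map snd new = ts].
Proof.
(* Identifiers longer than all those of [s] are fresh. *)
pose M := (sumn [seq size a.1 | a <- s]).+1.
have lM a : a \in s -> size a.1 < M.
  rewrite /M ltnS; elim: s {M} => //= b s IH; rewrite in_cons => /predU1P[->|/IH].
    exact: leq_addr.
  by move/leq_trans; apply; exact: leq_addl.
exists [seq (nseq (M + i) 0, nth (Out (OAtom 0)) ts i) | i <- iota 0 (size ts)].
split.
- rewrite map_inj_uniq ?iota_uniq // => i j [e _].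
  by have := congr1 size e; rewrite !size_nseq => /addnI.
- move=> a /mapP[i _ ->]; apply/negP=> /lM /=.
  by rewrite size_nseq ltnNge leq_addr.
- rewrite -map_comp; apply: (@eq_from_nth _ (Out (OAtom 0))).
    by rewrite size_map size_iota.
  move=> i; rewrite size_map size_iota => lt.
  by rewrite (nth_map 0) ?size_iota //= nth_iota.
Qed.

Lemma uniq_map_inj (S T : eqType) (f : S -> T) s :
  uniq (map f s) -> {in s &, injective f}.
Proof.
elim: s => //= x s IH /andP[xs /IH i] y z; rewrite !in_cons.
case/predU1P=> [->|ys] /predU1P[->|zs] // e.
- by rewrite e map_f in xs.
- by rewrite -e map_f in xs.
- exact: i.
Qed.

Lemma zip_types (l l' : seq garc) : map snd l' = map snd l ->
  {in zip l l', forall x, x.2.2 = x.1.2}.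
Proof.
elim: l l' => [|y s IH] [|y' s'] //= [e1 /IH{}IH] x.
by rewrite in_cons => /predU1P[->|/IH].
Qed.

Lemma zip_unzip12 (S T : Type) (s : seq (S * T)) : zip (unzip1 s) (unzip2 s) = s.
Proof. by elim: s => //= -[x y] s ->. Qed.

Lemma size_unzip12 (S T : Type) (s : seq (S * T)) : size (unzip1 s) = size (unzip2 s).
Proof. by rewrite !size_map. Qed.

(* [(c, a, oz)] stands for a conclusion [c] of the box and the corresponding
   auxiliary port or ?-conclusion [a]; [oz] is [Some z] once the ? node above [c]
   has been pulled out, [z] listing the pairs of its old and new premises. *)
Definition port : Type := (garc * garc * option (seq (garc * garc)))%type.
Definition pt_in (t : port) : garc := t.1.1.
Definition pt_out (t : port) : garc := t.1.2.
Definition pt_pairs (t : port) := if t.2 is Some z then z else [:: t.1].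
Definition pt_arcs (t : port) := pt_out t :: if t.2 is Some z then unzip2 z else [::].
Definition pt_why_in (t : port) :=
  if t.2 is Some z then [:: Why (unzip1 z) (pt_in t)] else [::].
Definition pt_why_out (t : port) :=
  if t.2 is Some z then [:: Why (unzip2 z) (pt_out t)] else [::].
Definition pairs ts := flatten (map pt_pairs ts).
Definition whys_in ts := flatten (map pt_why_in ts).
Definition whys_out ts := flatten (map pt_why_out ts).
Definition port_arcs ts := flatten (map pt_arcs ts).

(** An intermediate state of the reduction of a promotion: the ? nodes outside the box are exactly
    those recorded in [ts]. *)
Definition pulled (nb : seq node) (ts : seq port) (out p : garc) : pstruct :=
  PS (Bang (PS nb (rcons (unzip1 (pairs ts)) out)) (unzip2 (pairs ts)) p
        :: whys_out ts)
     (rcons (map pt_out ts) p).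

Lemma pairs_cons t ts : pairs (t :: ts) = pt_pairs t ++ pairs ts.
Proof. by []. Qed.

Lemma pairs_cat ts ts' : pairs (ts ++ ts') = pairs ts ++ pairs ts'.
Proof. by rewrite /pairs map_cat flatten_cat. Qed.

Lemma whys_in_cons t ts : whys_in (t :: ts) = pt_why_in t ++ whys_in ts.
Proof. by []. Qed.

Lemma whys_out_cons t ts : whys_out (t :: ts) = pt_why_out t ++ whys_out ts.
Proof. by []. Qed.

Lemma whys_out_cat ts ts' : whys_out (ts ++ ts') = whys_out ts ++ whys_out ts'.
Proof. by rewrite /whys_out map_cat flatten_cat. Qed.

Lemma port_arcs_cons t ts : port_arcs (t :: ts) = pt_arcs t ++ port_arcs ts.
Proof. by []. Qed.

Lemma port_arcs_cat ts ts' : port_arcs (ts ++ ts') = port_arcs ts ++ port_arcs ts'.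
Proof. by rewrite /port_arcs map_cat flatten_cat. Qed.

Lemma whys_in_why ts : all is_why (whys_in ts).
Proof. by elim: ts => // -[x [z|]] ts IH. Qed.

Lemma whys_out_why ts : all is_why (whys_out ts).
Proof. by elim: ts => // -[x [z|]] ts IH. Qed.

Lemma whys_inP ts n : reflect (exists2 t, t \in ts & n \in pt_why_in t) (n \in whys_in ts).
Proof. exact: flatten_mapP. Qed.

Lemma whys_outP ts n :
  reflect (exists2 t, t \in ts & n \in pt_why_out t) (n \in whys_out ts).
Proof. exact: flatten_mapP. Qed.

(** [R] is the box before any pulling. Its nodes are the ones still inside, [nb], together with the
    pulled ? nodes under their old premises and conclusions. *)
Record pulling (R : pstruct) (out p : garc) (nb : seq node) (ts : seq port) : Prop :=
  Pulling {
    pl_nodes : perm_eq (nodes R) (nb ++ whys_in ts);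
    pl_concl : concl R = rcons (map pt_in ts) out;
    pl_uniq : uniq (rcons (port_arcs ts) p);
    pl_out : {in ts, forall t, (pt_out t).2 = (pt_in t).2};
    pl_pairs : {in pairs ts, forall x, x.2.2 = x.1.2} }.

Section Pull.
Variables (R : pstruct) (out p : garc).
Hypotheses (wR : well_formed R) (fR : redex_free R) (tR : all why_typed (nodes R)).

Lemma nodes_why_fun ps ps' c :
  Why ps c \in nodes R -> Why ps' c \in nodes R -> ps = ps'.
Proof.
move=> h h'; move: wR; rewrite well_formedE => /and3P[u _ _].
have p1 := perm_to_rem h; apply/eqP; apply: contraTT u => ne.
have h1 : Why ps' c \in rem (Why ps c) (nodes R).
  by move: h'; rewrite (perm_mem p1) in_cons => /predU1P[[e]|//]; rewrite e eqxx in ne.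
have p2 := perm_concls_of p1; rewrite tailsE (perm_uniq p2) /concls_of /=.
rewrite negb_and negbK; apply/orP; left.
apply: (mem_concls_of h1); exact: mem_head.
Qed.

Lemma redex_free_disj c : c \in why_concls (nodes R) -> c \notin why_premss (nodes R).
Proof. by move: fR; rewrite redex_freeE => /andP[_ /hasPn h] /h. Qed.

Lemma redex_free_size ps c : Why ps c \in nodes R -> size ps != 1.
Proof. by move: fR; rewrite redex_freeE => /andP[/allP h _] /h. Qed.

Section Facts.
Variables (nb : seq node) (ts : seq port).
Hypothesis P : pulling R out p nb ts.
Let E := pulled nb ts out p.

Lemma nb_sub : {subset nb <= nodes R}.
Proof. by move=> n h; rewrite (perm_mem (pl_nodes P)) mem_cat h. Qed.

Lemma whys_in_sub : {subset whys_in ts <= nodes R}.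
Proof. by move=> n h; rewrite (perm_mem (pl_nodes P)) mem_cat h orbT. Qed.

Lemma why_pull_in c a z : (c, a, Some z) \in ts -> Why (unzip1 z) c \in nodes R.
Proof.
by move=> h; apply: whys_in_sub; apply/whys_inP; exists (c, a, Some z);
  rewrite ?mem_head.
Qed.

Lemma why_outP ps c : Why ps c \in whys_out ts ->
  exists d z, [/\ (d, c, Some z) \in ts, ps = unzip2 z & Why (unzip1 z) d \in nodes R].
Proof.
case/whys_outP=> -[[d a] [z|]] tt //; rewrite inE => /eqP[-> ->].
by exists d, z; split=> //; exact: why_pull_in tt.
Qed.

Lemma pt_in_inj : {in ts &, injective pt_in}.
Proof.
apply: uniq_map_inj; have := wf_uniq_heads wR; rewrite /heads (pl_concl P).
by rewrite cat_uniq rcons_uniq => /and3P[_ _ /andP[]].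
Qed.

Lemma size_pairs : size (unzip1 (pairs ts)) = size (unzip2 (pairs ts)).
Proof. exact: size_unzip12. Qed.

Lemma redex_free_box cs : redex_free (PS nb cs).
Proof.
rewrite redex_freeE; apply/andP; split.
  apply/allP=> n /nb_sub; apply: allP; by move: fR; rewrite redex_freeE => /andP[].
apply/negP=> /hasP[c /why_conclsP[ps h]] /why_premssP[qs [d [k cq]]].
have : c \in why_concls (nodes R) by apply/why_conclsP; exists ps; exact: nb_sub.
move/redex_free_disj/negP; apply; apply/why_premssP; exists qs, d; split=> //.
exact: nb_sub.
Qed.

(** Tails and heads are balanced port by port. The three counting lemmas sum up to the
    well-formedness of a state and of its box. *)
Lemma count_out A : count A (unzip2 (pairs ts)) + count A (concls_of (whys_out ts)) =
  count A (port_arcs ts).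
Proof.
elim: (ts) => // t s IH.
rewrite pairs_cons whys_out_cons port_arcs_cons concls_of_cat /unzip2 map_cat !count_cat.
have : count A (unzip2 (pt_pairs t)) + count A (concls_of (pt_why_out t)) =
       count A (pt_arcs t).
  by case: t => [[c a] [z|]]; rewrite /pt_why_out /pt_pairs /pt_arcs /pt_out /concls_of /=; lia.
by move: IH; rewrite /unzip2; lia.
Qed.

Lemma count_out_heads A : count A (prems_of (whys_out ts)) + count A (map pt_out ts) =
  count A (port_arcs ts).
Proof.
elim: (ts) => // t s IH; rewrite whys_out_cons port_arcs_cons prems_of_cat !count_cat.
have : count A (prems_of (pt_why_out t)) + A (pt_out t) = count A (pt_arcs t).
  by case: t => [[c a] [z|]]; rewrite /pt_why_out /pt_arcs /pt_out /prems_of /= ?cats0; lia.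
by rewrite /=; lia.
Qed.

Lemma count_in A : count A (unzip1 (pairs ts)) + count A (concls_of (whys_in ts)) =
  count A (prems_of (whys_in ts)) + count A (map pt_in ts).
Proof.
elim: (ts) => // t s IH.
rewrite pairs_cons whys_in_cons concls_of_cat prems_of_cat /unzip1 map_cat !count_cat.
have : count A (unzip1 (pt_pairs t)) + count A (concls_of (pt_why_in t)) =
       count A (prems_of (pt_why_in t)) + A (pt_in t).
  by case: t => [[c a] [z|]]; 
    rewrite /pt_why_in /pt_pairs /pt_in /concls_of /prems_of /= ?cats0; lia.
by move: IH; rewrite /unzip1 /=; lia.
Qed.

Lemma pulled_wf_box : well_formed (PS nb (rcons (unzip1 (pairs ts)) out)).
Proof.
move: (wR); rewrite well_formedE => /and3P[u b /allP w].
have pt : perm_eq (tails R) (concls_of nb ++ concls_of (whys_in ts)).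
  by rewrite -concls_of_cat; exact: perm_concls_of (pl_nodes P).
have ph : perm_eq (heads R)
    (prems_of nb ++ prems_of (whys_in ts) ++ rcons (map pt_in ts) out).
  rewrite catA -prems_of_cat /heads (pl_concl P) perm_cat2r.
  exact: perm_prems_of (pl_nodes P).
apply: wf_intro.
- by move: u; rewrite (perm_uniq pt) cat_uniq => /andP[].
- apply/perm_count=> A; move/perm_count: pt => /(_ A); move/perm_count: ph => /(_ A).
  move/perm_count: b => /(_ A).
  have := count_in A; rewrite -!cats1 !count_cat; lia.
- by apply/allP=> n /nb_sub/w.
Qed.

Lemma pulled_tails : perm_eq (tails E) (rcons (port_arcs ts) p).
Proof.
rewrite (_ : tails E = rcons (unzip2 (pairs ts)) p ++ concls_of (whys_out ts)) //.
by apply/perm_count=> A; have := count_out A; rewrite -!cats1 !count_cat /=; lia.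
Qed.

Lemma pulled_wf : well_formed E.
Proof.
apply: wf_intro.
- by rewrite -[concls_of _]/(tails E) (perm_uniq pulled_tails) (pl_uniq P).
- rewrite (perm_trans pulled_tails) //.
  rewrite (_ : prems_of _ = prems_of (whys_out ts)) //.
  by apply/perm_count=> A; have := count_out_heads A; rewrite -!cats1 !count_cat /=; lia.
- apply/andP; split.
    apply/andP; split; last exact: pulled_wf_box.
    by rewrite size_rcons size_pairs.
  by apply/allP=> n /(all_whyP (whys_out_why ts))[ps [c ->]].
Qed.

Lemma pulled_arcs : arcs E =i rcons (port_arcs ts) p.
Proof.
have := pulled_wf; rewrite well_formedE => /and3P[_ /perm_mem e _] a.
by rewrite /arcs mem_cat -e orbb (perm_mem pulled_tails).
Qed.

(** A pulled ? node concludes in a conclusion of the net, and heads are unique, so this arc is not a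
    premise of another node. *)
Lemma pulled_flat ps c qs d : Why ps c \in nodes E -> Why qs d \in nodes E ->
  c \notin qs.
Proof.
rewrite !in_cons => /predU1P[//|/why_outP[c' [z [tt _ _]]]] /predU1P[//|dW].
apply/negP=> cq.
have := wf_uniq_heads pulled_wf; rewrite headsE cat_uniq => /and3P[_ /hasPn h _].
have : c \in concl E by rewrite mem_rcons in_cons (map_f pt_out tt) orbT.
move/h/negP; apply; apply: (@mem_prems_of (Why qs d)) => //.
by rewrite in_cons dW orbT.
Qed.

Lemma pulled_size ps c : Why ps c \in nodes E -> size ps != 1.
Proof.
rewrite in_cons => /predU1P[//|/why_outP[d [z [_ -> h]]]].
by have := redex_free_size h; rewrite !size_map.
Qed.

End Facts.

Lemma port_arcs_pull c a ts1 ts2 (qs new : seq garc) : size qs = size new ->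
  perm_eq (rcons (port_arcs (ts1 ++ (c, a, Some (zip qs new)) :: ts2)) p)
          (new ++ rcons (port_arcs (ts1 ++ (c, a, None) :: ts2)) p).
Proof.
move=> sz; apply/perm_count=> A; rewrite -!cats1 !port_arcs_cat !port_arcs_cons.
by rewrite /pt_arcs /pt_out /= unzip2_zip ?sz // !count_cat /= !count_cat; lia.
Qed.

Lemma pulled_step nb nb1 ts1 ts2 c a qs new :
  let ts := ts1 ++ (c, a, None) :: ts2 in
  pulling R out p nb ts -> perm_eq nb (Why qs c :: nb1) ->
  uniq new -> {in new, forall x, x \notin rcons (port_arcs ts) p} ->
  map snd new = map snd qs ->
  pulling R out p nb1 (ts1 ++ (c, a, Some (zip qs new)) :: ts2).
Proof.
move=> ts P pn un fn tn.
have sz : size qs = size new by rewrite -(size_map snd) -tn size_map.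
have e1 : unzip1 (zip qs new) = qs by rewrite unzip1_zip ?sz.
have e2 : unzip2 (zip qs new) = new by rewrite unzip2_zip ?sz.
split.
- rewrite (perm_trans (pl_nodes P)) // /whys_in !map_cat /= !flatten_cat /= /pt_in /=.
  rewrite e1; apply/permP=> A; have := permP pn A; rewrite !count_cat /=; lia.
- by rewrite (pl_concl P) /ts !map_cat.
- set L := rcons (port_arcs ts) p in fn *.
  have pL := port_arcs_pull c a ts1 ts2 sz.
  rewrite (perm_uniq pL) cat_uniq un (pl_uniq P) andbT /=.
  by apply/hasPn=> x xL; apply/negP=> /fn; rewrite xL.
- move=> t; rewrite mem_cat in_cons => /or3P[h|/eqP->|h].
  + by apply: (pl_out P); rewrite mem_cat h.
  + by have := @pl_out _ _ _ _ _ P (c, a, None); apply; rewrite mem_cat mem_head orbT.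
  + by apply: (pl_out P); rewrite mem_cat in_cons h !orbT.
- move=> x; rewrite /pairs map_cat flatten_cat mem_cat /= mem_cat.
  case/or3P=> h.
  + by apply: (pl_pairs P); rewrite /pairs map_cat flatten_cat mem_cat h.
  + exact: zip_types tn _ h.
  + by apply: (pl_pairs P); rewrite /pairs map_cat flatten_cat mem_cat /= in_cons h !orbT.
Qed.

Definition pull_reach (Y : pstruct) : Prop :=
  exists nb ts, pulling R out p nb ts /\ iso (pulled nb ts out p) Y.

(** The step is given in an isomorphic copy. The port that it pulls is located in [ts], the same
    pulling is performed in the representative with fresh arcs, and the isomorphism is extended to
    these. *)
Lemma pull_reach_pull qs c bns l1 l2 aux1 a aux2 q ns cs new nb ts g :
  size l1 = size aux1 -> size l2 = (size aux2).+1 ->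
  let R1 := PS (Bang (PS (Why qs c :: bns) (l1 ++ c :: l2))
                     (aux1 ++ a :: aux2) q :: ns) cs in
  uniq new -> ~~ has (mem (arcs R1)) new ->
  [seq e.2 | e <- new] = [seq e.2 | e <- qs] ->
  pulling R out p nb ts -> isog g (pulled nb ts out p) R1 ->
  pull_reach (PS (Bang (PS bns (l1 ++ qs ++ l2)) (aux1 ++ new ++ aux2) q
                    :: Why new a :: ns) cs).
Proof.
move=> s1 s2 R1 un fn tn P iE; set E := pulled nb ts out p in iE.
have [gi gt gn gc] := iE; have gc' : cs = map g (concl E) := gc.
have [n1 [n0 [p1 h1 k1]]] := nsiso_inv gn.
have : n1 \in nodes E by rewrite (perm_mem p1) mem_head.
rewrite in_cons => /predU1P[e1|]; last first.
  by case/(all_whyP (whys_out_why ts)) => ps [d e]; rewrite e in h1; inversion h1.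
subst n1; move: p1; rewrite perm_cons => p1.
have [h [bns0 [l [c1 [bns' [l' [aux' [eB eB' [sl sl'] pz hi]]]]]]]] := niso_bang_inv h1.
case: eB => ? /rcons_inj[? ?]; subst bns0 l c1.
(* The last element of [l2] is the conclusion of the box for the principal port; the remaining ones
   match [aux2]. *)
case/lastP: l2 s2 R1 fn iE gn gc k1 h1 eB' => // l2 c2; rewrite size_rcons => -[s2].
move=> R1 fn iE gn gc k1 h1 eB'.
case: eB' => eb ec ea ep; subst bns' aux' q.
move: ec; rewrite -rcons_cons -rcons_cat => /rcons_inj[el ec2]; subst l' c2.
rewrite zip_unzip12 zip_cat // in pz.
have : (c, a) \in map (map_pair h g) (pairs ts).
  by rewrite -(perm_mem pz) mem_cat mem_head orbT.
case/mapP=> -[c0 a0] cQ [ec ea]; subst c a.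
have [hinj ht hn _] := hi; rewrite /= in hn.
have [n2 [nb1 [pn h2 k2]]] := nsiso_inv hn.
have [qs0 [c0' [e2 pq eh]]] := niso_why_inv h2; subst n2.
have cbox : c0 \in unzip1 (pairs ts) by apply/mapP; exists (c0, a0).
have Wnb : Why qs0 c0' \in nb by rewrite (perm_mem pn) mem_head.
have aW x : x \in qs0 \/ x = c0' -> x \in arcs (PS nb (rcons (unzip1 (pairs ts)) out)).
  move=> hx; apply: (narcs_arcs (R := PS nb _) Wnb); rewrite mem_cat.
  by case: hx => ->; rewrite ?mem_head ?orbT.
have e0 : c0 = c0'.
  apply: hinj => //; last by apply: aW; right.
  by apply: concl_arcs; rewrite mem_rcons in_cons cbox orbT.
subst c0'.
have [t tts tz] : exists2 t, t \in ts & (c0, a0) \in pt_pairs t by exact/flatten_mapP.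
case: t tts tz => [[c1 a1] [z|]] tts tz.
  (* If the pair stems from a ? node pulled earlier, [c0] is a premise of that node in [R] as well
     as the conclusion of another ? node of [R], against redex-freeness. *)
  exfalso; have Wz := why_pull_in P tts.
  have : c0 \in why_concls (nodes R).
    by apply/why_conclsP; exists qs0; exact: nb_sub P _ Wnb.
  move/redex_free_disj/negP; apply; apply/why_premssP; exists (unzip1 z), c1; split=> //.
  exact: (map_f fst tz).
move: tz; rewrite inE => /eqP[? ?]; subst c1 a1.
have [ts1 [ts2 ets]] : exists ts1 ts2, ts = ts1 ++ (c0, a0, None) :: ts2.
  by case/splitPr: tts => ts1 ts2; exists ts1, ts2.
have eQ : pairs ts = pairs ts1 ++ (c0, a0) :: pairs ts2 by rewrite ets pairs_cat.
have pQ : perm_eq (zip l1 aux1 ++ zip l2 aux2)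
                  (map (map_pair h g) (pairs ts1 ++ pairs ts2)).
  rewrite -(perm_cons (h c0, g a0)) -[X in perm_eq X _]/([:: _] ++ _ ++ _).
  rewrite (perm_catCA [:: _]) (perm_trans pz) // eQ map_cat [X in perm_eq _ (_ :: X)]map_cat.
  by rewrite (perm_catCA _ [:: _]).
have sq : size qs = size new by rewrite -(size_map snd qs) -tn size_map.
(* Isomorphisms forget the order of the premises of a ? node: [u] is [zip qs new] rearranged to
   follow [qs0], and its second components form [new2]. *)
have [u eu pu] : exists2 u, map h qs0 = map fst u & perm_eq u (zip qs new).
  apply: perm_map_inv; rewrite -/(unzip1 _) unzip1_zip ?sq //.
  by rewrite perm_sym.
have [new1 [un1 fn1 tn1]] := fresh_arcs (rcons (port_arcs ts) p) (map snd qs0).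
have aE := pulled_arcs P; rewrite -/E in aE.
pose new2 := unzip2 u.
have eu2 : zip (map h qs0) new2 = u by rewrite eu zip_unzip12.
have pnew : perm_eq new2 new.
  by have := perm_map snd pu; rewrite -!/(unzip2 _) unzip2_zip ?sq.
have un2 : uniq new2 by rewrite (perm_uniq pnew).
have s10 : size new1 = size qs0 by rewrite -(size_map snd) tn1 size_map.
have s20 : size new2 = size qs0 by rewrite size_map -(size_map fst) -eu size_map.
have s12 : size new1 = size new2 by rewrite s10.
have t2 : map snd new2 = map snd new1.
  rewrite tn1 -(_ : map snd (map h qs0) = map snd qs0); last first.
    by rewrite -map_comp; apply/eq_in_map=> x xq; apply: ht; apply: aW; left.
  rewrite eu -!map_comp; apply/eq_in_map=> x; rewrite (perm_mem pu).
  exact: zip_types.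
(* [g] is constrained only on the arcs of [E], so its values on the fresh arcs can be chosen: they
   follow the order of [new2]. *)
pose g1 a := if a \in new1 then nth dflt_arc new2 (index a new1) else g a.
have g1new : map g1 new1 = new2.
  apply: (@eq_from_nth _ dflt_arc); rewrite size_map // => i lt.
  by rewrite (nth_map dflt_arc) // /g1 mem_nth // index_uniq.
have g1E : {in arcs E, g =1 g1}.
  by move=> x; rewrite aE /g1; case: ifP => // /fn1/negbTE->.
have pE : {in pairs ts, forall x, x.2 \in arcs E}.
  move=> x xP; apply: (narcs_arcs (R := E) (mem_head _ _)).
  by rewrite mem_rcons in_cons (map_f snd xP) orbT.
have a0E : a0 \in arcs E by exact: (pE (c0, a0)).
pose ts' := ts1 ++ (c0, a0, Some (zip qs0 new1)) :: ts2.
have sub1 : {subset pairs ts1 ++ pairs ts2 <= pairs ts}.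
  by move=> x; rewrite eQ !mem_cat in_cons => /orP[->|->]; rewrite ?orbT.
have P' : pulling R out p nb1 ts'.
  by apply: pulled_step pn _ _ _ => //; rewrite -?ets.
have aE' x : x \in arcs (pulled nb1 ts' out p) -> x \in new1 \/ x \in arcs E.
  rewrite (pulled_arcs P') (perm_mem (port_arcs_pull _ _ _ _ _)) ?s10 // -ets aE.
  by rewrite mem_cat => /orP.
exists nb1, ts'; split=> //; apply/isoP; exists g1; apply: isog_of_nodes.
- have cross x y : x \in new1 -> y \in arcs E -> g1 x <> g1 y.
    move=> xn yE e; have : g1 x \in new by rewrite -(perm_mem pnew) -g1new map_f.
    by move/(hasPn fn); rewrite /= (mem_isog_arcs iE) e -g1E // map_f.
  move=> x y /aE'[xn|xE] /aE'[yn|yE] e.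
  + by apply: (uniq_map_inj (s := new1) (f := g1)); rewrite ?g1new.
  + by case: (cross x y).
  + by case: (cross y x).
  + by apply: gi; rewrite ?g1E.
- move=> x /aE'[xn|xE]; last by rewrite -g1E // gt.
  rewrite /g1 xn; have li : index x new1 < size new1 by rewrite index_mem.
  rewrite -[LHS](nth_map _ dflt_arc.2) -?s12 // t2.
  by rewrite (nth_map dflt_arc) // nth_index.
- rewrite /= /ts' whys_out_cat whys_out_cons /=.
  apply: (@nsiso_perm _ [:: Bang (PS nb1 (rcons (unzip1 (pairs ts')) out))
    (unzip2 (pairs ts')) p, Why new1 a0 & whys_out ts1 ++ whys_out ts2] _ _ _ _ (perm_refl _)).
    rewrite perm_cons /pt_why_out /= unzip2_zip ?s10 //.
    by rewrite (perm_catCA _ [:: _]).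
  have pE' : p \in arcs E by rewrite aE mem_rcons mem_head.
  apply: nsiso_cons; last apply: nsiso_cons.
  + rewrite g1E // -rcons_cat -rcons_cat; apply: niso_bang.
    * exact: size_unzip12.
    * by rewrite !size_cat s1 sq s2.
    * rewrite !zip_cat // zip_unzip12 /ts' pairs_cat pairs_cons /pt_pairs /= !map_cat.
      have -> : map (map_pair h g1) (zip qs0 new1) = u.
        rewrite -eu2 -g1new; elim: (qs0) (new1) => [|x s IH] [|y s'] //=.
        by rewrite IH.
      have e1 s : {subset s <= pairs ts} ->
          map (map_pair h g1) s = map (map_pair h g) s.
        by move=> ss; apply/eq_in_map=> x /ss/pE xE; rewrite /map_pair g1E.
      rewrite !e1 => [|x xs|x xs]; rewrite ?sub1 // ?mem_cat ?xs ?orbT //.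
      rewrite perm_sym perm_catCA perm_sym perm_catCA perm_cat //.
        by rewrite perm_sym.
      by rewrite -map_cat.
    * apply: (isog_sub hi) => //.
      move=> x; rewrite mem_arcs /= => /orP[/hasP[n nn xn]|].
        by apply: (narcs_arcs (R := PS nb _)) xn; rewrite (perm_mem pn) in_cons nn orbT.
      rewrite mem_rcons in_cons => /predU1P[->|].
        by apply: concl_arcs; rewrite mem_rcons mem_head.
      rewrite /ts' pairs_cat pairs_cons /unzip1 !map_cat -!/(unzip1 _) /pt_pairs.
      rewrite unzip1_zip ?s10 // mem_cat mem_cat => /or3P[xp|xq|xp].
      - apply: concl_arcs; rewrite mem_rcons in_cons eQ /unzip1 map_cat mem_cat.
        by rewrite xp orbT.
      - by apply: aW; left.
      - apply: concl_arcs; rewrite mem_rcons in_cons eQ /unzip1 map_cat mem_cat.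
        by rewrite in_cons xp !orbT.
  + by rewrite g1E //; apply: iWhy; rewrite g1new perm_sym.
  + apply: nsiso_ext (nsiso_perm _ (perm_refl _) k1); last first.
      by move: p1; rewrite ets whys_out_cat.
    move=> x /flatten_mapP[n nn xn]; apply: g1E.
    apply: (narcs_arcs (R := E)) xn; rewrite in_cons ets whys_out_cat whys_out_cons.
    by rewrite orbC mem_cat /=; move: nn; rewrite mem_cat => /orP[->|->]; rewrite ?orbT.
- rewrite [LHS]gc' (_ : concl (pulled nb1 ts' out p) = concl E).
    by apply/eq_in_map=> x xE; apply: g1E; exact: concl_arcs.
  by rewrite /E /= ets /ts' !map_cat.
Qed.
(** Merging is excluded by [pulled_flat], erasing by [pulled_size], and a step inside the box
    because the box stays redex-free. *)
Lemma pull_reach_deep S S' : pull_reach S -> deep why_rule S S' ->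
  pull_reach S'.
Proof.
move=> [nb [ts [P /isoP[g iE]]]] d.
case: d iE => {S S'} [S S' []|B B' aux q ns cs /deep_redex_free f].
- move=> ps c qs d ns cs [gi gt gn _]; exfalso.
  have [n1 [n0 [p1 h1 k1]]] := nsiso_inv gn.
  have [n2 [n3 [p2 h2 k2]]] := nsiso_inv k1.
  have [ps0 [c0 [e1 _ ec]]] := niso_why_inv h1.
  have [qs0 [d0 [e2 q2 _]]] := niso_why_inv h2; subst n1 n2 c.
  have c0E : Why ps0 c0 \in nodes (pulled nb ts out p) by rewrite (perm_mem p1) mem_head.
  have d0E : Why qs0 d0 \in nodes (pulled nb ts out p).
    by rewrite (perm_mem p1) in_cons (perm_mem p2) mem_head orbT.
  have /negP[] := pulled_flat P c0E d0E.
  have : g c0 \in map g qs0 by rewrite -(perm_mem q2) mem_head.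
  case/mapP=> x xq /gi e; rewrite e //.
    by apply: narcs_arcs c0E _ _; rewrite mem_cat mem_head orbT.
  by apply: narcs_arcs d0E _ _; rewrite mem_cat xq.
- move=> q c ns cs _ [_ _ gn _]; exfalso.
  have [n1 [n0 [p1 h1 _]]] := nsiso_inv gn.
  have [ps0 [c0 [e1 q1 _]]] := niso_why_inv h1; subst n1.
  have c0E : Why ps0 c0 \in nodes (pulled nb ts out p) by rewrite (perm_mem p1) mem_head.
  have /negP[] := pulled_size P c0E.
  by rewrite -(size_map g) -(perm_size q1).
- move=> qs c bns l1 l2 aux1 a aux2 q ns cs new s1 s2 R1 un fn tn iE.
  exact: pull_reach_pull iE.
- move=> [_ _ gn _]; exfalso.
  have [n1 n1E h1] := nsiso_mem_r gn (mem_head _ _).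
  move: n1E; rewrite in_cons => /predU1P[e1|/(all_whyP (whys_out_why ts))[ps [c e1]]].
    subst n1; have [h [bns [l [c [bns' [l' [aux' [eB eB' _ _ hi]]]]]]]] := niso_bang_inv h1.
    case: eB => ? ec; subst bns.
    have := iso_redex_free (proj2 (isoP _ _) (ex_intro _ h hi)) (redex_free_box P _).
    case: eB' => e1 _ _ f'; subst B.
    by case/negP: f; move: f'; rewrite !redex_freeE.
  by subst n1; inversion h1.
Qed.

Lemma pull_reach_iso S S' : pull_reach S -> iso S S' -> pull_reach S'.
Proof. by move=> [nb [ts [P i]]] j; exists nb, ts; split=> //; exact: iso_trans j. Qed.

(** * Uniqueness of the normal form of a promotion *)

Definition all_pulled (ts : seq port) : Prop :=
  {in ts, forall t, t.2 = None -> pt_in t \notin why_concls (nodes R)}.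

Lemma normal_all_pulled nb ts : pulling R out p nb ts ->
  why_normal (pulled nb ts out p) -> all_pulled ts.
Proof.
move=> P nE [[c a] oz] tts /= e; subst oz; apply/negP=> /= /why_conclsP[qs cR].
have Wnb : Why qs c \in nb.
  move: cR; rewrite (perm_mem (pl_nodes P)) mem_cat => /orP[//|].
  case/whys_inP=> -[[d b] [z|]] uts //; rewrite inE => /eqP[_ ed].
  by have := pt_in_inj P tts uts ed.
have [ts1 [ts2 ets]] : exists ts1 ts2, ts = ts1 ++ (c, a, None) :: ts2.
  by case/splitPr: tts => ts1 ts2; exists ts1, ts2.
have pn := perm_to_rem Wnb; set nb1 := rem _ _ in pn.
have eQ : pairs ts = pairs ts1 ++ (c, a) :: pairs ts2 by rewrite ets pairs_cat.
set E := pulled nb ts out p in nE.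
pose l1 := unzip1 (pairs ts1); pose l2 := rcons (unzip1 (pairs ts2)) out.
pose x1 := unzip2 (pairs ts1); pose x2 := unzip2 (pairs ts2).
pose E1 := PS (Bang (PS (Why qs c :: nb1) (l1 ++ c :: l2)) (x1 ++ a :: x2) p :: whys_out ts)
              (concl E).
have el : rcons (unzip1 (pairs ts)) out = l1 ++ c :: l2.
  by rewrite eQ /unzip1 map_cat /= rcons_cat.
have ex : unzip2 (pairs ts) = x1 ++ a :: x2 by rewrite eQ /unzip2 map_cat.
have wE := pulled_wf P; have wb := pulled_wf_box P.
have i : iso E E1.
  apply/isoP; exists id; apply: isog_id => //=; apply: nsiso_cons; last first.
    by apply: nsiso_refl; have /andP[] := wf_nodes wE.
  rewrite -ex; apply: niso_box_cong; first by rewrite size_rcons size_pairs.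
  rewrite -el; apply/isoP; exists id; apply: isog_id => //=.
  apply: nsiso_perm (perm_refl _) pn _; apply: nsiso_refl; exact: (wf_nodes wb).
have [new [un fn tn]] := fresh_arcs (arcs E1 ++ rcons (port_arcs ts) p) (map snd qs).
have s1 : size l1 = size x1 by rewrite size_unzip12.
have s2 : size l2 = (size x2).+1 by rewrite size_rcons size_unzip12.
have hr := @WhyPu qs c nb1 l1 l2 x1 a x2 p (whys_out ts) (concl E) new s1 s2 un.
have sq : size qs = size new by rewrite -(size_map snd qs) -tn size_map.
(* The reduct is again a state of the reduction, which gives the well-formedness behind the
   reflexivity of [iso] at the end of the step. *)
have P' : pulling R out p nb1 (ts1 ++ (c, a, Some (zip qs new)) :: ts2).
  apply: (pulled_step (nb := nb)) => //; rewrite -ets // => x /fn.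
  by apply: contra; rewrite mem_cat => ->; rewrite orbT.
apply: (nE (PS (Bang (PS nb1 (l1 ++ qs ++ l2)) (x1 ++ new ++ x2) p
                    :: Why new a :: whys_out ts) (concl E))).
exists E1; eexists; split; first exact: i.
  apply: deep_root; apply: hr => //; apply/hasPn=> x /fn.
  by apply: contra => /= xE; rewrite mem_cat xE.
apply/isoP; exists id; apply: isog_refl; apply/andP; split; last first.
  by apply/allP=> n /(all_whyP (whys_out_why ts))[? [? ->]].
have /andP[] := wf_nodes (pulled_wf P').
rewrite pairs_cat pairs_cons /pt_pairs [snd _]/= /unzip1 /unzip2 !map_cat.
rewrite -!/(unzip1 _) -!/(unzip2 _).
by rewrite unzip1_zip ?unzip2_zip ?sq // !rcons_cat.
Qed.

Lemma port_fun nb ts nb' ts' c a z a' oz : pulling R out p nb ts ->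
  pulling R out p nb' ts' -> all_pulled ts' ->
  (c, a, Some z) \in ts -> (c, a', oz) \in ts' ->
  exists2 z', oz = Some z' & unzip1 z = unzip1 z'.
Proof.
move=> P P' F tts tts'; have h := why_pull_in P tts.
case: oz tts' => [z'|] tts'; last first.
  have /negP[] := F _ tts' erefl; by apply/why_conclsP; exists (unzip1 z).
by exists z' => //; have h' := why_pull_in P' tts'; exact: (nodes_why_fun h h').
Qed.

(** Outer arcs are not compared, since fresh names are chosen for them at each pulling. *)
Definition same_port (t t' : port) : bool :=
  (pt_in t == pt_in t') &&
  match t.2, t'.2 with
  | Some z, Some z' => unzip1 z == unzip1 z'
  | None, None => true
  | _, _ => false
  end.

Lemma all_pulled_same nb ts nb' ts' : pulling R out p nb ts ->
  pulling R out p nb' ts' -> all_pulled ts -> all_pulled ts' -> all2 same_port ts ts'.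
Proof.
move=> P P' F F'; have e : map pt_in ts = map pt_in ts'.
  by have := pl_concl P; rewrite (pl_concl P') => /rcons_inj[].
have : {in ts & ts', forall t t', pt_in t = pt_in t' -> same_port t t'}.
  move=> [[c a] oz] [[c' a'] oz'] tts tts' /= ec; rewrite /pt_in /= in ec; subst c'.
  rewrite /same_port /pt_in eqxx /=; case: oz tts => [z|] tts.
    by have [z' -> /= ->] := port_fun P P' F' tts tts'.
  case: oz' tts' => // z' tts'; by have [] := port_fun P' P F tts' tts.
elim: ts ts' e {P P' F F'} => [|t s IH] [|t' s'] //= [et es] h.
rewrite h ?mem_head //= IH // => u u' us us'; apply: h; by rewrite in_cons ?us ?us' orbT.
Qed.

Definition ren_port (g : garc -> garc) (t : port) : port :=
  (pt_in t, g (pt_out t), omap (map (map_pair id g)) t.2).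

Lemma ren_port_same g ts ts' : all2 same_port ts ts' ->
  map g (port_arcs ts) = port_arcs ts' -> ts' = map (ren_port g) ts.
Proof.
elim: ts ts' => [|[[c a] oz] s IH] [|[[c' a'] oz'] s'] // /andP[h hs].
rewrite !port_arcs_cons map_cat => /eqP.
move: h => /andP[/eqP ec h]; rewrite /pt_in /= in ec; subst c'.
rewrite eqseq_cat; last first.
  case: oz oz' h => [z|] [z'|] //= /eqP e.
  by rewrite !size_map -!(size_map fst) -/(unzip1 z) e !size_map.
case/andP=> /eqP e /eqP /(IH _ hs) ->; congr cons.
move: e; rewrite /pt_arcs /pt_out /ren_port /= => -[<- e]; congr (_, _, _).
case: oz oz' h e => [z|] [z'|] //= /eqP e1 e2; congr Some.
by elim: z z' e1 e2 => [|[x y] z IHz] [|[x' y'] z'] //= [-> e1] [<- e2]; rewrite (IHz z').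
Qed.

Lemma pairs_ren g ts : pairs (map (ren_port g) ts) = map (map_pair id g) (pairs ts).
Proof.
elim: ts => // t s IH; rewrite /= !pairs_cons map_cat IH; congr cat.
by case: t => [[c a] [z|]].
Qed.

Lemma whys_in_ren g ts : whys_in (map (ren_port g) ts) = whys_in ts.
Proof.
elim: ts => // t s IH; rewrite /= !whys_in_cons IH; congr cat.
case: t => [[c a] [z|]] //; rewrite /pt_why_in /= /pt_in /=; congr [:: Why _ _].
by rewrite /unzip1 -map_comp.
Qed.

Lemma nsiso_whys_out g ts : nsiso g (whys_out ts) (whys_out (map (ren_port g) ts)).
Proof.
elim: ts => [|t s IH]; first exact: nsiso_nil.
rewrite /= !whys_out_cons; apply: nsiso_cat IH.
case: t => [[c a] [z|]]; last exact: nsiso_nil.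
apply: nsiso_cons (nsiso_nil g); apply: iWhy.
by rewrite /unzip2 -!map_comp.
Qed.

Lemma pulled_unique nb ts nb' ts' : pulling R out p nb ts ->
  pulling R out p nb' ts' -> all_pulled ts -> all_pulled ts' ->
  iso (pulled nb ts out p) (pulled nb' ts' out p).
Proof.
move=> P P' F F'; have S := all_pulled_same P P' F F'.
pose L := rcons (port_arcs ts) p; pose L' := rcons (port_arcs ts') p.
have uL : uniq L := pl_uniq P; have uL' : uniq L' := pl_uniq P'.
(* Outer arcs have the types of the inner arcs they correspond to. Hence the lists [L] and [L'] have
   the same types, and matching them by position preserves types. *)
have tL nb0 ts0 : pulling R out p nb0 ts0 ->
    map snd (port_arcs ts0) = flatten [seq [seq a.2 | a <- pt_in t ::
      if t.2 is Some z then unzip1 z else [::]] | t <- ts0].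
  move=> P0; rewrite map_flatten -map_comp; congr flatten; apply/eq_in_map=> t tts.
  rewrite /= (pl_out P0) //; congr cons.
  case: t tts => [[c a] [z|]] //= tts; rewrite -!map_comp; apply/eq_in_map=> x xz /=.
  by apply: (pl_pairs P0); apply/flatten_mapP; exists (c, a, Some z).
have eT : map snd L = map snd L'.
  rewrite !map_rcons (tL _ _ P) (tL _ _ P'); congr rcons; congr flatten.
  elim: ts ts' S {P P' F F' L L' uL uL'} => [|[[c a] oz] s IH] [|[[c' a'] oz'] s'] //=.
  case/andP=> /andP[/eqP]; rewrite /pt_in /= => -> h /IH->; congr (_ :: _).
  by case: oz oz' h => [z|] [z'|] //= /eqP->.
have sL : size L = size L' by rewrite -(size_map snd) eT size_map.
pose g a := nth dflt_arc L' (index a L).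
have gL : map g L = L'.
  apply: (@eq_from_nth _ dflt_arc); rewrite size_map // => i lt.
  by rewrite (nth_map dflt_arc) // /g index_uniq.
have [gp gts] : g p = p /\ map g (port_arcs ts) = port_arcs ts'.
  by move: gL; rewrite /L /L' map_rcons => /rcons_inj[].
have ets' := ren_port_same S gts.
have aE := pulled_arcs P.
apply/isoP; exists g; apply: isog_of_nodes.
- move=> a b; rewrite !aE => aL bL; apply: (uniq_map_inj (s := L)) => //.
  by rewrite gL.
- move=> a; rewrite aE => aL; have li : index a L < size L by rewrite index_mem.
  by rewrite /g -[LHS](nth_map _ dflt_arc.2) -?sL // -eT (nth_map dflt_arc) // nth_index.
- have pn : perm_eq nb nb'.
    rewrite -(perm_cat2r (whys_in ts)) -(permPl (pl_nodes P)) (perm_trans (pl_nodes P')) //.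
    by rewrite ets' whys_in_ren.
  rewrite /= ets' pairs_ren; apply: nsiso_cons (nsiso_whys_out g ts).
  have := @niso_bang g id nb (unzip1 (pairs ts)) out (unzip2 (pairs ts)) p.
  rewrite gp; apply.
  + exact: size_unzip12.
  + exact: size_unzip12.
  + by rewrite !zip_unzip12.
  + rewrite map_id; apply: isog_id => //=; apply: nsiso_perm (perm_refl _) pn _.
    exact: nsiso_refl (wf_nodes (pulled_wf_box P)).
- by rewrite /= map_rcons gp ets' -!map_comp.
Qed.

Lemma pull_reach_why_nf Y : pull_reach Y ->
  exists nb ts, [/\ pulling R out p nb ts, all_pulled ts &
                   iso (pulled nb ts out p) (why_nf Y)].
Proof.
move=> rY; have [nb0 [ts0 [_ i0]]] := rY.
have [s n] := why_nfP (iso_refl_r i0).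
have [nb [ts [P i]]] : pull_reach (why_nf Y).
  apply: steps_inv s rY => S S'; [exact: pull_reach_iso|exact: pull_reach_deep].
exists nb, ts; split=> //; apply: (normal_all_pulled P) => R' h.
apply: (n R'); apply: step_iso_l h; exact: iso_sym.
Qed.

Lemma pull_reach_why_nf_iso Y Y' : pull_reach Y -> pull_reach Y' ->
  iso (why_nf Y) (why_nf Y').
Proof.
move=> /pull_reach_why_nf[nb [ts [P F i]]] /pull_reach_why_nf[nb' [ts' [P' F' i']]].
apply: iso_trans (iso_sym i) _; apply: iso_trans i'; exact: pulled_unique.
Qed.

Lemma pull_reach_good G A Y : pull_reach Y -> p.2 = Out (OBang A) ->
  map snd (concl R) = rcons (map ctx_type G) (Out A) ->
  good G (OBang A) (why_nf Y).
Proof.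
move=> /pull_reach_why_nf[nb [ts [P F i]]] ep eG; apply: good_iso i.
have wE := pulled_wf P; split=> //.
- rewrite redex_freeE; apply/andP; split; last first.
    apply/negP=> /hasP[c /why_conclsP[ps h]] /why_premssP[qs [d [k cq]]].
    by have := pulled_flat P h k; rewrite cq.
  apply/andP; split; last first.
    apply/allP=> n nW; have [ps [c e]] := all_whyP (whys_out_why ts) nW; subst n.
    by apply: (pulled_size P (ps := ps) (c := c)); rewrite in_cons nW orbT.
  apply/andP; split; first exact: (redex_free_box P (rcons (unzip1 (pairs ts)) out)).
  rewrite -size_unzip12 -cats1 take_size_cat //; apply/hasPn=> c /mapP[x xP ->] /=.
  (* A conclusion of the box is either a premise of a pulled ? node, so not the conclusion of a ?
     node of [R], or belongs to an untreated port, where [all_pulled] excludes a ? node. *)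
  have [[[d a] [z|]] tts xt] := flatten_mapP xP; apply/negP=> xc.
    have xR : x.1 \in why_concls (nodes R).
      have [ps h] := why_conclsP _ _ xc; apply/why_conclsP; exists ps; exact: (nb_sub P).
    have /negP[] := redex_free_disj xR; apply/why_premssP; exists (unzip1 z), d.
    by split; [exact: (why_pull_in P tts)|exact: map_f].
  move: xt; rewrite inE => /eqP ex; rewrite ex /= in xc.
  have /negP[] := F _ tts erefl.
  by have [ps h] := why_conclsP _ _ xc; apply/why_conclsP; exists ps; exact: (nb_sub P).
- apply/andP; split=> //; apply/allP=> n nW.
  have [ps [c e]] := all_whyP (whys_out_why ts) nW; subst n.
  have [d [z [tts -> h]]] := why_outP P nW.
  apply/allP=> x /mapP[y yz ->].
  have := pl_out P tts; rewrite /pt_out /pt_in /= => ->.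
  rewrite (pl_pairs P); last by apply/flatten_mapP; exists (d, c, Some z).
  by have := allP (allP tR _ h); apply; exact: map_f.
- move: eG; rewrite (pl_concl P) map_rcons => /rcons_inj[eG _].
  rewrite /= map_rcons ep -eG -!map_comp; congr rcons.
  by apply/eq_in_map=> t tts /=; rewrite (pl_out P).
Qed.
End Pull.

(** The nodes [N] stay in the box and the ports record only ? nodes, so one list [ts] describes a
    normal form before and after the step, which becomes a step inside the box. *)
Lemma why_nf_pull_ax_der G A N N' ns cs out p Y Y' : ax_der N N' ->
  good G A (PS (N ++ ns) cs) ->
  pull_reach (PS (N ++ ns) cs) out p Y -> pull_reach (PS (N' ++ ns) cs) out p Y' ->
  ax_ders (why_nf Y) (why_nf Y').
Proof.
move=> h gR r r'; have [w f t _] := gR; have [w' f' t' _] := good_ax_der h gR.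
have [nN nN'] := ax_der_not_why h.
have [nb [ts [P F i]]] := pull_reach_why_nf w f t r.
have [nb' [ts' [P' F' i']]] := pull_reach_why_nf w' f' t' r'.
have [nb0 q1 q2] := perm_split_why nN (whys_in_why ts) (pl_nodes P).
have P1 : pulling (PS (N ++ ns) cs) out p (N ++ nb0) ts.
  split; [|exact: pl_concl P|exact: pl_uniq P|exact: pl_out P|exact: pl_pairs P].
  by rewrite -catA perm_cat2l.
have P2 : pulling (PS (N' ++ ns) cs) out p (N' ++ nb0) ts.
  split; [|exact: pl_concl P|exact: pl_uniq P|exact: pl_out P|exact: pl_pairs P].
  by rewrite -catA perm_cat2l.
have F2 : all_pulled (PS (N' ++ ns) cs) ts.
  move=> u uts e; have := F u uts e.
  by rewrite /= !why_concls_cat (not_why_concls nN) (not_why_concls nN').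
apply: ax_ders_iso_l (iso_sym i) _.
apply: ax_ders_iso_l (pulled_unique w f t P P1 F F) _.
apply: (@ax_ders_step _ [:: Bang (PS (N ++ nb0) (rcons (unzip1 (pairs ts)) out))
    (unzip2 (pairs ts)) p] [:: Bang (PS (N' ++ nb0) (rcons (unzip1 (pairs ts)) out))
    (unzip2 (pairs ts)) p] (whys_out ts) (rcons (map pt_out ts) p)).
- exact: iso_refl (pulled_wf w f t P1).
- exact: ax_der_box.
- apply: ax_ders_iso; apply: iso_trans i'.
  exact: (pulled_unique w' f' t' P2 P' F2 F').
Qed.

(** * Nets of terms *)

Lemma concls_of_map g ns : concls_of (map (map_node g) ns) = map g (concls_of ns).
Proof.
elim: ns => // n ns IH; rewrite /concls_of /= -!/(concls_of _) map_cat IH.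
by case: n => //= *; rewrite map_rcons.
Qed.

Lemma niso_self g n : well_formed_node n -> niso g n (map_node g n).
Proof.
case: n => [a b|a b|c|c|l r c|l r c|B aux p|p c|ps c] /=; try by constructor.
case: B => bns cs /andP[/eqP]; case/lastP: cs => // l c; rewrite size_rcons => -[sl] w.
have := @niso_bang g id bns l c aux p bns l (map g aux) sl.
rewrite map_id size_map; apply=> //.
  have -> // : zip l (map g aux) = map (map_pair id g) (zip l aux).
  by elim: l aux {sl w} => [|x l IH] [|y aux] //=; rewrite IH.
exact: isog_refl (wf_nodes w).
Qed.

Lemma nsiso_self g ns : all well_formed_node ns -> nsiso g ns (map (map_node g) ns).
Proof.
move=> w; exists (map (map_node g) ns) => //.
elim: ns w => [|n ns IH] /=; first by constructor.
by case/andP=> wn w; constructor; [exact: niso_self|exact: IH].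
Qed.

Lemma isog_map_arcs g R : well_formed R -> {in arcs R &, injective g} ->
  {in arcs R, forall a, (g a).2 = a.2} -> isog g R (map_arcs g R).
Proof. by move=> w gi gt; split=> //; exact: nsiso_self (wf_nodes w). Qed.

(** Disjointness of the parts of a net is read off the first entry of the identifiers of their
    arcs. *)
Definition has_tag (i : nat) (a : garc) : bool := ohead a.1 == Some i.

Lemma tag_isog (i : nat) R : well_formed R ->
  isog (fun a : garc => (i :: a.1, a.2)) R (Defs.tag i R).
Proof. by move=> w; apply: isog_map_arcs => // -[x s] [y t] _ _ [-> ->]. Qed.

Lemma tag_arcs (i : nat) R a : well_formed R -> a \in arcs (Defs.tag i R) -> has_tag i a.
Proof.
by move=> w; rewrite (mem_isog_arcs (tag_isog i w)) => /mapP[x _ ->]; rewrite /has_tag /=.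
Qed.

Lemma good_tag i G A R : good G A R -> good G A (Defs.tag i R).
Proof.
move=> g; apply: good_iso (g) _; apply/isoP; eexists; apply: tag_isog.
by case: g.
Qed.

Lemma good_concl G A R : good G A R ->
  [/\ concl R = rcons (ins R) (out R), map snd (ins R) = map ctx_type G &
      (out R).2 = Out A].
Proof.
case=> _ _ _; rewrite /ins /out; case/lastP: (concl R) => [|l o]; first by case: (G).
rewrite map_rcons => /rcons_inj[e1 e2]; rewrite last_rcons size_rcons /=.
by have -> : take (size l) (rcons l o) = l; [rewrite -cats1 take_size_cat|].
Qed.

Lemma good_out_type G A R : good G A R -> out_type R = A.
Proof. by case/good_concl=> _ _ e; rewrite /out_type e. Qed.

Lemma good_size_ins G A R : good G A R -> size (ins R) = size G.
Proof. by case/good_concl=> _ e _; rewrite -(size_map snd) e size_map. Qed.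

Lemma good_wf G A R : good G A R -> well_formed R.
Proof. by case. Qed.

Lemma good_heads G A R : good G A R ->
  perm_eq (concls_of (nodes R)) (prems_of (nodes R) ++ rcons (ins R) (out R)).
Proof.
move=> g; have [w _ _ _] := g; have [e _ _] := good_concl g.
by move: w; rewrite well_formedE => /and3P[_ p _]; rewrite -e.
Qed.

Lemma good_uniq_tails G A R : good G A R -> uniq (concls_of (nodes R)).
Proof. by case=> w _ _ _; move: w; rewrite well_formedE => /and3P[]. Qed.

Lemma iso_concl g R R' : isog g R R' -> ins R' = map g (ins R).
Proof. by case=> _ _ _ e; rewrite /ins e size_map map_take. Qed.

Lemma good_var G j A : onth G j = Some A -> good G A (var_net G j).
Proof.
move=> Gj; have lt : j < size G by rewrite -onthTE Gj.
have eA := onth_nth (OAtom 0) _ _ _ Gj.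
rewrite /var_net; set Ai := nth (OAtom 0) G in eA *.
set x := fun i => ([:: 0; i], In (IWhy (negO (Ai i)))).
have xi : injective x by move=> i k [].
have ji : j \in iota 0 (size G) by rewrite mem_iota.
have pj := perm_to_rem ji; rewrite rem_filter ?iota_uniq // in pj.
set W := [seq Why [::] (x i) | i <- iota 0 (size G) & i != j].
have cW : concls_of W = map x [seq i <- iota 0 (size G) | i != j].
  by rewrite /W; elim: [seq i <- _ | _] => //= i s IH; rewrite /concls_of /= -IH.
have pW : prems_of W = [::].
  by rewrite /W; elim: [seq i <- _ | _] => //= i s IH; rewrite /prems_of /= -[RHS]IH.
have wW : all is_why W by rewrite all_map; apply/allP.
have pT : perm_eq (map x (iota 0 (size G)))
    (x j :: map x [seq i <- iota 0 (size G) | i != j]) by exact: (perm_map x pj).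
set n := ([:: 1], _); set o := ([:: 2], _).
have pC : perm_eq (concls_of [:: Ax n o, Defs.Der n (x j) & W])
                  [:: n, o & map x (iota 0 (size G))].
  rewrite (_ : concls_of _ = [:: n, o, x j & concls_of W]) // cW !perm_cons.
  by rewrite perm_sym.
split.
- apply: wf_intro.
  + rewrite (perm_uniq pC) /= map_inj_uniq // iota_uniq andbT !inE /=.
    by apply/andP; split; apply/mapP=> -[].
  + rewrite (perm_trans pC) // (_ : prems_of _ = n :: prems_of W) // pW perm_cons.
    by rewrite -cats1 perm_sym perm_catC.
  + by apply/allP=> m; rewrite !in_cons => /or3P[/eqP->|/eqP->|/(all_whyP wW)[? [? ->]]].
- rewrite redex_freeE; apply/andP; split.
    by apply/allP=> m; rewrite !in_cons => /or3P[/eqP->|/eqP->|/mapP[i _ ->]].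
  suff -> : why_premss [:: Ax n o, Defs.Der n (x j) & W] = [::] by apply/hasPn.
  by rewrite [LHS](_ : _ = why_premss W) // -all_why_prems.
- by apply/allP=> m; rewrite !in_cons => /or3P[/eqP->|/eqP->|/mapP[i _ ->]].
- rewrite /= map_rcons [o.2]/= eA -map_comp; congr rcons.
  by rewrite -{2}(mkseq_nth (OAtom 0) G) /mkseq -map_comp; apply: eq_map.
Qed.

(** Nodes other than ? and ! nodes create no ?-redex when added, so abstraction, and likewise [Der]
    below, stay redex-free without normalization. *)
Lemma good_lam G A A' R : good (A :: G) A' R -> good G (blimp A A') (lam_net R).
Proof.
move=> gR; have gS := good_tag 0 gR; have [e ti to] := good_concl gS.
have ot := good_out_type gS.
rewrite /lam_net; set S := Defs.tag 0 R in gS e ti to ot *.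
case E : (ins S) ti e => [|x l] //= [tx tl] e.
rewrite tx /ctx_type ot; set c := ([:: 1], _).
have [w f t _] := gS.
split.
- apply: wf_intro.
  + rewrite /concls_of /= -/(concls_of _) (good_uniq_tails gS) andbT.
    apply/negP=> /(tails_arcs (R := S)) /(tag_arcs (good_wf gR)).
    by rewrite /has_tag.
  + have := good_heads gS; rewrite E => /perm_count p; apply/perm_count=> P.
    have := p P; rewrite /concls_of /prems_of /= -/(concls_of _) -/(prems_of _).
    rewrite -!cats1 /= ?(@count_cat garc) /= ?(@count_cat garc) /=; lia.
  + exact: (wf_nodes w).
- by rewrite -cat1s redex_free_cat //; case: (S) f.
- exact: t.
- by rewrite /= !map_rcons tl.
Qed.

Lemma good_der G A R : good G (OBang A) R -> good G A (der_net R).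
Proof.
move=> gR; have gS := good_tag 0 gR; have [e ti to] := good_concl gS.
have ot := good_out_type gS.
rewrite /der_net; set S := Defs.tag 0 R in gS e ti to ot *; rewrite ot /=.
set n := ([:: 1], _); set o := ([:: 2], _); set d := ([:: 3], _).
have [w f t _] := gS; have tS a : a \in concls_of (nodes S) -> has_tag 0 a.
  by move=> /(tails_arcs (R := S)) /(tag_arcs (good_wf gR)).
split.
- apply: wf_intro.
  + rewrite (_ : concls_of _ = [:: n; o; d] ++ concls_of (nodes S)) //.
    rewrite cat_uniq (good_uniq_tails gS) andbT; apply/andP; split=> //.
    apply/hasPn=> a /tS; apply: contraL; rewrite !inE.
    by case/or3P=> /eqP->.
  + have := good_heads gS => /perm_count p; apply/perm_count=> P.
    have := p P; rewrite /concls_of /prems_of /= -/(concls_of _) -/(prems_of _).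
    rewrite -!cats1 /= ?(@count_cat garc) /= ?(@count_cat garc) /=; lia.
  + exact: (wf_nodes w).
- rewrite (redex_free_cat (N := [:: Ax _ _; Defs.Der _ _; Cut _ _])) //.
  by case: (S) f.
- by rewrite /= map_rcons ti.
Qed.

(** * Promotion *)

Definition bang_aux (R : pstruct) : seq garc :=
  [seq ([:: 0; i], (nth dflt_arc (ins R) i).2) | i <- iota 0 (size (ins R))].
Definition bang_port (R : pstruct) : garc := ([:: 1], Out (OBang (out_type R))).
Definition bang_pre (R : pstruct) : pstruct :=
  PS [:: Bang R (bang_aux R) (bang_port R)] (rcons (bang_aux R) (bang_port R)).

Lemma bang_aux_types R : map snd (bang_aux R) = map snd (ins R).
Proof.
rewrite -[in RHS](mkseq_nth dflt_arc (ins R)) /mkseq -!map_comp.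
exact: eq_map.
Qed.

Lemma bang_pre_reach G A R : good G A R ->
  pull_reach R (out R) (bang_port R) (bang_pre R).
Proof.
move=> g; have [e _ _] := good_concl g; have [w f t _] := g.
have sz : size (ins R) = size (bang_aux R) by rewrite size_map size_iota.
(* The initial state: no port has been treated. *)
pose ts : seq port := [seq (x, None) | x <- zip (ins R) (bang_aux R)].
have ep : pairs ts = zip (ins R) (bang_aux R).
  by rewrite /ts; elim: (zip _ _) => //= x s IH; rewrite pairs_cons IH.
have ew : whys_in ts = [::] by rewrite /ts; elim: (zip _ _) => //= x s IH.
have ew' : whys_out ts = [::] by rewrite /ts; elim: (zip _ _) => //= x s IH.
have ein : map pt_in ts = ins R.
  by rewrite -map_comp -[RHS](unzip1_zip (t := bang_aux R)) ?sz.
have eout : map pt_out ts = bang_aux R.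
  by rewrite -map_comp -[RHS](unzip2_zip (s := ins R)) ?sz.
have ea : port_arcs ts = bang_aux R.
  by rewrite -eout /ts; elim: (zip _ _) => //= x s IH; rewrite port_arcs_cons IH.
have P : pulling R (out R) (bang_port R) (nodes R) ts.
  split.
  - by rewrite ew cats0.
  - by rewrite ein.
  - rewrite ea rcons_uniq map_inj_uniq ?iota_uniq ?andbT; last by move=> i j [].
    by apply/mapP=> -[].
  - have tt : map snd (map pt_out ts) = map snd (map pt_in ts).
      by rewrite ein eout bang_aux_types.
    rewrite -(map_comp snd pt_out) -(map_comp snd pt_in) in tt.
    by move=> u uts; have := (proj2 (eq_in_map _ _ _) tt) u uts.
  - by rewrite ep; apply: zip_types; exact: bang_aux_types.
exists (nodes R), ts; split=> //.
have -> : pulled (nodes R) ts (out R) (bang_port R) = bang_pre R.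
  rewrite /pulled /bang_pre ep ew' eout unzip1_zip ?unzip2_zip ?sz //.
  by rewrite -e; case: (R).
apply: iso_refl; rewrite -[bang_pre R]/(bang_pre R).
have -> : bang_pre R = pulled (nodes R) ts (out R) (bang_port R).
  rewrite /pulled /bang_pre ep ew' eout unzip1_zip ?unzip2_zip ?sz //.
  by rewrite -e; case: (R).
exact: (pulled_wf w f t P).
Qed.

Lemma good_bang G A R : good G A R -> good G (OBang A) (bang_net R).
Proof.
move=> g; have [w f t c] := g.
apply: (pull_reach_good w f t (bang_pre_reach g)) => //.
by rewrite /= (good_out_type g).
Qed.

(** [bang_pre R'] is also a state reachable for the box [R], so both normal forms fall under
    uniqueness for [R]. *)
Lemma bang_net_iso G A R R' : good G A R -> iso R R' -> iso (bang_net R) (bang_net R').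
Proof.
move=> g i; have [w f t _] := g; have g' := good_iso g i.
have r := bang_pre_reach g; apply: (pull_reach_why_nf_iso w f t r).
apply: (pull_reach_iso r (S' := bang_pre R')); have /isoP[k ik] := i.
have ei := iso_concl ik; have [e ti _] := good_concl g; have [_ ti' _] := good_concl g'.
have ex : bang_aux R' = bang_aux R.
  have sz : size (ins R') = size (ins R) by rewrite ei size_map.
  rewrite /bang_aux sz; apply/eq_in_map=> j; rewrite mem_iota => /andP[_ lt].
  congr pair; rewrite -!(nth_map _ dflt_arc.2) ?sz // ti ti' //.
have ep : bang_port R' = bang_port R.
  by rewrite /bang_port (good_out_type g) (good_out_type g').
have -> : bang_pre R' = PS [:: Bang R' (bang_aux R) (bang_port R)]
    (rcons (bang_aux R) (bang_port R)) by rewrite /bang_pre ex ep.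
apply/isoP; exists id; apply: isog_id => //.
apply: nsiso_cons; last exact: nsiso_nil.
apply: niso_box_cong i.
by rewrite e size_rcons size_map size_iota.
Qed.

Lemma bang_net_ax_der G A N N' ns cs : ax_der N N' -> good G A (PS (N ++ ns) cs) ->
  ax_ders (bang_net (PS (N ++ ns) cs)) (bang_net (PS (N' ++ ns) cs)).
Proof.
move=> h g; have g' := good_ax_der h g.
exact: (why_nf_pull_ax_der h g (bang_pre_reach g) (bang_pre_reach g')).
Qed.

Lemma bang_net_ax_ders G A R R' : good G A R -> ax_ders R R' ->
  ax_ders (bang_net R) (bang_net R').
Proof.
move=> g h; apply: (ax_ders_cong (I := good G A)) h g.
- by move=> ? ?; exact: good_iso.
- by move=> ? ? ? ?; exact: good_ax_der.
- by move=> ? ?; exact: bang_net_iso.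
- by move=> ? ? ? ?; exact: bang_net_ax_der.
Qed.

(** * Application before ?-normalization *)

Lemma uniq_cat_disj (T : eqType) (s t : seq T) a :
  uniq (s ++ t) -> a \in s -> a \notin t.
Proof.
rewrite cat_uniq => /and3P[_ /hasPn h _] as_; apply: contraL as_ => /h.
by [].
Qed.

(* [App] and [App_d] before ?-normalization; they differ by [top]. *)
Definition pre_net (top : seq node) (o : garc) (S1 S2 : pstruct) : pstruct :=
  PS (top ++ joins S1 S2 ++ nodes S1 ++ nodes S2) (rcons (joined S1) o).

(** Collects what the nodes added by [App] and by [App_d] have in common, so that both are treated
    at once. Tags 0, 1 and 2 belong to [S1], [S2] and the joined arcs. By [top_perm], [top] consumes
    the two outputs and all that it produces except [o]. *)
Record top_ok (top : seq node) (o : garc) (S1 S2 : pstruct) : Prop := TopOk {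
  top_not_why : all (predC is_why) top;
  top_redex_free : all redex_free_node top;
  top_wf : all well_formed_node top;
  top_tags : {in concls_of top, forall a, [&& ~~ has_tag 0 a, ~~ has_tag 1 a & ~~ has_tag 2 a]};
  top_uniq : uniq (concls_of top);
  top_o : o \in concls_of top;
  top_perm : perm_eq (rcons (prems_of top) o) (concls_of top ++ [:: out S1; out S2]) }.

Section Pre.
Variables (G : bctx) (A1 A2 : output) (S1 S2 : pstruct) (top : seq node) (o : garc).
Hypotheses (g1 : good G A1 S1) (g2 : good G A2 S2).
Hypotheses (tag1 : {in arcs S1, forall a, has_tag 0 a})
  (tag2 : {in arcs S2, forall a, has_tag 1 a}).
Hypothesis topP : top_ok top o S1 S2.

Let X := pre_net top o S1 S2.
Let ns := nodes S1 ++ nodes S2.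
Let xs := ins S1 ++ ins S2.

Lemma size_ins12 : size (ins S2) = size (ins S1).
Proof. by rewrite (good_size_ins g1) (good_size_ins g2). Qed.

Lemma joined_tag a : a \in joined S1 -> has_tag 2 a.
Proof. by case/mapP=> i _ ->. Qed.

Lemma uniq_joined : uniq (joined S1).
Proof. by rewrite map_inj_uniq ?iota_uniq // => i j []. Qed.

Lemma joins_why : all is_why (joins S1 S2).
Proof. by rewrite all_map; apply/allP. Qed.

Lemma concls_joins : concls_of (joins S1 S2) = joined S1.
Proof.
rewrite /joins /joined; elim: (iota _ _) => //= i s IH.
by rewrite /concls_of /= -!/(concls_of _) IH.
Qed.

Lemma prems_joins : perm_eq (prems_of (joins S1 S2)) xs.
Proof.
have e1 : ins S1 = [seq nth dflt_arc (ins S1) i | i <- iota 0 (size (ins S1))].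
  by rewrite -[LHS](mkseq_nth dflt_arc).
have e2 : ins S2 = [seq nth dflt_arc (ins S2) i | i <- iota 0 (size (ins S1))].
  by rewrite -size_ins12 -[LHS](mkseq_nth dflt_arc).
rewrite /xs [X in _ ++ X]e2 [X in X ++ _]e1 /joins.
elim: (iota _ _) => //= i s IH; rewrite /prems_of /= -/(prems_of _).
apply/perm_count=> P; move/perm_count: IH => /(_ P).
by rewrite !(@count_cat garc) /= !(@count_cat garc) /=; lia.
Qed.

Lemma tagsC1 a : a \in concls_of (nodes S1) -> has_tag 0 a.
Proof. by move/(tails_arcs (R := S1))/tag1. Qed.

Lemma tagsC2 a : a \in concls_of (nodes S2) -> has_tag 1 a.
Proof. by move/(tails_arcs (R := S2))/tag2. Qed.

Lemma tag_inj i j a : has_tag i a -> has_tag j a -> i = j.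
Proof. by rewrite /has_tag => /eqP-> /eqP[]. Qed.

Lemma pre_wf : well_formed X.
Proof.
have [w1 f1 _ _] := g1; have [w2 f2 _ _] := g2.
apply: wf_intro.
- rewrite !concls_of_cat concls_joins cat_uniq (top_uniq topP) /= cat_uniq uniq_joined /=.
  rewrite cat_uniq (good_uniq_tails g1) (good_uniq_tails g2) /= andbT.
  apply/and3P; split; apply/hasPn=> a.
  + rewrite !mem_cat => /or3P[/joined_tag h|/tagsC1 h|/tagsC2 h];
      by apply/negP=> /(top_tags topP); rewrite h ?andbF.
  + rewrite mem_cat => /orP[/tagsC1 h|/tagsC2 h]; apply/negP=> /joined_tag k.
      by have := tag_inj h k.
    by have := tag_inj h k.
  + by move=> /tagsC2 h; apply/negP=> /tagsC1 k; have := tag_inj h k.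
- rewrite !concls_of_cat !prems_of_cat concls_joins.
  have /perm_count p1 := good_heads g1; have /perm_count p2 := good_heads g2.
  have /perm_count p3 := prems_joins; have /perm_count p4 := top_perm topP.
  apply/perm_count=> P; have := p1 P; have := p2 P; have := p3 P; have := p4 P.
  by rewrite /xs -!cats1 !(@count_cat garc) /=; lia.
- rewrite !all_cat (top_wf topP) (wf_nodes w1) (wf_nodes w2) /= andbT.
  by apply/allP=> n /(all_whyP joins_why)[? [? ->]].
Qed.

(** The ? nodes of [S1] and [S2] that end at a join. Only these meet ?-reduction; the other ? nodes
    go to the core. *)
Definition at_join (n : node) : bool := has (mem xs) (why_concl n).

Definition pre_whys := joins S1 S2 ++ filter at_join ns.
Definition pre_core := top ++ filter (predC at_join) ns.

Lemma pre_nodes : perm_eq (nodes X) (pre_whys ++ pre_core).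
Proof.
rewrite /X /pre_net /pre_whys /pre_core /= -/ns.
rewrite perm_catCA -catA perm_cat2l perm_sym perm_catCA perm_cat2l.
by rewrite perm_filterC.
Qed.

Lemma pre_uniq_tails : uniq (concls_of pre_whys ++ concls_of pre_core).
Proof.
have := pre_wf; rewrite well_formedE => /and3P[u _ _].
rewrite -concls_of_cat -(perm_uniq (perm_concls_of pre_nodes)) //.
Qed.

Lemma pre_uniq_heads : uniq (prems_of pre_whys ++ prems_of pre_core ++ rcons (joined S1) o).
Proof.
rewrite catA -prems_of_cat.
have p : perm_eq (heads X) (prems_of (pre_whys ++ pre_core) ++ rcons (joined S1) o).
  by rewrite /heads perm_cat2r; exact: perm_prems_of pre_nodes.
by rewrite -(perm_uniq p); exact: wf_uniq_heads pre_wf.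
Qed.

Lemma pre_mem a : (a \in concls_of pre_whys ++ concls_of pre_core) =
  (a \in prems_of pre_whys ++ prems_of pre_core ++ rcons (joined S1) o).
Proof.
have p : perm_eq (heads X) (prems_of (pre_whys ++ pre_core) ++ rcons (joined S1) o).
  by rewrite /heads perm_cat2r; exact: perm_prems_of pre_nodes.
rewrite catA -prems_of_cat -(perm_mem p) -concls_of_cat.
rewrite -(perm_mem (perm_concls_of pre_nodes)).
by have := pre_wf; rewrite well_formedE => /and3P[_ /perm_mem].
Qed.

(** Within one of the two nets this is redex-freeness; across them it is the difference of tags. *)
Lemma pre_flat c : c \in why_concls ns -> c \notin why_premss ns.
Proof.
have [_ f1 _ _] := g1; have [_ f2 _ _] := g2.
have flat S : redex_free S -> c \in why_concls (nodes S) -> c \notin why_premss (nodes S).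
  by rewrite redex_freeE => /andP[_ /hasPn h] /h.
have pT S : c \in why_concls (nodes S) -> c \in arcs S.
  by move=> h; apply: tails_arcs; exact: why_concls_sub h.
have pH S : c \in why_premss (nodes S) -> c \in arcs S.
  by move=> h; apply: heads_arcs; exact: why_premss_heads.
rewrite /ns why_concls_cat why_premss_cat !mem_cat => /orP[h|h]; apply/norP; split.
- exact: flat.
- by apply/negP=> /pH/tag2 k; have := tag_inj k (tag1 (pT _ h)).
- by apply/negP=> /pH/tag1 k; have := tag_inj k (tag2 (pT _ h)).
- exact: flat.
Qed.

Lemma xs_prems a : a \in xs -> a \in prems_of pre_whys.
Proof. by move=> ax; rewrite /pre_whys prems_of_cat mem_cat (perm_mem prems_joins) ax. Qed.

Lemma at_joinP n : n \in ns -> at_join n ->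
  exists ps c, [/\ n = Why ps c, Why ps c \in pre_whys & c \in xs].
Proof.
move=> nn; case: n nn => // ps c nn h; exists ps, c; split=> //.
  by rewrite mem_cat mem_filter nn h orbT.
by move: h; rewrite /at_join /= orbF.
Qed.

Lemma core_sub : {subset why_concls pre_core <= why_concls ns} /\
  {subset why_premss pre_core <= why_premss ns}.
Proof.
rewrite /pre_core why_concls_cat why_premss_cat.
rewrite (not_why_concls (top_not_why topP)) (not_why_premss (top_not_why topP)) /=.
split=> [c /why_conclsP[ps]|c /why_premssP[ps [d []]]]; rewrite mem_filter => /andP[_ h].
  by apply/why_conclsP; exists ps.
by move=> k; apply/why_premssP; exists ps, d.
Qed.

Lemma pre_coreP : core pre_core o.
Proof.
have [w1 f1 t1 _] := g1; have [w2 f2 t2 _] := g2.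
move: (f1) (f2); rewrite !redex_freeE => /andP[/allP f1' _] /andP[/allP f2' _].
have [sub1 sub2] := core_sub.
split.
- rewrite all_cat (top_redex_free topP) /=; apply/allP=> n; rewrite mem_filter mem_cat.
  by case/andP=> _ /orP[/f1'|/f2'].
- by apply/negP=> /hasP[c /sub1 h /sub2]; rewrite (negbTE (pre_flat h)).
- rewrite all_cat; apply/andP; split.
    by apply/allP=> -[] // ps c /(allP (top_not_why topP)).
  apply/allP=> n; rewrite mem_filter mem_cat => /andP[_ /orP[]]; exact: allP.
- move=> a; rewrite in_cons => /predU1P[->|aP].
    by rewrite concls_of_cat mem_cat (top_o topP).
  have : a \in concls_of pre_whys ++ concls_of pre_core.
    by rewrite pre_mem !mem_cat aP orbT.
  rewrite mem_cat => /orP[|//]; rewrite concls_of_cat mem_cat concls_joins.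
  have uh := pre_uniq_heads; case/orP=> [aj|].
    move: uh; rewrite cat_uniq => /and3P[_ _ /uniq_cat_disj/(_ aP)].
    by rewrite mem_rcons in_cons aj orbT.
  case/flattenP=> l /mapP[n]; rewrite mem_filter => /andP[h nn] -> an.
  have [ps [c [e _ cx]]] := at_joinP nn h; subst n.
  move: an; rewrite inE => /eqP e; subst a.
  have := uniq_cat_disj uh (xs_prems cx).
  by rewrite mem_cat aP.
- move=> c cN; have cns := sub1 _ cN.
  have [ps h] := why_conclsP _ _ cN.
  have cT : c \in concls_of pre_core by exact: why_concls_sub.
  have cnW : c \notin concls_of pre_whys.
    by apply/negP=> cW; have := uniq_cat_disj pre_uniq_tails cW; rewrite cT.
  (* Where can a ? node left in the core end? At a join it would satisfy [at_join]; at a ? node of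
     [S1] or [S2] it would contradict [pre_flat]; and the conclusions of the net start at the joins
     or in [top]. *)
  have : c \in prems_of pre_whys ++ prems_of pre_core ++ rcons (joined S1) o.
    by rewrite -pre_mem mem_cat cT orbT.
  rewrite !mem_cat => /or3P[|//|].
  + rewrite prems_of_cat mem_cat (perm_mem prems_joins) => /orP[cx|].
      move: h; rewrite /pre_core mem_cat => /orP[/(allP (top_not_why topP))//|].
      by rewrite mem_filter /= /at_join /= cx.
    case/flattenP=> l /mapP[n]; rewrite mem_filter => /andP[hn nn] -> cn.
    have [qs [d [e _ _]]] := at_joinP nn hn; subst n.
    have /negP[] := pre_flat cns; apply/why_premssP; exists qs, d; split=> //.
  + rewrite mem_rcons in_cons => /predU1P[e|cj]; last first.
      by case/negP: cnW; rewrite concls_of_cat mem_cat concls_joins cj.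
    have oT := top_o topP; rewrite -e in oT.
    move: pre_uniq_tails; rewrite cat_uniq => /and3P[_ _].
    rewrite /pre_core concls_of_cat => /uniq_cat_disj/(_ oT).
    have hW : Why ps c \in filter (predC at_join) ns.
      by move: h; rewrite /pre_core mem_cat => /orP[/(allP (top_not_why topP))//|].
    by rewrite (mem_concls_of hW) ?mem_head.
Qed.

(** By [pre_flat], no ? node of the two nets feeds another one, so a single unfolding reaches the
    sources. *)
Definition why_src (a : garc) : seq garc :=
  if a \in why_concls ns then flatten [seq why_prems n | n <- ns & a \in why_concl n]
  else [:: a].

Definition pre_fr : seq (seq garc) :=
  [seq why_src (nth dflt_arc (ins S1) i) ++ why_src (nth dflt_arc (ins S2) i)
  | i <- iota 0 (size (ins S1))].

Definition pre_src (a : garc) : seq garc :=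
  if a \in joined S1 then nth [::] pre_fr (index a (joined S1)) else why_src a.

(** ? nodes are stacked at most two high: those of the two nets, then the joins. *)
Definition pre_rank (a : garc) : nat :=
  if a \in joined S1 then 2 else (a \in why_concls ns).

(** Tails are unique, so [Why ps c] is the only node selected by the filter in [why_src]. *)
Lemma why_srcE ps c : Why ps c \in ns -> why_src c = ps.
Proof.
move=> h; rewrite /why_src.
have -> : c \in why_concls ns by apply/why_conclsP; exists ps.
have u : uniq (concls_of ns).
  have := pre_wf; rewrite well_formedE => /and3P[].
  by rewrite tailsE /= !concls_of_cat catA cat_uniq => /and3P[_ _]; rewrite -concls_of_cat.
have p := perm_to_rem h; move: u; rewrite (perm_uniq (perm_concls_of p)) => /andP[cn _].
suff -> : [seq n <- ns | c \in why_concl n] = [:: Why ps c] by rewrite /= cats0.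
apply: perm_small_eq => //; rewrite (perm_trans (perm_filter _ p)) //= mem_head.
rewrite (eq_in_filter (a2 := pred0)) ?filter_pred0 // => n nr /=.
by apply/negP=> /why_concl_concls cc; case/negP: cn; exact: (mem_concls_of nr).
Qed.

Lemma nth_joined i : i < size (ins S1) ->
  join_arc S1 i \in joined S1 /\ pre_src (join_arc S1 i) =
    why_src (nth dflt_arc (ins S1) i) ++ why_src (nth dflt_arc (ins S2) i).
Proof.
move=> lt; have iI : i \in iota 0 (size (ins S1)) by rewrite mem_iota.
have jj : join_arc S1 i \in joined S1 by exact: map_f.
split=> //; rewrite /pre_src jj /joined index_map; last by move=> j k [].
have -> : index i (iota 0 (size (ins S1))) = i.
  have ei : nth 0 (iota 0 (size (ins S1))) i = i by rewrite nth_iota.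
  by rewrite -{1}ei index_uniq ?size_iota ?iota_uniq.
by rewrite /pre_fr (nth_map 0) ?size_iota // nth_iota.
Qed.

Lemma prems_not_joined a : a \in prems_of pre_whys -> a \notin joined S1.
Proof.
move/(uniq_cat_disj pre_uniq_heads); apply: contra => aj.
by rewrite mem_cat mem_rcons in_cons aj !orbT.
Qed.

Lemma pre_joining : joining pre_core o pre_fr (map ctx_type G) X pre_whys
  (joined S1) pre_src pre_rank.
Proof.
have [w1 f1 t1 _] := g1; have [w2 f2 t2 _] := g2.
have tns : all why_typed ns by rewrite all_cat t1 t2.
have [_ ti1 _] := good_concl g1; have [_ ti2 _] := good_concl g2.
have x1 i : i < size (ins S1) -> nth dflt_arc (ins S1) i \in xs.
  by move=> lt; rewrite mem_cat mem_nth.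
have x2 i : i < size (ins S1) -> nth dflt_arc (ins S2) i \in xs.
  by move=> lt; rewrite mem_cat orbC mem_nth // size_ins12.
have srcx a : a \in xs -> pre_src a = why_src a.
  by move/xs_prems/prems_not_joined/negbTE=> h; rewrite /pre_src h.
have joinP ps c : Why ps c \in joins S1 S2 -> exists2 i, i < size (ins S1) &
    ps = [:: nth dflt_arc (ins S1) i; nth dflt_arc (ins S2) i] /\ c = join_arc S1 i.
  by case/mapP=> i; rewrite mem_iota => /andP[_ lt] [-> ->]; exists i.
have whyP ps c : Why ps c \in filter at_join ns ->
    [/\ Why ps c \in ns, c \in xs & {in ps, forall p, p \in prems_of pre_whys /\
        p \notin why_concls ns}].
  rewrite mem_filter /at_join /= orbF => /andP[cx h]; split=> // p pp; split.
    apply: (mem_prems_of (n := Why ps c)) => //.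
    by rewrite mem_cat mem_filter /at_join /= cx h orbT.
  apply/negP=> /pre_flat/negP; apply; apply/why_premssP; by exists ps, c.
split.
- exact: pre_nodes.
- by [].
- rewrite all_cat joins_why; apply/allP=> n; rewrite mem_filter => /andP[h nn].
  by have [ps [c [-> _ _]]] := at_joinP nn h.
- rewrite all_cat; apply/andP; split; last first.
    by apply/allP=> n; rewrite mem_filter => /andP[_]; exact: allP.
  apply/allP=> n nj; have [ps [c e]] := all_whyP joins_why nj; subst n.
  have [i lt [-> ->]] := joinP _ _ nj; rewrite /= eqxx /= andbT.
  (* The two joined arcs have the same type because both nets are typed over the context [G]. *)
  rewrite -[X in X == _](nth_map _ dflt_arc.2) ?size_ins12 //.
  by rewrite -[X in _ == X](nth_map _ dflt_arc.2) // ti1 ti2.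
- exact: pre_wf.
- rewrite -ti1 -[in RHS](mkseq_nth dflt_arc (ins S1)) /mkseq -!map_comp.
  exact: eq_map.
- move=> a aN an; have aj : a \notin joined S1.
    apply/negP=> aj; have aW : a \in concls_of pre_whys.
      by rewrite concls_of_cat mem_cat concls_joins aj.
    by have := uniq_cat_disj pre_uniq_tails aW; rewrite aN.
  rewrite /pre_src (negbTE aj) /why_src; case: ifP => // /why_conclsP[ps h].
  case: (boolP (at_join (Why ps a))) => hj.
    have aW : a \in concls_of pre_whys.
      apply: (mem_concls_of (n := Why ps a)); last exact: mem_head.
      by rewrite mem_cat mem_filter hj h orbT.
    by have := uniq_cat_disj pre_uniq_tails aW; rewrite aN.
  case/negP: an; apply/why_conclsP; exists ps.
  by rewrite mem_cat mem_filter /= hj h orbT.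
- move=> ps c; rewrite mem_cat => /orP[/joinP[i lt [-> ->]]|/whyP[h cx pp]].
    have [_ ->] := nth_joined lt.
    by rewrite /= cats0 !srcx ?x1 ?x2.
  rewrite srcx // (why_srcE h).
  suff -> : flatten (map pre_src ps) = ps by [].
  elim: (ps) pp => //= p s IH pp.
  have [pW pC] := pp p (mem_head _ _); rewrite IH.
    by rewrite /pre_src (negbTE (prems_not_joined pW)) /why_src (negbTE pC).
  by move=> q qs; apply: pp; rewrite in_cons qs orbT.
- move=> ps c; rewrite mem_cat => /orP[/joinP[i lt [-> ->]]|/whyP[h cx pp]] p pps.
    have [jj _] := nth_joined lt; rewrite /pre_rank jj.
    have px : p \in xs by move: pps; rewrite !inE => /orP[]/eqP->; [exact: x1|exact: x2].
    rewrite (negbTE (prems_not_joined (xs_prems px))).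
    by case: (p \in _).
  have [pW pC] := pp p pps.
  rewrite /pre_rank (negbTE (prems_not_joined pW)) (negbTE pC).
  rewrite (negbTE (prems_not_joined (xs_prems cx))).
  suff -> : c \in why_concls ns by [].
  by apply/why_conclsP; exists ps.
- rewrite all2E !size_map eqxx /=; apply/allP=> x xz.
  have : exists2 i, i < size (ins S1) & x = (join_arc S1 i,
      why_src (nth dflt_arc (ins S1) i) ++ why_src (nth dflt_arc (ins S2) i)).
    move: xz; rewrite /joined /pre_fr.
    have : {in iota 0 (size (ins S1)), forall i, i < size (ins S1)}.
      by move=> i; rewrite mem_iota.
    elim: (iota _ _) => //= i s IH hi; rewrite in_cons => /predU1P[->|/IH].
      by exists i => //; apply: hi; exact: mem_head.
    by apply=> k ks; apply: hi; rewrite in_cons ks orbT.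
  by case=> i lt -> /=; have [_ ->] := nth_joined lt.
Qed.
End Pre.

Lemma negOK A : negI (negO A) = A
with negIK J : negO (negI J) = J.
Proof.
- case: A => [X|J A|A] //=; first by rewrite negIK negOK.
  by rewrite negOK.
- case: J => [X|A J|J] //=; first by rewrite negIK negOK.
  by rewrite negIK.
Qed.

(** * Gluing renamings of tagged nets *)

Definition glue (k1 k2 : garc -> garc) (a : garc) : garc :=
  if has_tag 0 a then k1 a else if has_tag 1 a then k2 a else a.

(** Both renamings preserve tags, and an arc of [top] with tag 0 or 1 belongs to the corresponding
    net. The glued function therefore has three disjoint ranges and is injective. *)
Lemma isog_glue k1 k2 S1 S2 S1' S2' top cs :
  isog k1 S1 S1' -> isog k2 S2 S2' ->
  {in arcs S1, forall a, has_tag 0 a} -> {in arcs S2, forall a, has_tag 1 a} ->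
  {in arcs S1', forall a, has_tag 0 a} -> {in arcs S2', forall a, has_tag 1 a} ->
  all well_formed_node top ->
  {in arcs (PS top cs), forall a, has_tag 0 a -> a \in arcs S1} ->
  {in arcs (PS top cs), forall a, has_tag 1 a -> a \in arcs S2} ->
  isog (glue k1 k2) (PS (top ++ nodes S1 ++ nodes S2) cs)
    (PS (map (map_node (glue k1 k2)) top ++ nodes S1' ++ nodes S2')
        (map (glue k1 k2) cs)).
Proof.
move=> i1 i2 t1 t2 t1' t2' w h1 h2; set X := PS _ _.
have aX a : a \in arcs X -> (has_tag 0 a -> a \in arcs S1) /\ (has_tag 1 a -> a \in arcs S2).
  rewrite mem_arcs /= !has_cat => /orP[/or3P[h|h|h]|h].
  - by split; [apply: h1|apply: h2]; rewrite mem_arcs h.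
  - have aS : a \in arcs S1 by rewrite mem_arcs h.
    by split=> // k; have := tag_inj k (t1 _ aS).
  - have aS : a \in arcs S2 by rewrite mem_arcs h.
    by split=> // k; have := tag_inj k (t2 _ aS).
  - by split; [apply: h1|apply: h2]; rewrite mem_arcs h orbT.
have [gi1 gt1 gn1 gc1] := i1; have [gi2 gt2 gn2 gc2] := i2.
have k1t a : a \in arcs S1 -> has_tag 0 (k1 a).
  by move=> aS; apply: t1'; rewrite (mem_isog_arcs i1) map_f.
have k2t a : a \in arcs S2 -> has_tag 1 (k2 a).
  by move=> aS; apply: t2'; rewrite (mem_isog_arcs i2) map_f.
apply: isog_of_nodes => //.
- move=> a b /aX[a1 a2] /aX[b1 b2]; rewrite /glue.
  case: (boolP (has_tag 0 a)) => [a0|a0]; case: (boolP (has_tag 0 b)) => [b0|b0].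
  + by apply: gi1; [exact: a1|exact: b1].
  + case: ifP => b01 e; have := k1t _ (a1 a0); rewrite e.
      by move=> k; have := tag_inj k (k2t _ (b2 b01)).
    by rewrite (negbTE b0).
  + case: ifP => a01 e; have := k1t _ (b1 b0); rewrite -e.
      by move=> k; have := tag_inj k (k2t _ (a2 a01)).
    by rewrite (negbTE a0).
  + case: (boolP (has_tag 1 a)) => [a3|a3]; case: (boolP (has_tag 1 b)) => [b3|b3] //.
    * by apply: gi2; [exact: a2|exact: b2].
    * by move=> e; have := k2t _ (a2 a3); rewrite e (negbTE b3).
    * by move=> e; have := k2t _ (b2 b3); rewrite -e (negbTE a3).
- move=> a /aX[a1 a2]; rewrite /glue; case: ifP => [/a1|_]; first exact: gt1.
  by case: ifP => [/a2|//]; exact: gt2.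
- apply: nsiso_cat (nsiso_self _ w) _; apply: nsiso_cat.
  + apply: nsiso_ext gn1 => a aS; have aS1 : a \in arcs S1.
      by case/flatten_mapP: aS => n nS an; exact: (narcs_arcs nS).
    by rewrite /glue t1.
  + apply: nsiso_ext gn2 => a aS; have aS2 : a \in arcs S2.
      by case/flatten_mapP: aS => n nS an; exact: (narcs_arcs nS).
    rewrite /glue t2 //; case: ifP => // k; by have := tag_inj k (t2 _ aS2).
Qed.

Lemma out_isog G A R R' g : good G A R -> good G A R' -> isog g R R' ->
  out R' = g (out R).
Proof.
move=> gR gR' [_ _ _ e]; have [e1 _ _] := good_concl gR; have [e2 _ _] := good_concl gR'.
by move: e; rewrite e2 e1 map_rcons => /rcons_inj[].
Qed.

Lemma iso_tag i G A R R' : good G A R -> iso R R' ->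
  exists k, isog k (Defs.tag i R) (Defs.tag i R').
Proof.
move=> g /isoP[k ik]; have g' : good G A R' by apply: good_iso g _; apply/isoP; exists k.
have i1 := tag_isog i (good_wf g); have i2 := tag_isog i (good_wf g').
eexists; exact: isog_trans (isog_trans (isog_inv i1) ik) i2.
Qed.

Lemma lam_net_iso G A A' R R' : good (A :: G) A' R -> iso R R' ->
  iso (lam_net R) (lam_net R').
Proof.
move=> g i; have g' := good_iso g i; have [k ik] := iso_tag 0 g i.
have gS := good_tag 0 g; have gS' := good_tag 0 g'.
have eo := out_isog gS gS' ik; have ei := iso_concl ik.
have ot := good_out_type gS; have ot' := good_out_type gS'.
have [e ti _] := good_concl gS; have [_ ti' _] := good_concl gS'.
have t0 := fun a => @tag_arcs 0 R a (good_wf g).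
have t0' := fun a => @tag_arcs 0 R' a (good_wf g').
rewrite /lam_net; move: (Defs.tag 0 R) (Defs.tag 0 R') gS gS' ik eo ei ot ot' e ti ti' t0 t0'.
move=> S S' gS gS' ik eo ei ot ot' e ti ti' t0 t0'.
case E : (ins S) ti ei e => [|x l] //= [tx tl] ei e.
rewrite ei in ti' *; move: ti' => /= [tx' tl'].
rewrite tx tx' /ctx_type ot ot'; set c := ([:: 1], _).
have gl a : a \in arcs S -> glue k id a = k a by move=> aS; rewrite /glue t0.
have cS a : a \in rcons (x :: l) (out S) -> a \in arcs S.
  by move=> aS; apply: concl_arcs; rewrite e.
(* The second net to glue is the lone arc [c]: its identifier [[:: 1]] carries tag 1, so it has to
   belong to the second net, where it is fixed. *)
have i0 : isog id (PS [::] [:: c]) (PS [::] [:: c]) by exact: isog_refl.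
have n0 : {in arcs (PS [::] [:: c]), forall a, has_tag 1 a}.
  by move=> a; rewrite mem_arcs inE => /eqP->.
apply/isoP; exists (glue k id).
have := @isog_glue k id S (PS [::] [:: c]) S' (PS [::] [:: c]) [:: Par x (out S) c]
  (rcons l c) ik i0 t0 n0 t0' n0.
have gx : glue k id x = k x by apply: gl; apply: cS; exact: mem_head.
have go : glue k id (out S) = k (out S) by apply: gl; apply: cS; rewrite mem_rcons mem_head.
rewrite /= !cats0 map_rcons gx go -eo (_ : glue k id c = c) //.
have -> : map (glue k id) l = map k l.
  by apply/eq_in_map=> a al; rewrite gl // cS // mem_rcons !in_cons al !orbT.
apply=> //.
- move=> a; rewrite mem_arcs /= orbF mem_rcons !inE.
  case/or3P=> [/or3P[]/eqP->|/eqP->|al] //.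
  + by rewrite cS // mem_rcons !in_cons eqxx !orbT.
  + by rewrite cS // mem_rcons mem_head.
  + by rewrite cS // mem_rcons !in_cons al !orbT.
- move=> a; rewrite mem_arcs /= orbF mem_rcons !inE => aX h.
  have : a = c \/ a \in arcs S.
    case/or3P: aX => [/or3P[]/eqP->|/eqP->|al]; try (by left); right.
    + by rewrite cS // mem_rcons !in_cons eqxx !orbT.
    + by rewrite cS // mem_rcons mem_head.
    + by rewrite cS // mem_rcons !in_cons al !orbT.
  case=> [ea|aS]; first exact/eqP.
  by have := tag_inj h (t0 _ aS).
Qed.

Lemma lam_net_ax_ders G A A' R R' : good (A :: G) A' R -> ax_ders R R' ->
  ax_ders (lam_net R) (lam_net R').
Proof.
move=> g h; apply: (ax_ders_cong (I := good (A :: G) A')) h g.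
- by move=> ? ?; exact: good_iso.
- by move=> ? ? ? ?; exact: good_ax_der.
- by move=> ? ?; exact: lam_net_iso.
move=> N N' ns cs h g; have g' := good_ax_der h g.
have w := good_wf (good_lam g); have w' := good_wf (good_lam g').
(* The par node and the new conclusions depend only on [cs], so they are the same for [N] and for
   [N']. *)
pose q := head (One dflt_arc) (nodes (lam_net (PS ns cs))).
pose f := map_node (fun a : garc => (0 :: a.1, a.2)).
have e M : lam_net (PS (M ++ ns) cs) =
    PS (q :: map f M ++ map f ns) (concl (lam_net (PS ns cs))).
  by rewrite -map_cat.
have p M : perm_eq (q :: map f M ++ map f ns) (map f M ++ q :: map f ns).
  by rewrite (perm_catCA [:: q]).
rewrite !e in w w' *.
apply: (ax_ders_step (iso_front (wf_nodes w) (p N)) (ax_der_map _ h)).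
apply: ax_ders_iso; apply: iso_sym; exact: (iso_front (wf_nodes w') (p N')).
Qed.

(** * Application and its congruence *)

Definition app_arcs_in A' : garc := ([:: 3], In (negO A')).
Definition app_out A' : garc := ([:: 4], Out A').
Definition app_tens A A' : garc := ([:: 5], In (ITens A (negO A'))).
Definition app_der A A' : garc := ([:: 6], In (IWhy (ITens A (negO A')))).

Definition app_top A A' (s1 s2 : garc) : seq node :=
  [:: Ax (app_arcs_in A') (app_out A'); Tens s2 (app_arcs_in A') (app_tens A A');
      Cut (app_tens A A') s1].
Definition appd_top A A' (s1 s2 : garc) : seq node :=
  [:: Ax (app_arcs_in A') (app_out A'); Tens s2 (app_arcs_in A') (app_tens A A');
      Defs.Der (app_tens A A') (app_der A A'); Cut (app_der A A') s1].

Section App.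
Variables (G : bctx) (A A' B1 : output) (R1 R2 : pstruct).
Hypotheses (g1 : good G B1 R1) (g2 : good G (OBang A) R2).
Let S1 := Defs.tag 0 R1.
Let S2 := Defs.tag 1 R2.

Lemma tag_arcs1 : {in arcs S1, forall a, has_tag 0 a}.
Proof. by move=> a; apply: tag_arcs; exact: good_wf g1. Qed.

Lemma tag_arcs2 : {in arcs S2, forall a, has_tag 1 a}.
Proof. by move=> a; apply: tag_arcs; exact: good_wf g2. Qed.

Lemma app_top_ok : top_ok (app_top A A' (out S1) (out S2)) (app_out A') S1 S2.
Proof.
split=> //; first by move=> a; rewrite !inE => /or3P[]/eqP->.
  by rewrite /concls_of /= !inE eqxx ?orbT.
by apply/permP=> P /=; lia.
Qed.

Lemma appd_top_ok : top_ok (appd_top A A' (out S1) (out S2)) (app_out A') S1 S2.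
Proof.
split=> //; first by move=> a; rewrite !inE => /or4P[]/eqP->.
  by rewrite /concls_of /= !inE eqxx ?orbT.
by apply/permP=> P /=; lia.
Qed.

Lemma app_netE : B1 = blimp A A' -> app_net R1 R2 =
  why_nf (pre_net (app_top A A' (out S1) (out S2)) (app_out A') S1 S2).
Proof.
move=> e; rewrite /app_net (good_out_type (good_tag 0 g1)) (good_out_type (good_tag 1 g2)).
by rewrite e.
Qed.

Lemma appd_netE : B1 = OBang (blimp A A') -> appd_net R1 R2 =
  why_nf (pre_net (appd_top A A' (out S1) (out S2)) (app_out A') S1 S2).
Proof.
move=> e; rewrite /appd_net (good_out_type (good_tag 0 g1)) (good_out_type (good_tag 1 g2)).
by rewrite e.
Qed.

Definition app_core := pre_coreP (good_tag 0 g1) (good_tag 1 g2) tag_arcs1 tag_arcs2 app_top_ok.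
Definition app_joining :=
  pre_joining (good_tag 0 g1) (good_tag 1 g2) tag_arcs1 tag_arcs2 app_top_ok.
Definition appd_core := pre_coreP (good_tag 0 g1) (good_tag 1 g2) tag_arcs1 tag_arcs2 appd_top_ok.
Definition appd_joining :=
  pre_joining (good_tag 0 g1) (good_tag 1 g2) tag_arcs1 tag_arcs2 appd_top_ok.

Lemma good_app : B1 = blimp A A' -> good G A' (app_net R1 R2).
Proof.
by move=> e; rewrite (app_netE e); apply: (reach_good app_core (joining_reach app_joining)).
Qed.
End App.

Lemma appd_net_iso G A A' R1 R2 R1' R2' : good G (OBang (blimp A A')) R1 ->
  good G (OBang A) R2 -> iso R1 R1' -> iso R2 R2' ->
  iso (appd_net R1 R2) (appd_net R1' R2').
Proof.
move=> g1 g2 i1 i2; have g1' := good_iso g1 i1; have g2' := good_iso g2 i2.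
rewrite (appd_netE g1 g2 erefl) (appd_netE g1' g2' erefl).
apply: (reach_why_nf_iso (appd_core A' g1 g2) (joining_reach (appd_joining A' g1 g2))).
apply: (reach_iso (joining_reach (appd_joining A' g1 g2))).
have [k1 ik1] := iso_tag 0 g1 i1; have [k2 ik2] := iso_tag 1 g2 i2.
have t1 := tag_arcs1 g1; have t1' := tag_arcs1 g1'.
have t2 := tag_arcs2 g2; have t2' := tag_arcs2 g2'.
have gS1 := good_tag 0 g1; have gS1' := good_tag 0 g1'.
have gS2 := good_tag 1 g2; have gS2' := good_tag 1 g2'.
have eo1 := out_isog gS1 gS1' ik1; have eo2 := out_isog gS2 gS2' ik2.
have ei1 := iso_concl ik1; have ei2 := iso_concl ik2.
have [e1 ti1 _] := good_concl gS1; have [e2 ti2 _] := good_concl gS2.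
have sz : size (ins (Defs.tag 1 R2)) = size (ins (Defs.tag 0 R1)).
  exact: (size_ins12 gS1 gS2).
move: (Defs.tag 0 R1) (Defs.tag 1 R2) (Defs.tag 0 R1') (Defs.tag 1 R2')
  gS1 gS2 gS1' gS2' ik1 ik2 t1 t1' t2 t2' eo1 eo2 ei1 ei2 e1 e2 ti1 ti2 sz.
move=> S1 S2 S1' S2' gS1 gS2 gS1' gS2' ik1 ik2 t1 t1' t2 t2' eo1 eo2 ei1 ei2 e1 e2 ti1 ti2 sz.
have o1 : out S1 \in arcs S1 by apply: concl_arcs; rewrite e1 mem_rcons mem_head.
have o2 : out S2 \in arcs S2 by apply: concl_arcs; rewrite e2 mem_rcons mem_head.
have x1 i : i < size (ins S1) -> nth dflt_arc (ins S1) i \in arcs S1.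
  by move=> lt; apply: concl_arcs; rewrite e1 mem_rcons in_cons mem_nth ?orbT.
have x2 i : i < size (ins S1) -> nth dflt_arc (ins S2) i \in arcs S2.
  by move=> lt; apply: concl_arcs; rewrite e2 mem_rcons in_cons mem_nth ?orbT ?sz.
have gl1 a : a \in arcs S1 -> glue k1 k2 a = k1 a by move=> aS; rewrite /glue t1.
have gl2 a : a \in arcs S2 -> glue k1 k2 a = k2 a.
  move=> aS; rewrite /glue (t2 _ aS); case: ifP => // h.
  by have := tag_inj h (t2 _ aS).
have gj i : i < size (ins S1) -> glue k1 k2 (join_arc S1 i) = join_arc S1' i.
  move=> lt; rewrite /glue /= /join_arc ei1 (nth_map dflt_arc) //.
  by have [_ gt1 _ _] := ik1; rewrite gt1 ?x1.
(* The joins mix arcs of both nets, so for the gluing they count as nodes of [top]. *)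
set top := appd_top A A' (out S1) (out S2) ++ joins S1 S2.
set cs := rcons (joined S1) (app_out A').
have arcsP a : a \in arcs (PS top cs) ->
    [\/ a \in arcs S1, a \in arcs S2 | ~~ has_tag 0 a && ~~ has_tag 1 a].
  have joinP b : b \in joined S1 -> ~~ has_tag 0 b && ~~ has_tag 1 b.
    by case/mapP=> i _ ->.
  rewrite mem_arcs => /orP[/hasP[n]|]; last first.
    rewrite mem_rcons in_cons => /predU1P[->|/joinP h]; by [constructor 3|constructor 3].
  rewrite mem_cat => /orP[|/mapP[i]].
    rewrite !inE => /or4P[]/eqP->; rewrite /narcs /= !inE.
    - by case/orP=> /eqP->; constructor 3.
    - by case/or3P=> /eqP->; [constructor 2|constructor 3|constructor 3].
    - by case/orP=> /eqP->; constructor 3.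
    - by case/orP=> /eqP->; [constructor 3|constructor 1].
  rewrite mem_iota => /andP[_ lt] ->; rewrite /narcs /= !inE.
  by case/or3P=> /eqP->; [constructor 1; exact: x1|constructor 2; exact: x2|constructor 3].
apply/isoP; exists (glue k1 k2).
have := @isog_glue k1 k2 S1 S2 S1' S2' top cs ik1 ik2 t1 t2 t1' t2'.
have -> : map (map_node (glue k1 k2)) top =
    appd_top A A' (out S1') (out S2') ++ joins S1' S2'.
  rewrite /top map_cat; congr cat; first by rewrite /= (gl1 _ o1) (gl2 _ o2) -eo1 -eo2.
  rewrite /joins -map_comp [in RHS]ei1 size_map; apply/eq_in_map=> i.
  rewrite mem_iota => /andP[_ lt] /=; rewrite gj // gl1 ?x1 // gl2 ?x2 //.
  by rewrite ei2 !(nth_map dflt_arc) ?sz.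
have -> : map (glue k1 k2) cs = rcons (joined S1') (app_out A').
  rewrite /cs map_rcons /joined -map_comp ei1 size_map; congr rcons.
  by apply/eq_in_map=> i; rewrite mem_iota => /andP[_ lt]; exact: gj.
rewrite /pre_net /top -!catA; apply.
- by apply/allP=> n; rewrite mem_cat !inE => /orP[/or4P[]/eqP->|/mapP[i _ ->]].
- move=> a /arcsP[//|aS h|/andP[/negbTE->]//].
  by have := tag_inj h (t2 _ aS).
- move=> a /arcsP[aS h|//|/andP[_ /negbTE->]//].
  by have := tag_inj h (t1 _ aS).
Qed.

Lemma appd_net_ax_ders G A A' R1 R2 R1' R2' : good G (OBang (blimp A A')) R1 ->
  good G (OBang A) R2 -> ax_ders R1 R1' -> ax_ders R2 R2' ->
  ax_ders (appd_net R1 R2) (appd_net R1' R2').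
Proof.
move=> g1 g2 h1 h2; have g1' := good_ax_ders g1 h1.
apply: (@ax_ders_trans _ (appd_net R1' R2)).
  apply: (ax_ders_cong (F := fun R => appd_net R R2) (I := good G (OBang (blimp A A')))) h1 g1.
  - by move=> ? ?; exact: good_iso.
  - by move=> ? ? ? ?; exact: good_ax_der.
  - by move=> R R' g i; apply: appd_net_iso g g2 i (iso_refl (good_wf g2)).
  move=> N N' ns cs h g; have g' := good_ax_der h g.
  rewrite (appd_netE g g2 erefl) (appd_netE g' g2 erefl).
  pose f := map_node (fun a : garc => (0 :: a.1, a.2)).
  have jn := appd_joining A' g g2; have jn' := appd_joining A' g' g2.
  have w' := jn_wf_node jn'.
  (* [T] and [J] depend on the conclusions of the argument, which the step leaves alone; the
     rewritten nodes are thus the tagged copies of [N] and the rest is shared. *)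
  set T := appd_top A A' _ _ in jn *; set J := joins (Defs.tag 0 (PS (N ++ ns) cs)) (Defs.tag 1 R2).
  pose rest := T ++ J ++ map f ns ++ nodes (Defs.tag 1 R2).
  have p M : perm_eq (T ++ J ++ map f (M ++ ns) ++ nodes (Defs.tag 1 R2)) (map f M ++ rest).
    rewrite map_cat -!catA /rest; apply/permP=> P; rewrite !count_cat; lia.
  apply: (why_nf_ax_der (appd_core A' g g2) jn (ax_der_map _ h) (p N)).
  by apply: iso_sym; apply: (iso_front w' (p N')).
apply: (ax_ders_cong (F := fun R => appd_net R1' R) (I := good G (OBang A))) h2 g2.
- by move=> ? ?; exact: good_iso.
- by move=> ? ? ? ?; exact: good_ax_der.
- by move=> R R' g i; apply: appd_net_iso g1' g (iso_refl (good_wf g1')) i.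
move=> N N' ns cs h g; have g' := good_ax_der h g.
rewrite (appd_netE g1' g erefl) (appd_netE g1' g' erefl).
pose f := map_node (fun a : garc => (1 :: a.1, a.2)).
have jn := appd_joining A' g1' g; have jn' := appd_joining A' g1' g'.
have w' := jn_wf_node jn'.
set T := appd_top A A' _ _ in jn *; set J := joins (Defs.tag 0 R1') (Defs.tag 1 (PS (N ++ ns) cs)).
pose rest := T ++ J ++ nodes (Defs.tag 0 R1') ++ map f ns.
have p M : perm_eq (T ++ J ++ nodes (Defs.tag 0 R1') ++ map f (M ++ ns)) (map f M ++ rest).
  rewrite map_cat /rest; apply/permP=> P; rewrite !count_cat; lia.
apply: (why_nf_ax_der (appd_core A' g1' g) jn (ax_der_map _ h) (p N)).
by apply: iso_sym; apply: (iso_front w' (p N')).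
Qed.

(** * From [App] after [Der] to [App_d] *)

Lemma map_node_comp g f n : map_node g (map_node f n) = map_node (g \o f) n.
Proof. by case: n => *; rewrite /= -?map_comp. Qed.

(* After the ax-step, the net of [App (Der R1, R2)] differs from that of
   [App_d (R1, R2)] only by the names of the arcs. *)
Definition der_ren (a : garc) : garc :=
  match a.1 with
  | [:: 0; 3] => ([:: 6], a.2)
  | [:: 0, 0 & x] => (0 :: x, a.2)
  | _ => a
  end.

(** [der_ren] is not injective on all arcs, since it moves arcs onto existing identifiers. This
    domain leaves out the targets [[:: 6]] and the identifiers with a single tag 0; it contains all
    arcs of the reduct. *)
Definition der_ren_dom (a : garc) : bool :=
  match a.1 with
  | [:: 0; 3] | [:: 0, 0 & _] => true
  | 0 :: _ | [:: 6 & _] => false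
  | _ => true
  end.

Definition der_ren_inv (a : garc) : garc :=
  match a.1 with
  | [:: 6] => ([:: 0; 3], a.2)
  | 0 :: x => ([:: 0, 0 & x], a.2)
  | _ => a
  end.

Lemma der_renK a : der_ren_dom a -> der_ren_inv (der_ren a) = a.
Proof.
case: a => -[|[|[|[|[|[|[|[|k]]]]]]] [|[|[|[|[|l]]]] [|m s]]] t //=.
Qed.

Lemma der_ren_type a : (der_ren a).2 = a.2.
Proof.
by case: a => -[|[|k] [|[|[|[|[|l]]]] [|m s]]] t.
Qed.

Lemma app_der_net G A A' R1 R2 : good G (OBang (blimp A A')) R1 ->
  good G (OBang A) R2 -> ax_ders (app_net (der_net R1) R2) (appd_net R1 R2).
Proof.
move=> g1 g2; have gD := good_der g1.
rewrite (app_netE gD g2 erefl) (appd_netE g1 g2 erefl).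
have jn := app_joining A' gD g2; have wX := jn_wf jn.
set D := Defs.tag 0 (der_net R1) in jn wX *.
set S1 := Defs.tag 0 R1; set S2 := Defs.tag 1 R2 in jn wX *.
pose f := fun a : garc => (0 :: a.1, a.2).
have gS1 := good_tag 0 g1; have [e1 ti1 _] := good_concl gS1.
have ot := good_out_type gS1.
(* The arcs [[:: 1]], [[:: 2]] and [[:: 3]] of [der_net], as tagged by [app_net]. *)
pose n1 : garc := ([:: 0; 1], In (negO (blimp A A'))).
pose o1 : garc := ([:: 0; 2], Out (blimp A A')).
pose d1 : garc := ([:: 0; 3], In (IWhy (negO (blimp A A')))).
have oD : out D = o1.
  by rewrite /D /der_net ot /out /= map_rcons last_rcons.
have eiD : ins D = map f (ins S1).
  rewrite /ins /D /der_net ot /= map_rcons size_rcons /= -/(ins S1) -cats1.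
  by rewrite take_size_cat.
have eD : nodes D = [:: Ax n1 o1; Defs.Der n1 d1; Cut d1 (f (out S1))] ++
    map (map_node f) (nodes S1).
  by rewrite /D /der_net ot.
set T := app_top A A' _ _ in jn wX *; set X := pre_net T _ D S2 in jn wX *.
pose n := app_arcs_in A'; pose o := app_out A'; pose t := app_tens A A'.
pose ns := [:: Ax n o; Tens (out S2) n t; Cut d1 (f (out S1))] ++
  joins D S2 ++ map (map_node f) (nodes S1) ++ nodes S2.
have pX : perm_eq (nodes X) ([:: Ax n1 o1; Cut t o1; Defs.Der n1 d1] ++ ns).
  rewrite /X /pre_net /T /app_top oD eD /ns /= -/n -/o -/t.
  by apply/permP=> P; rewrite /= !count_cat /= !count_cat; lia.
apply: (why_nf_ax_der (app_core A' gD g2) jn (ax_der_root o1 n1 t d1) pX).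
set Y := pre_net _ _ _ _; pose Z := PS ([:: Defs.Der t d1] ++ ns) (concl X); rewrite -/Z.
have wZ : well_formed Z.
  exact: (ax_der_wf (ax_der_root o1 n1 t d1)) (iso_wf (iso_front (wf_nodes wX) pX) wX).
have f0 a : a \in arcs S1 -> has_tag 0 a by apply: tag_arcs; exact: good_wf g1.
have t2 := tag_arcs2 g2.
have ren_f a : a \in arcs S1 -> der_ren (f a) = a.
  by move/f0; case: a => -[|[|k] s] u.
have ren_2 a : has_tag 1 a || has_tag 2 a -> der_ren a = a.
  by case: a => -[|[|[|[|k]]] s] u.
have aZ a : a \in arcs Z -> der_ren_dom a.
  have : arcs Z =i concls_of (nodes Z).
    move: wZ; rewrite well_formedE => /and3P[_ /perm_mem e _] b.
    by rewrite /arcs mem_cat -e orbb.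
  move=> ->; rewrite /Z /ns /= [concls_of _](_ : _ = [:: d1; n; o; t] ++
    concls_of (joins D S2 ++ map (map_node f) (nodes S1) ++ nodes S2)) //.
  rewrite !concls_of_cat concls_joins concls_of_map !mem_cat !inE.
  case/or4P=> [/or4P[]/eqP->//|/mapP[i _ ->]//|/mapP[b bS ->]|aS].
    have := f0 b (tails_arcs bS); by case: (b) => -[|[|k] s] u.
  have := t2 a (tails_arcs aS); by case: (a) => -[|[|[|k]] s] u.
have iZ : isog der_ren Z (map_arcs der_ren Z).
  apply: isog_map_arcs => //; last by move=> a _; exact: der_ren_type.
  by apply: (can_in_inj (g := der_ren_inv)) => a /aZ; exact: der_renK.
have iZ' : iso Z (map_arcs der_ren Z) by apply/isoP; exists der_ren.
apply: (iso_trans iZ').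
have cS a : a \in rcons (ins S1) (out S1) -> a \in arcs S1.
  by rewrite -e1; exact: concl_arcs.
have oS : out S1 \in arcs S1 by apply: cS; rewrite mem_rcons mem_head.
have x1 i : i < size (ins S1) -> nth dflt_arc (ins S1) i \in arcs S1.
  by move=> lt; apply: cS; rewrite mem_rcons in_cons mem_nth ?orbT.
have gS2 := good_tag 1 g2; have [e2 _ _] := good_concl gS2.
have sz := size_ins12 gS1 gS2.
have x2 i : i < size (ins S1) -> has_tag 1 (nth dflt_arc (ins S2) i).
  move=> lt; apply: t2; apply: concl_arcs.
  by rewrite e2 mem_rcons in_cons mem_nth ?orbT ?sz.
have ej i : i < size (ins S1) -> der_ren (join_arc D i) = join_arc S1 i.
  by move=> lt; rewrite ren_2 ?orbT // /join_arc eiD (nth_map dflt_arc).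
have eJ : map (map_node der_ren) (joins D S2) = joins S1 S2.
  rewrite /joins -map_comp eiD size_map; apply/eq_in_map=> i.
  rewrite mem_iota => /andP[_ lt] /=; rewrite ej // (nth_map dflt_arc) // ren_f ?x1 //.
  by rewrite ren_2 ?x2.
have ec : map der_ren (rcons (joined D) (app_out A')) = rcons (joined S1) (app_out A').
  rewrite map_rcons /joined -map_comp eiD size_map; congr rcons.
  by apply/eq_in_map=> i; rewrite mem_iota => /andP[_ lt]; exact: ej.
have eM : map (map_node der_ren) (map (map_node f) (nodes S1)) = nodes S1.
  rewrite -map_comp map_id_in // => m mS; rewrite /= map_node_comp.
  rewrite (map_node_in (g := id)) ?map_node_id // => a am.
  by rewrite /= ren_f // (narcs_arcs mS).
have eN : map (map_node der_ren) (nodes S2) = nodes S2.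
  by apply: map_nodes_id => m mS a am; apply: ren_2; rewrite t2 // (narcs_arcs mS).
(* Arcs carry their types, so the double negation in [negO (blimp A A')] has to be simplified for
   the two names to coincide. *)
have ed : der_ren d1 = app_der A A' by rewrite /d1 /app_der /= negOK.
have es2 : der_ren (out S2) = out S2.
  by apply: ren_2; rewrite t2 //; apply: concl_arcs; rewrite e2 mem_rcons mem_head.
have eZ : map_arcs der_ren Z = PS ([:: Defs.Der t (app_der A A'); Ax n o; Tens (out S2) n t;
    Cut (app_der A A') (out S1)] ++ joins S1 S2 ++ nodes S1 ++ nodes S2)
    (rcons (joined S1) (app_out A')).
  rewrite (_ : map_arcs der_ren Z = PS ([:: Defs.Der t (der_ren d1); Ax n o;
      Tens (der_ren (out S2)) n t; Cut (der_ren d1) (der_ren (f (out S1)))] ++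
      map (map_node der_ren) (joins D S2 ++ map (map_node f) (nodes S1) ++ nodes S2))
      (map der_ren (rcons (joined D) (app_out A')))) //.
  by rewrite ec !map_cat eJ eM eN ed es2 ren_f.
have wZ' := wf_nodes (isog_wf iZ wZ); rewrite eZ in wZ' *.
apply: (iso_front wZ') => /=; rewrite -/n -/o -/t.
by apply/permP=> P; rewrite /= !count_cat; lia.
Qed.

(** * Nets of typed terms and the two simulations *)

Lemma good_net G t A : btyped G t A -> good G A (net_of_bterm G t).
Proof.
elim=> {G t A} [G i A Gi|G A t A' _ IH|G t s A A' _ IHt _ IHs|G t A _ IH|G t A _ IH] /=.
- exact: good_var.
- exact: good_lam.
- exact: good_app IHt IHs erefl.
- exact: good_bang.
- exact: good_der.
Qed.

Lemma net_termN G M : net_of_bterm (ctxN G) (termN M) = netN G M.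
Proof.
elim: M G => [i|s M IH|M IHM N IHN] G //=; first by rewrite -IH.
by rewrite IHM IHN.
Qed.

Lemma net_termV G M s : ltyped G M s ->
  ax_ders (net_of_bterm (ctxV G) (termV M)) (netV G M).
Proof.
have refl H t A : btyped H t A -> iso (net_of_bterm H t) (net_of_bterm H t).
  by move/good_net/good_wf/iso_refl.
elim=> {G M s} [G i s Gi|G s M t tM IH|G M N s t tM IHM tN IHN] /=.
- apply: ax_ders_iso; apply: (refl (ctxV G) (BProm (BVar i)) (OBang (typV s))).
  by apply: bt_prom; apply: bt_var; exact: onth_map_Some.
- have gM := good_net (termV_typed tM).
  exact: bang_net_ax_ders (good_lam gM) (lam_net_ax_ders gM IH).
- have gM := good_net (termV_typed tM); have gN := good_net (termV_typed tN).
  (* The step at the root comes first, on the unreduced arguments. These are then reduced inside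
     [App_d], so congruence is called for [App_d] only, not for [App] or [Der]. *)
  apply: ax_ders_trans (app_der_net gM gN) _.
  exact: appd_net_ax_ders gM gN IHM IHN.
Qed.

Theorem theorem45 (G : seq stype) (M : lterm) (s : stype)
    (typed : ltyped G M s) :
  iso (net_of_bterm (ctxN G) (termN M)) (netN G M) /\
  steps ax_rule (net_of_bterm (ctxV G) (termV M)) (netV G M).
Proof.
have wN := good_wf (good_net (termN_typed typed)).
have wV := good_wf (good_net (termV_typed typed)).
split; first by rewrite -net_termN; exact: iso_refl.
exact: ax_ders_steps wV (net_termV typed).
Qed.
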